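(* In the stochastic contextual linear bandit setting described in the context, suppose that the set of optimal arms $\{x_1^*,\ldots,x_M^*\}$ spans $\mathbb R^d$. Then $\mathcal C(\theta,\mathcal A^1,\ldots,\mathcal A^M)=0$. Consequently, if moreover $T_x^m(\Delta)$ is uniquely defined and $T_x^m(\cdot)$ is continuous at the true gap vector $\Delta$ for all $m\in[M]$ and $x\in\mathcal A^m$, the policy $\pi_{\mathrm{oam}}$ (Optimal Allocation Matching, described in the context) with $\varepsilon_t=1/\log(\log(t))$ satisfies $$\liminf_{n\to\infty}\frac{R_\theta^{\pi_{\mathrm{oam}}}(n)}{\log(n)}=0.$$
   Context: Setting (stochastic $K$-armed contextual linear bandit). There are $M$ contexts; for each $m\in[M]$ there is a known finite action set $\mathcal A^m\subset\mathbb R^d$ with $|\mathcal A^m|=K$, such that $\mathcal A^m$ spans $\mathbb R^d$ and $\|x\|_2\le 1$ for all $x\in\bigcup_m\mathcal A^m$. The parameter $\theta\in\mathbb R^d$ is fixed and unknown. For horizon $n$, contexts $c_1,\dots,c_n$ are drawn i.i.d. from an unknown distribution $p$ on $[M]$ with $p(m)>0$ for all $m$. In round $t$ the learner sees $c_t$, chooses $X_t\in\mathcal A^{c_t}$ and receives $Y_t=\langle X_t,\theta\rangle+\eta_t$, with $\eta_t$ independent standard Gaussians. The optimal arm of context $m$ is $x_m^*=\arg\max_{x\in\mathcal A^m}\langle x,\theta\rangle$. Gaps: $\Delta_x^m=\langle x_m^*-x,\theta\rangle$ for $x\in\mathcal A^m$. The regret is $R_\theta^\pi(n)=\mathbb E\big[\sum_{t=1}^n\langle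 x_{c_t}^*,\theta\rangle-\sum_{t=1}^nY_t\big]$. Write $\|x\|_A=\sqrt{x^\top Ax}$. The constant $\mathcal C(\theta,\mathcal A^1,\dots,\mathcal A^M)$ is the optimal value of $\inf_{\alpha_{x,m}\in[0,\infty]}\sum_{m}\sum_{x\in\mathcal A^m}\alpha_{x,m}\Delta_x^m$ subject to $x^\top\big(\sum_{m'}\sum_{y\in\mathcal A^{m'}}\alpha_{y,m'}yy^\top\big)^{-1}x\le(\Delta_x^m)^2/2$ for every $m$ and every $x\in\mathcal A^m$ with $\Delta_x^m>0$. Conventions: $\infty\times0=0$; for weights in $[0,\infty]$, inverses are defined by passing to the limit: $x^\top(\sum\alpha_{y,m'}yy^\top)^{-1}x:=\lim_{L\to\infty}x^\top(\sum\min(\alpha_{y,m'},L)yy^\top)^{-1}x$, the truncated matrices being required to be invertible for large $L$. Let $f_{n,\delta}=2(1+1/\log n)\log(1/\delta)+cd\log(d\log n)$ and $f_n=f_{n,1/n}$. Here $c>0$ is an absolute constant, chosen so that for every $\delta\in(0,1)$, $\mathbb P\big(\exists t\ge d,\exists x\in\bigcup_m\mathcal A^m:|\langle x,\hat\theta_t-\theta\rangle|\ge\|x\|_{G_t^{-1}}f_{n,\delta}^{1/2}\big)\le\delta$, with $\hat\theta_t,G_t$ as below. Allocation map: for $\tilde\Delta=(\tilde\Delta_x^m)_{x\in\mathcal A^m,m\in[M]}$ with entries in $[0,\infty)$, $T(\tilde\Delta)=(T_x^m(\tilde\Delta))_{x,m}$ denotes a solution of $$\min_{(T_x^m)\in[0,\infty]}\sum_m\sum_{x\in\mathcal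 A^m}T_x^m\tilde\Delta_x^m\quad\text{s.t. } \|x\|^2_{H_T^{-1}}\le\frac{(\tilde\Delta_x^m)^2}{f_n}\ \ \forall x\in\mathcal A^m,\ m\in[M],$$ with $H_T=\sum_m\sum_{x\in\mathcal A^m}T_x^mxx^\top$ invertible. Statistics: $N_x(t)=\sum_{s=1}^t\mathbb I(X_s=x)$; $G_t=\sum_{s=1}^tX_sX_s^\top$; $\hat\theta_t=G_t^{-1}\sum_{s=1}^tX_sY_s$; $\hat\Delta_x^m(t)=\max_{y\in\mathcal A^m}\langle y-x,\hat\theta_t\rangle$; $\hat\Delta(t)=(\hat\Delta_x^m(t))_{x,m}$; $\hat\Delta_{\min}(t)=\min\{\hat\Delta_x^m(t):m\in[M],x\in\mathcal A^m,\hat\Delta_x^m(t)>0\}$. Policy $\pi_{\mathrm{oam}}$ for horizon $n$ (ties in $\arg\min$/$\arg\max$ broken arbitrarily): Initialisation: for $t=1,\dots,d$, play any $X_t\in\mathcal A^{c_t}$ not in the span of $\{X_1,\dots,X_{t-1}\}$. Set the exploration counter $s(d)=0$. For $t=d+1,\dots,n$: let $D_x(t)=\min\{T_x^{c_t}(\hat\Delta(t-1)),\,f_n/\hat\Delta_{\min}^2(t-1)\}$ for $x\in\mathcal A^{c_t}$. (1) Exploitation: if $\|x\|^2_{G_{t-1}^{-1}}\le\max\{\hat\Delta_{\min}^2(t-1)/f_n,\ (\hat\Delta_x^{c_t}(t-1))^2/f_n\}$ for all $x\in\mathcal A^{c_t}$, play $X_t=\arg\max_{x\in\mathcal A^{c_t}}x^\top\hat\theta_{t-1}$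 and set $s(t)=s(t-1)$. (2) Exploration: otherwise set $s(t)=s(t-1)+1$ and: (2a) if $N_x(t-1)\ge D_x(t)$ for all $x\in\mathcal A^{c_t}$, play $X_t=\arg\max_{x\in\mathcal A^{c_t}}\big(x^\top\hat\theta_{t-1}+\sqrt{f_{n,1/s(t)^2}}\,\|x\|_{G_{t-1}^{-1}}\big)$; (2b) otherwise let $b_1=\arg\min_{x\in\mathcal A^{c_t}}N_x(t-1)/D_x(t)$ (ratios with zero denominator counted as $+\infty$) and $b_2=\arg\min_{x\in\mathcal A^{c_t}}N_x(t-1)$; play $X_t=b_2$ if $N_{b_2}(t-1)\le\varepsilon_t\,s(t-1)$, and $X_t=b_1$ otherwise. *)

(* Defs.v *)
From HB Require Import structures.
From mathcomp Require Import all_boot all_order all_algebra.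
From mathcomp Require Import all_classical all_reals all_analysis.

Set Implicit Arguments.
Unset Strict Implicit.
Unset Printing Implicit Defensive.

Import Order.TTheory GRing.Theory Num.Theory.
Import numFieldNormedType.Exports.

Local Open Scope classical_set_scope.
Local Open Scope ring_scope.

(* The K-element action set of context m is enumerated (injectively) by
   [A m : 'I_K -> 'cV_d], so that a pair (m, x) with x in the action set of m
   is represented by a pair (m, i) : 'I_M * 'I_K. *)

Section LinearAlgebra.
Variables (R : realType) (d : nat).
Implicit Types (x y : 'cV[R]_d) (H : 'M[R]_d).

Definition dotp x y : R := (x^T *m y) 0 0.

Definition norm2 x : R := Num.sqrt (dotp x x).

Definition sqnorm_inv H x : R := (x^T *m invmx H *m x) 0 0.

Definition norm_inv H x : R := Num.sqrt (sqnorm_inv H x).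

Definition spans (s : seq 'cV[R]_d) : Prop := span s = fullv.

End LinearAlgebra.

Section Allocation.
Variables (R : realType) (d K M : nat) (A : 'I_M -> 'I_K -> 'cV[R]_d).

Record action_sets : Prop := ActionSets {
  action_inj : forall m, injective (A m) ;
  action_spans : forall m, spans [seq A m i | i <- enum 'I_K] ;
  action_norm : forall m i, norm2 (A m i) <= 1 }.

Definition optimal_arms (theta : 'cV[R]_d) (xstar : 'I_M -> 'I_K) : Prop :=
  forall m i, dotp (A m i) theta <= dotp (A m (xstar m)) theta.

Definition gaps (theta : 'cV[R]_d) (xstar : 'I_M -> 'I_K) : 'M[R]_(M, K) :=
  \matrix_(m, i) dotp (A m (xstar m) - A m i) theta.

Implicit Types (alpha : 'I_M -> 'I_K -> \bar R) (D : 'M[R]_(M, K)).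

Definition trunc_info alpha (L : R) : 'M[R]_d :=
  \sum_m \sum_i fine (Order.min (alpha m i) L%:E) *: (A m i *m (A m i)^T).

Definition invertible_info alpha : Prop :=
  \forall L \near +oo, trunc_info alpha L \in unitmx.

Definition sqnorm_info_inv alpha (x : 'cV[R]_d) : R :=
  lim (sqnorm_inv (trunc_info alpha L) x @[L --> +oo]).

(* In [\bar R] the product satisfies +oo * 0 = 0. *)
Definition cost alpha D : \bar R :=
  (\sum_m \sum_i alpha m i * (D m i)%:E)%E.

Definition C_feasible (D : 'M[R]_(M, K)) alpha : Prop :=
  [/\ forall m i, (0 <= alpha m i)%E,
      invertible_info alpha &
      forall m i, 0 < D m i ->
        sqnorm_info_inv alpha (A m i) <= D m i ^+ 2 / 2].

Definition C_const (theta : 'cV[R]_d) (xstar : 'I_M -> 'I_K) : \bar R :=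
  ereal_inf [set cost alpha (gaps theta xstar) |
    alpha in C_feasible (gaps theta xstar)].

Definition alloc_feasible (f : R) D alpha : Prop :=
  [/\ forall m i, (0 <= alpha m i)%E,
      invertible_info alpha &
      forall m i, sqnorm_info_inv alpha (A m i) <= D m i ^+ 2 / f].

Definition alloc_solution (f : R) D alpha : Prop :=
  alloc_feasible f D alpha /\
  forall beta, alloc_feasible f D beta -> (cost alpha D <= cost beta D)%E.

Definition nonneg_gaps : set 'M[R]_(M, K) :=
  [set D | forall m i, 0 <= D m i].

End Allocation.

Definition f_conf (R : realType) (c : R) (d n : nat) (delta : R) : R :=
  2 * (1 + 1 / ln n%:R) * ln (1 / delta) + c * d%:R * ln (d%:R * ln n%:R).

(* The policy acts on one trajectory: contexts [ctx t], chosen arms [arm t]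
   and rewards [rew t], the rounds being t = 1, ..., n. *)
Section Trajectory.
Variables (R : realType) (d K M : nat) (A : 'I_M -> 'I_K -> 'cV[R]_d).
Variables (ctx : nat -> 'I_M) (arm : nat -> 'I_K) (rew : nat -> R).

Definition action (t : nat) : 'cV[R]_d := A (ctx t) (arm t).

Definition pulls (x : 'cV[R]_d) (t : nat) : nat :=
  (\sum_(1 <= s < t.+1) (action s == x))%N.

Definition design (t : nat) : 'M[R]_d :=
  \sum_(1 <= s < t.+1) action s *m (action s)^T.

Definition theta_hat (t : nat) : 'cV[R]_d :=
  invmx (design t) *m \sum_(1 <= s < t.+1) rew s *: action s.

(* The default 0 of the maximum is harmless: the term j = i is 0. *)
Definition gaps_hat (t : nat) : 'M[R]_(M, K) :=
  \matrix_(m, i) \big[Num.max/0]_(j < K) dotp (A m j - A m i) (theta_hat t).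

(* This is +oo if no estimated gap is positive. *)
Definition gap_hat_min (t : nat) : \bar R :=
  \big[Order.min/+oo%E]_(u : 'I_M * 'I_K | 0 < gaps_hat t u.1 u.2)
    (gaps_hat t u.1 u.2)%:E.

Definition exploits (f : R) (t : nat) : bool :=
  [forall i : 'I_K,
    ((sqnorm_inv (design t.-1) (A (ctx t) i))%:E <=
     Order.max (gap_hat_min t.-1 * gap_hat_min t.-1 * (f^-1)%:E)
               (gaps_hat t.-1 (ctx t) i ^+ 2 / f)%:E)%E].

Definition explorations (f : R) (t : nat) : nat :=
  (\sum_(d.+1 <= s < t.+1) ~~ exploits f s)%N.

(* Since [fine +oo = 0] and [f / 0 = 0], the second bound is 0 = f / (+oo)^2
   when [gap_hat_min] is +oo. *)
Definition demand (f : R) (T : 'M[R]_(M, K) -> 'I_M -> 'I_K -> \bar R)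
    (t : nat) (i : 'I_K) : \bar R :=
  Order.min (T (gaps_hat t.-1) (ctx t) i)
            (f / fine (gap_hat_min t.-1) ^+ 2)%:E.

Definition pull_ratio f T (t : nat) (i : 'I_K) : \bar R :=
  if demand f T t i == 0%E then +oo%E
  else ((pulls (A (ctx t) i) t.-1)%:R / fine (demand f T t i))%:E.

Definition greedy (t : nat) (i : 'I_K) : Prop :=
  forall j, dotp (A (ctx t) j) (theta_hat t.-1) <=
            dotp (A (ctx t) i) (theta_hat t.-1).

Definition ucb_index (f : R) (t : nat) (i : 'I_K) : R :=
  dotp (A (ctx t) i) (theta_hat t.-1) +
  Num.sqrt f * norm_inv (design t.-1) (A (ctx t) i).

(* Arg min and arg max are relations, so ties may be broken in any way. *)
Definition oam_explore (f : R) (f_delta : R -> R) T (eps : nat -> R)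
    (t : nat) : Prop :=
  let N i := pulls (A (ctx t) i) t.-1 in
  if [forall i, (demand f T t i <= (N i)%:R%:E)%E] then
    let g := f_delta (1 / (explorations f t)%:R ^+ 2) in
    (forall j, ucb_index g t j <= ucb_index g t (arm t)) : Prop
  else
    exists b1 b2 : 'I_K,
      [/\ forall j, (pull_ratio f T t b1 <= pull_ratio f T t j)%E,
          forall j, (N b2 <= N j)%N &
          arm t = if (N b2)%:R <= eps t * (explorations f t.-1)%:R
                  then b2 else b1].

Definition follows_oam (n : nat) (c : R) T (eps : nat -> R) : Prop :=
  let f_delta := f_conf c d n in
  let f := f_delta (1 / n%:R) in
  forall t, (1 <= t <= n)%N ->
    if (t <= d)%N then
      action t \notin span [seq action s | s <- iota 1 t.-1] : Prop
    else if exploits f t then greedy t (arm t)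
    else oam_explore f f_delta T eps t.

End Trajectory.

Section Events.
Variables (T : Type) (d : measure_display) (U : measurableType d).

Definition events_of (X : T -> U) : set (set T) :=
  [set X @^-1` B | B in measurable].

Definition events_of_fin (I : Type) (X : T -> I) : set (set T) :=
  [set X @^-1` B | B in setT].

End Events.

Section History.
Variables (R : realType) (K M : nat) (T : Type).
Variables (ctx : nat -> T -> 'I_M) (arm : nat -> T -> 'I_K).
Variable (rew : nat -> T -> R).

Definition past_events (t : nat) : set (set T) :=
  \bigcup_(s in [set s | (1 <= s < t)%N])
    (events_of_fin (ctx s) `|` events_of_fin (arm s) `|` events_of (rew s)).

Definition past (t : nat) : set (set T) := <<s past_events t>>.

Definition past_and_choice (t : nat) : set (set T) :=
  <<s past_events t `|` (events_of_fin (ctx t) `|` events_of_fin (arm t))>>.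

End History.

(* An interaction of a (possibly randomised) non-anticipating learner with the
   bandit over n rounds.  [ctx_law] says that c_t is drawn from p independently
   of the earlier rounds, and [noise_law] that eta_t is standard Gaussian and
   independent of the earlier rounds, of c_t and of X_t.  In particular the
   contexts are i.i.d., the noises are i.i.d., and the two families are
   independent. *)
Structure bandit_run (R : realType) (d K M : nat)
    (A : 'I_M -> 'I_K -> 'cV[R]_d) (theta : 'cV[R]_d) (p : 'I_M -> R)
    (n : nat) := BanditRun {
  run_display : measure_display ;
  run_space : measurableType run_display ;
  run_prob : probability run_space R ;
  run_ctx : nat -> run_space -> 'I_M ;
  run_arm : nat -> run_space -> 'I_K ;
  run_noise : nat -> {RV run_prob >-> R} ;
  run_rew := fun t w =>
    dotp (A (run_ctx t w) (run_arm t w)) theta + run_noise t w ;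
  ctx_measurable : forall t m, measurable (run_ctx t @^-1` [set m]) ;
  arm_measurable : forall t i, measurable (run_arm t @^-1` [set i]) ;
  ctx_law : forall t, (1 <= t <= n)%N ->
    forall E, past run_ctx run_arm run_rew t E ->
    forall m, run_prob (E `&` run_ctx t @^-1` [set m]) =
              (run_prob E * (p m)%:E)%E ;
  noise_law : forall t, (1 <= t <= n)%N ->
    forall E, past_and_choice run_ctx run_arm run_rew t E ->
    forall B : set R, measurable B ->
      run_prob (E `&` run_noise t @^-1` B) =
      (run_prob E * normal_prob 0 1 B)%E }.

Arguments run_ctx {R d K M A theta p n} b.
Arguments run_arm {R d K M A theta p n} b.
Arguments run_rew {R d K M A theta p n} b.
Arguments run_noise {R d K M A theta p n} b.
Arguments run_prob {R d K M A theta p n} b.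
Arguments run_space {R d K M A theta p n} b.

Section Run.
Variables (R : realType) (d K M : nat) (A : 'I_M -> 'I_K -> 'cV[R]_d).
Variables (theta : 'cV[R]_d) (p : 'I_M -> R) (n : nat).
Variable (r : bandit_run A theta p n).

Definition run_follows_oam (c : R) T (eps : nat -> R) : Prop :=
  forall w : run_space r,
    follows_oam A (run_ctx r ^~ w) (run_arm r ^~ w) (run_rew r ^~ w)
      n c T eps.

Definition regret (xstar : 'I_M -> 'I_K) : \bar R :=
  expectation (run_prob r) (fun w =>
    \sum_(1 <= t < n.+1)
      dotp (A (run_ctx r t w) (xstar (run_ctx r t w))) theta -
    \sum_(1 <= t < n.+1) run_rew r t w).

(* Rounds stop at the horizon n, and f_{n,delta} depends on n, so t ranges over
   d, ..., n.  The zero action is excluded because both sides of the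
   inequality vanish for it, so its event would have probability 1. *)
Definition confidence_failure (c delta : R) : set (run_space r) :=
  [set w | exists t m i,
    let G := design A (run_ctx r ^~ w) (run_arm r ^~ w) t in
    let that := theta_hat A (run_ctx r ^~ w) (run_arm r ^~ w)
                  (run_rew r ^~ w) t in
    [/\ (d <= t <= n)%N, A m i != 0 &
        norm_inv G (A m i) * Num.sqrt (f_conf c d n delta) <=
        `|dotp (A m i) (that - theta)|]].

Definition confidence (c : R) : Prop :=
  forall delta, 0 < delta < 1 ->
    (run_prob r (confidence_failure c delta) <= delta%:E)%E.

End Run.

(* Main.v *)
(** The optimal arms span the space, so putting infinite weight on them makes
    every norm [x^T H^-1 x] vanish at cost 0; hence the constant is 0, and
    uniqueness of the optimal allocation forces each context to have a single
    optimal arm. Moreover, whenever the estimated optimal arms are the true ones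
    the optimal allocation vanishes on all other arms, so that step (2b) of the
    policy plays an optimal arm, up to forced exploration.

    Write [L = ln n]. On the confidence event of level [1/n], the suboptimal
    rounds are: wrong exploitations, at most [O(L)] of them, and none on the
    confidence event of level [1/L]; UCB rounds, [O(ln s + ln L)] of them up to
    the failures of the confidence events of level [1/s^2]; rounds (2b) with a
    wrong ranking, which need [eps_t s(t)] below the confidence radius; and forced
    exploration, [o(s(t)) + O(1)] of them. Once every optimal arm has been pulled
    [C L] times exploration stops. Each context occurs linearly often, so this
    happens after [O(L)] rounds if the confidence event of level [1/L] holds and
    few UCB failures occur, in which case only [o(L)] rounds are suboptimal;
    otherwise, which has probability [O(1/L)], the number of suboptimal rounds is
    still [O(L ln L)] plus a multiple of the number of UCB failures, whose
    expectation is bounded. *)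

Require Import Defs.
From HB Require Import structures.
From mathcomp Require Import all_boot all_order all_algebra.
From mathcomp Require Import all_classical all_reals all_analysis.
From mathcomp Require Import measurable_realfun ring lra.

Set Implicit Arguments.
Unset Strict Implicit.
Unset Printing Implicit Defensive.

Import Order.TTheory GRing.Theory Num.Theory.
Import numFieldNormedType.Exports.

Local Open Scope classical_set_scope.
Local Open Scope ring_scope.

(** * Norms of the design matrix *)

(** The confidence event of level 1/n alone only bounds the wrong exploitations by a multiple of L,
    the very order of the normalisation. Level 1/L is the compromise: its squared radius is of order
    ln L, eventually below f_n / 4, which halves every error in the exploitation test and excludes
    mistakes, while its failure probability turns a cost L ln L into ln L. Both arguments compare
    errors with a positive estimated gap, and break down when the greedy arm ties with the optimal
    one, whose estimated gap is then 0; ties are therefore shown to be negligible, because Gaussian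
    noise has no atoms. Randomness enters through a pointwise bound of the regret by finitely many
    weighted indicators; all else is deterministic, on a single trajectory. An excess of UCB
    failures is charged to the failing levels themselves, as in the Markov inequality. The result is
    a full limit. *)

Section Dot.
Variables (R : realType) (d : nat).
Implicit Types (x y z w : 'cV[R]_d) (G H : 'M[R]_d).

Lemma dotpE x y : dotp x y = \sum_k x k 0 * y k 0.
Proof. by rewrite /dotp mxE; apply: eq_bigr => k _; rewrite mxE. Qed.

Lemma dotpC x y : dotp x y = dotp y x.
Proof. by rewrite !dotpE; apply: eq_bigr => k _; rewrite mulrC. Qed.

Lemma dotpDl x y z : dotp (x + y) z = dotp x z + dotp y z.
Proof. by rewrite /dotp linearD mulmxDl mxE. Qed.

Lemma dotpBl x y z : dotp (x - y) z = dotp x z - dotp y z.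
Proof. by rewrite /dotp linearB mulmxBl !mxE. Qed.

Lemma dotpZl a x z : dotp (a *: x) z = a * dotp x z.
Proof. by rewrite /dotp linearZ -scalemxAl mxE. Qed.

Lemma dotp0l x : dotp 0 x = 0.
Proof. by rewrite /dotp linear0 mul0mx mxE. Qed.

Lemma dotpBr x y z : dotp x (y - z) = dotp x y - dotp x z.
Proof. by rewrite !(dotpC x) dotpBl. Qed.

Lemma dotp_suml (I : Type) (s : seq I) (P : pred I) (F : I -> 'cV[R]_d) z :
  dotp (\sum_(i <- s | P i) F i) z = \sum_(i <- s | P i) dotp (F i) z.
Proof.
elim/big_rec2: _ => [|i u v _ <-]; first exact: dotp0l.
by rewrite dotpDl.
Qed.

Lemma dotp_self_eq0 x : dotp x x = 0 -> x = 0.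
Proof.
rewrite dotpE => /eqP; rewrite psumr_eq0 => [|k _]; last exact: sqr_ge0.
move=> /allP h; apply/matrixP => k j; rewrite ord1 mxE.
by have := h k (mem_index_enum _); rewrite mulf_eq0 orbb => /eqP.
Qed.

Lemma dotp_outer x w : dotp w (x *m x^T *m w) = dotp x w ^+ 2.
Proof.
rewrite {1}/dotp -mulmxA mulmxA mxE big_ord1 expr2 !ord1.
by congr (_ * _); exact: dotpC.
Qed.

Lemma dotp_mulmx_suml (I : Type) (s : seq I) (P : pred I) (F : I -> 'M[R]_d) w :
  dotp w ((\sum_(i <- s | P i) F i) *m w) =
  \sum_(i <- s | P i) dotp w (F i *m w).
Proof.
rewrite mulmx_suml dotpC dotp_suml.
by apply: eq_bigr => i _; rewrite dotpC.
Qed.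

(** A row of the kernel of G^T, once transposed, is a vector w with G w = 0, so the form vanishes at
    w. Invertibility of design matrices and of allocation matrices is obtained in this way. *)
Lemma unitmx_definite G : (forall w, dotp w (G *m w) = 0 -> w = 0) ->
  G \in unitmx.
Proof.
move=> h; rewrite -unitmx_tr -row_free_unit -kermx_eq0; apply/eqP.
apply/row_matrixP => i; rewrite row0.
have k0 : row i (kermx G^T) *m G^T = 0.
  by apply/sub_kermxP; exact: row_sub.
have /(congr1 trmx) := k0; rewrite trmx_mul trmxK trmx0 => e.
apply: trmx_inj; rewrite trmx0; apply: h.
by rewrite e /dotp mulmx0 mxE.
Qed.

Lemma sqnorm_inv_dotp G x : sqnorm_inv G x = dotp x (invmx G *m x).
Proof. by rewrite /sqnorm_inv /dotp mulmxA. Qed.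

Lemma spans_coef (I : finType) (y : I -> 'cV[R]_d) :
  spans [seq y i | i <- enum I] ->
  forall x, exists c : I -> R, x = \sum_i c i *: y i.
Proof.
move=> sp x; have : x \in <<[seq y i | i <- enum I]>>%VS by rewrite sp memvf.
rewrite -[in X in X -> _](in_tupleE [seq y i | i <- enum I]).
move=> /coord_span e.
(* [coord] is indexed by positions in the tuple; [enum_rank] transports the coordinates to I. *)
have sz : size [seq y i | i <- enum I] = #|I| by rewrite size_map cardE.
exists (fun i => coord (in_tuple [seq y i | i <- enum I])
                   (cast_ord (esym sz) (enum_rank i)) x).
rewrite [LHS]e (reindex (fun i : I => cast_ord (esym sz) (enum_rank i))) /=.
  apply: eq_bigr => i _; congr (_ *: _).
  by rewrite (nth_map i) -?cardE ?ltn_ord// nth_enum_rank.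
exists (fun k => enum_val (cast_ord sz k)) => k _.
  by rewrite cast_ordKV enum_rankK.
by rewrite enum_valK cast_ordK.
Qed.

Lemma spans_dotp_eq0 (I : finType) (y : I -> 'cV[R]_d) w :
  spans [seq y i | i <- enum I] -> (forall i, dotp (y i) w = 0) -> w = 0.
Proof.
move=> sp h; have [c e] := spans_coef sp w.
apply: dotp_self_eq0; rewrite {1}e dotp_suml big1// => i _.
by rewrite dotpZl h mulr0.
Qed.

Lemma sqnorm_inv_ge0 G x : G \in unitmx ->
  (forall w, 0 <= dotp w (G *m w)) -> 0 <= sqnorm_inv G x.
Proof.
move=> uG pG; rewrite sqnorm_inv_dotp dotpC.
by rewrite -[X in dotp _ X](mulKVmx uG) pG.
Qed.

(* With w = G^-1 x, the norm is Q = w^T G w = sum_j c_j <y_j, w>, and each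
   <y_j, w> is at most sqrt (Q / N). *)
Lemma sqnorm_inv_le (I : finType) (y : I -> 'cV[R]_d) (c : I -> R) G x N :
  G \in unitmx -> x = \sum_i c i *: y i -> 0 < N ->
  (forall i w, N * dotp (y i) w ^+ 2 <= dotp w (G *m w)) ->
  (forall w, 0 <= dotp w (G *m w)) ->
  sqnorm_inv G x <= (\sum_i `|c i|) ^+ 2 / N.
Proof.
move=> uG ex N0 h pG.
have Q0 := sqnorm_inv_ge0 x uG pG.
set Q := sqnorm_inv G x in Q0 *; set w := invmx G *m x.
have eQ : dotp w (G *m w) = Q.
  by rewrite /w mulKVmx// /Q sqnorm_inv_dotp dotpC.
set q := Num.sqrt (Q / N).
have QN : 0 <= Q / N by rewrite divr_ge0// ltW.
have yq i : `|dotp (y i) w| <= q.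
  rewrite /q -sqrtr_sqr ler_sqrt// ler_pdivlMr// mulrC -eQ; exact: h.
have Qle : Q <= (\sum_i `|c i|) * q.
  rewrite /Q sqnorm_inv_dotp -/w {1}ex dotp_suml mulr_suml.
  apply: ler_sum => i _; rewrite dotpZl.
  by rewrite (le_trans (ler_norm _))// normrM ler_wpM2l.
(* For Q > 0, squaring gives Q^2 <= (sum |c_i|)^2 Q / N, and one factor Q cancels. *)
have [->|Qn0] := eqVneq Q 0.
  by rewrite divr_ge0 ?sqr_ge0// ltW.
have Qp : 0 < Q by rewrite lt_def Qn0.
have q2 : q ^+ 2 = Q / N by rewrite sqr_sqrtr.
have : Q ^+ 2 <= ((\sum_i `|c i|) * q) ^+ 2.
  rewrite ler_sqr ?nnegrE//; exact: le_trans Qle.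
by rewrite exprMn q2 expr2 mulrA mulrAC ler_pM2r.
Qed.

Lemma sqnorm_invZ a G x : a != 0 -> G \in unitmx ->
  sqnorm_inv (a *: G) x = a^-1 * sqnorm_inv G x.
Proof.
move=> a0 uG; rewrite /sqnorm_inv invmxZ ?unitmxZ ?unitfE//.
by rewrite -scalemxAr -scalemxAl mxE.
Qed.

End Dot.

Section Design.
Variables (R : realType) (d K M : nat) (A : 'I_M -> 'I_K -> 'cV[R]_d).
Variables (ctx : nat -> 'I_M) (arm : nat -> 'I_K).
Local Notation action := (action A ctx arm).
Local Notation design := (design A ctx arm).
Local Notation pulls := (pulls A ctx arm).

Lemma dotp_design t w :
  dotp w (design t *m w) = \sum_(1 <= s < t.+1) dotp (action s) w ^+ 2.
Proof.
rewrite /design dotp_mulmx_suml; apply: eq_bigr => s _.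
exact: dotp_outer.
Qed.

Lemma dotp_design_ge0 t w : 0 <= dotp w (design t *m w).
Proof. by rewrite dotp_design sumr_ge0// => s _; rewrite sqr_ge0. Qed.

Lemma pulls_dotp_design x t w :
  (pulls x t)%:R * dotp x w ^+ 2 <= dotp w (design t *m w).
Proof.
rewrite dotp_design /pulls natr_sum mulr_suml; apply: ler_sum => s _.
case: eqP => [->|_]; first by rewrite mul1r.
by rewrite mul0r sqr_ge0.
Qed.

Hypothesis indep : forall t, (1 <= t <= d)%N ->
  action t \notin span [seq action s | s <- iota 1 t.-1].

(** Each initial action avoids the span of its predecessors, so its line is in direct sum with that
    span and the dimension grows by one. *)
Lemma dim_span_actions t : (t <= d)%N ->
  \dim (span [seq action s | s <- iota 1 t]) = t.
Proof.
elim: t => [|t IH] td; first by rewrite span_nil dimv0.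
have := indep (t := t.+1); rewrite td => /(_ isT).
rewrite [t.+1.-1]/= => nin.
have -> : iota 1 t.+1 = iota 1 t ++ [:: t.+1] by rewrite -{1}(addn1 t) iotaD add1n.
rewrite map_cat span_cat span_seq1.
have := dim_vline (action t.+1).
have -> : (action t.+1 != 0).
  by apply: contra nin => /eqP ->; rewrite mem0v.
move=> /= d1.
suff cap0 : (span [seq action s | s <- iota 1 t] :&: <[action t.+1]> = 0)%VS.
  by rewrite dimv_disjoint_sum// d1 IH ?addn1// ltnW.
apply/eqP; rewrite -subv0; apply/subvP => v; rewrite memv_cap => /andP[vs].
move=> /vlineP[k ek]; move: vs; rewrite ek.
have [->|k0] := eqVneq k 0; first by move=> _; rewrite scale0r mem0v.
by rewrite rpredZeq (negbTE k0) /= (negbTE nin).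
Qed.

(** The form w^T G_t w is a sum of squares; if it vanishes, w is orthogonal to all actions played,
    and the first d of them already span. *)
Lemma design_unitmx t : (d <= t)%N -> design t \in unitmx.
Proof.
move=> dt; apply: unitmx_definite => w.
rewrite dotp_design => /eqP; rewrite psumr_eq0 => [|s _]; last exact: sqr_ge0.
move=> /allP h.
have full : span [seq action s | s <- iota 1 d] = fullv.
  apply/eqP; rewrite eqEdim subvf dim_span_actions//.
  by rewrite dimvf /dim /= muln1.
have : w \in span [seq action s | s <- iota 1 d] by rewrite full memvf.
rewrite -(in_tupleE [seq action s | s <- iota 1 d]) => /coord_span e.
apply: dotp_self_eq0; rewrite {1}e dotp_suml big1// => i _.
rewrite dotpZl (nth_map 0%N) ?size_iota; last first.
  by have := ltn_ord i; rewrite {2}size_map size_iota.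
have id : (i < d)%N by have := ltn_ord i; rewrite {2}size_map size_iota.
rewrite nth_iota//.
have := h (1 + i)%N; rewrite mem_index_iota add1n /= !ltnS.
rewrite (leq_trans id dt) sqrf_eq0 => /(_ isT)/eqP ->.
by rewrite mulr0.
Qed.

Lemma sqnorm_design_ge0 t x : (d <= t)%N -> 0 <= sqnorm_inv (design t) x.
Proof.
by move=> dt; apply: sqnorm_inv_ge0; [exact: design_unitmx|exact: dotp_design_ge0].
Qed.

Lemma sqnorm_design_le (I : finType) (y : I -> 'cV[R]_d) (c : I -> R) x t N :
  (d <= t)%N -> x = \sum_i c i *: y i -> 0 < N ->
  (forall i, N <= (pulls (y i) t)%:R) ->
  sqnorm_inv (design t) x <= (\sum_i `|c i|) ^+ 2 / N.
Proof.
move=> dt ex N0 hN; apply: (sqnorm_inv_le (y := y)) => //.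
- exact: design_unitmx.
- move=> i w; apply: le_trans (pulls_dotp_design (y i) t w).
  by rewrite ler_wpM2r ?sqr_ge0.
- exact: dotp_design_ge0.
Qed.

Lemma sqnorm_design_le1 x t N : (d <= t)%N -> 0 < N -> N <= (pulls x t)%:R ->
  sqnorm_inv (design t) x <= N^-1.
Proof.
move=> dt N0 hN.
have := @sqnorm_design_le 'I_1 (fun=> x) (fun=> 1) x t N dt.
by rewrite !big_ord1 normr1 expr1n scale1r div1r; apply.
Qed.

End Design.

(** * Infinite allocations *)

Section Alloc.
Variables (R : realType) (d K M : nat) (A : 'I_M -> 'I_K -> 'cV[R]_d).
Variables (theta : 'cV[R]_d) (xstar : 'I_M -> 'I_K).
Hypothesis hspan : spans [seq A m (xstar m) | m <- enum 'I_M].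
Implicit Types (P : 'I_M -> 'I_K -> bool) (D : 'M[R]_(M, K)).

(** P is left general because two choices are compared later: the designated optimal arms alone, and
    all arms of gap 0. *)
Definition infinite_alloc P (m : 'I_M) (i : 'I_K) : \bar R :=
  if P m i then +oo%E else 0%E.

Definition info_on P : 'M[R]_d :=
  \sum_m \sum_(i | P m i) A m i *m (A m i)^T.

Lemma trunc_infinite_alloc P L : 0 <= L ->
  trunc_info A (infinite_alloc P) L = L *: info_on P.
Proof.
move=> L0; rewrite /trunc_info /info_on scaler_sumr; apply: eq_bigr => m _.
rewrite scaler_sumr [RHS]big_mkcond; apply: eq_bigr => i _.
rewrite /infinite_alloc; case: (P m i).
  by rewrite min_r// leey.
by rewrite min_l ?lee_fin// scale0r.
Qed.

Lemma info_on_unitmx P : (forall m, P m (xstar m)) -> info_on P \in unitmx.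
Proof.
move=> hP; apply: unitmx_definite => w h; apply: (spans_dotp_eq0 hspan) => m.
have inner0 k : 0 <= \sum_(i | P k i) dotp (A k i) w ^+ 2.
  by rewrite sumr_ge0// => i _; rewrite sqr_ge0.
have : \sum_m \sum_(i | P m i) dotp (A m i) w ^+ 2 = 0.
  rewrite -[RHS]h /info_on dotp_mulmx_suml; apply: eq_bigr => k _.
  by rewrite dotp_mulmx_suml; apply: eq_bigr => i _; rewrite dotp_outer.
move=> /eqP; rewrite psumr_eq0// => /allP /(_ m (mem_index_enum _)) /= /eqP.
move=> /eqP; rewrite psumr_eq0 => [|k _]; last exact: sqr_ge0.
move=> /allP /(_ (xstar m) (mem_index_enum _)); rewrite hP /=.
by rewrite sqrf_eq0 => /eqP.
Qed.

Lemma invertible_infinite_alloc P : (forall m, P m (xstar m)) ->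
  invertible_info A (infinite_alloc P).
Proof.
move=> hP; near=> L.
have L0 : 0 < L by near: L; apply: nbhs_pinfty_gt; exact: num_real.
rewrite trunc_infinite_alloc ?ltW// unitmxZ ?unitfE ?gt_eqF//.
exact: info_on_unitmx.
Unshelve. all: by end_near. Qed.

(** Truncation at L multiplies a fixed invertible matrix by L, so the norm is a constant divided by
    L. *)
Lemma sqnorm_infinite_alloc P x : (forall m, P m (xstar m)) ->
  sqnorm_info_inv A (infinite_alloc P) x = 0.
Proof.
move=> hP; apply: cvg_lim; first exact: Rhausdorff.
set k := sqnorm_inv (info_on P) x.
have : (fun L : R => L^-1 * k) @ +oo --> 0 * k.
  apply: cvgMr_tmp; apply/gtr0_cvgV0 => //.
  by apply: nbhs_pinfty_gt; exact: num_real.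
rewrite mul0r; apply: cvg_trans; apply: near_eq_cvg; near=> L.
have L0 : 0 < L by near: L; apply: nbhs_pinfty_gt; exact: num_real.
rewrite trunc_infinite_alloc ?ltW// sqnorm_invZ ?gt_eqF//.
exact: info_on_unitmx.
Unshelve. all: by end_near. Qed.

Lemma infinite_alloc_ge0 P m i : (0 <= infinite_alloc P m i)%E.
Proof. by rewrite /infinite_alloc; case: (P m i). Qed.

Lemma cost_ge0 alpha D : (forall m i, (0 <= alpha m i)%E) -> nonneg_gaps D ->
  (0 <= cost alpha D)%E.
Proof.
move=> a0 D0; rewrite /cost sume_ge0// => m _; rewrite sume_ge0// => i _.
by rewrite mule_ge0// lee_fin D0.
Qed.

Lemma cost_infinite_alloc P D : (forall m i, P m i -> D m i = 0) ->
  cost (infinite_alloc P) D = 0%E.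
Proof.
move=> h; rewrite /cost big1// => m _; rewrite big1// => i _.
rewrite /infinite_alloc; case: ifPn => [/h ->|_]; last by rewrite mul0e.
by rewrite mule0.
Qed.

Lemma alloc_feasible_infinite f P D : 0 < f -> (forall m, P m (xstar m)) ->
  alloc_feasible A f D (infinite_alloc P).
Proof.
move=> f0 hP; split.
- exact: infinite_alloc_ge0.
- exact: invertible_infinite_alloc.
- by move=> m i; rewrite sqnorm_infinite_alloc// divr_ge0 ?sqr_ge0 ?ltW.
Qed.

(** Infinite weight on [xstar] is feasible at cost 0, so an optimal cost is at most 0; being a sum
    of nonnegative terms, it vanishes term by term. *)
Lemma alloc_solution_eq0 f D alpha m i : 0 < f -> nonneg_gaps D ->
  (forall m, D m (xstar m) = 0) -> alloc_solution A f D alpha ->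
  0 < D m i -> alpha m i = 0%E.
Proof.
move=> f0 D0 Dx [[a0 _ _] opt] Dmi.
pose P m i := i == xstar m.
have := opt _ (alloc_feasible_infinite D (P := P) f0 (fun m => eqxx _)).
rewrite cost_infinite_alloc => [c0|k j /eqP -> //].
have t0 k j : (0 <= alpha k j * (D k j)%:E)%E by rewrite mule_ge0// lee_fin D0.
have : (alpha m i * (D m i)%:E)%E = 0%E.
  apply/eqP; rewrite eq_le t0 andbT; apply: le_trans c0.
  rewrite /cost (bigD1 m)//= (bigD1 i)//= -addeA leeDl// adde_ge0//.
    by rewrite sume_ge0.
  by rewrite sume_ge0// => k _; rewrite sume_ge0.
by move=> /eqP; rewrite mule_eq0 eqe (gt_eqF Dmi) orbF => /eqP.
Qed.

Lemma C_const_eq0 : optimal_arms A theta xstar -> C_const A theta xstar = 0%E.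
Proof.
move=> hopt.
have g0 : nonneg_gaps (gaps A theta xstar).
  by move=> m i; rewrite mxE dotpBl subr_ge0.
apply/eqP; rewrite eq_le; apply/andP; split; last first.
  by apply: le_ereal_inf_tmp => _ [alpha [a0 _ _] <-]; exact: cost_ge0.
pose P m i := i == xstar m.
apply: ereal_inf_lbound; exists (infinite_alloc P); last first.
  by apply: cost_infinite_alloc => m i /eqP ->; rewrite mxE dotpBl subrr.
split.
- exact: infinite_alloc_ge0.
- by apply: invertible_infinite_alloc => m; exact: eqxx.
- move=> m i _; rewrite sqnorm_infinite_alloc; last by move=> k; exact: eqxx.
  by rewrite divr_ge0 ?sqr_ge0.
Qed.

(** Infinite weight on [xstar] alone and infinite weight on all arms of gap 0 are both feasible at
    cost 0, hence both solutions. Uniqueness identifies them, which excludes a second arm of gap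
    0. *)
Lemma unique_optimal_arm f alpha0 m i : 0 < f ->
  optimal_arms A theta xstar ->
  (forall alpha, alloc_solution A f (gaps A theta xstar) alpha ->
     alpha = alpha0) ->
  i != xstar m -> 0 < gaps A theta xstar m i.
Proof.
move=> f0 hopt uniq ni.
have g0 : nonneg_gaps (gaps A theta xstar).
  by move=> k j; rewrite mxE dotpBl subr_ge0.
rewrite lt_def g0 andbT; apply/eqP => gi.
have sol P : (forall m, P m (xstar m)) ->
    (forall m i, P m i -> gaps A theta xstar m i = 0) ->
    alloc_solution A f (gaps A theta xstar) (infinite_alloc P).
  move=> h1 h2; split; first exact: alloc_feasible_infinite.
  by move=> beta [b0 _ _]; rewrite cost_infinite_alloc// cost_ge0.
have gx k : gaps A theta xstar k (xstar k) = 0 by rewrite mxE dotpBl subrr.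
have := uniq _ (sol (fun k j => j == xstar k) _ _).
rewrite -(uniq _ (sol (fun k j => gaps A theta xstar k j == 0) _ _)).
- move=> /(_ (fun m => eqxx _)) h.
  have /(congr1 (fun a => a m i)) : infinite_alloc (fun k j => j == xstar k)
     = infinite_alloc (fun k j => gaps A theta xstar k j == 0).
    by apply: h => k j /eqP ->.
  by rewrite /infinite_alloc (negbTE ni) gi eqxx.
- by move=> k; apply/eqP.
- by move=> k j /eqP.
Qed.

End Alloc.

(** * The policy along one trajectory *)

Section Counting.
Variable R : realType.
Implicit Types e h : nat -> bool.

Definition count_upto (e : nat -> bool) (t : nat) : nat :=
  (\sum_(1 <= s < t.+1) e s)%N.

Lemma count_upto0 e : count_upto e 0 = 0%N.
Proof. by rewrite /count_upto big_geq. Qed.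

Lemma count_uptoS e t : count_upto e t.+1 = (count_upto e t + e t.+1)%N.
Proof. by rewrite /count_upto big_nat_recr. Qed.

Lemma count_upto_le e t : (count_upto e t <= t)%N.
Proof.
elim: t => [|t IH]; first by rewrite count_upto0.
by rewrite count_uptoS -(addn1 t) leq_add// leq_b1.
Qed.

Lemma leq_count_upto e e' t :
  (forall s, (1 <= s <= t)%N -> e s -> e' s) ->
  (count_upto e t <= count_upto e' t)%N.
Proof.
move=> h; rewrite /count_upto big_nat_cond [X in (_ <= X)%N]big_nat_cond.
apply: leq_sum => s; rewrite andbT ltnS => hs.
by have := h s hs; case: (e s) => // ->.
Qed.

Lemma count_upto_mono e t t' : (t <= t')%N ->
  (count_upto e t <= count_upto e t')%N.
Proof.
move=> /subnK <-; elim: (t' - t)%N => // k IH.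
by rewrite addSn count_uptoS (leq_trans IH)// leq_addr.
Qed.

Lemma count_upto_or e e1 e2 t :
  (forall s, (1 <= s <= t)%N -> e s -> e1 s || e2 s) ->
  (count_upto e t <= count_upto e1 t + count_upto e2 t)%N.
Proof.
move=> h; rewrite /count_upto -big_split /= big_nat_cond.
rewrite [X in (_ <= X)%N]big_nat_cond.
apply: leq_sum => s; rewrite andbT ltnS => hs.
by have := h s hs; case: (e s) => // /(_ isT); case: (e1 s); case: (e2 s).
Qed.

Lemma count_upto_le_bound e b t :
  (forall s, (1 <= s <= t)%N -> e s -> (s <= b)%N) -> (count_upto e t <= b)%N.
Proof.
move=> h; apply: (@leq_trans (count_upto (fun s => s <= b)%N t)).
  exact: leq_count_upto.
elim: t {h} => [|t IH]; first by rewrite count_upto0.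
have [tb|bt] := leqP t.+1 b.
  exact: leq_trans (count_upto_le _ _) tb.
by rewrite count_uptoS [X in (_ + X)%N](_ : _ = 0%N) ?addn0 // leqNgt bt.
Qed.

Lemma count_upto_le_real_bound e (b : R) t : 0 <= b ->
  (forall s, (1 <= s <= t)%N -> e s -> s%:R <= b) -> (count_upto e t)%:R <= b.
Proof.
move=> b0 h; apply: le_trans (_ : (Num.truncn b)%:R <= b); last by rewrite truncn_le.
rewrite ler_nat; apply: count_upto_le_bound => s st es.
by rewrite truncn_ge_nat// h.
Qed.

(** At the last counted round the counter of e was still at most B, and it dominates the number of
    rounds counted before. *)
Lemma count_upto_small_counter e (B : R) t : 0 <= B ->
  (count_upto (fun s => e s && ((count_upto e s.-1)%:R <= B)) t)%:R <= B + 1.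
Proof.
move=> B0; set e' := fun s => _.
have le : (count_upto e' t <= count_upto e t)%N.
  by apply: leq_count_upto => s _ /andP[].
elim: t le => [|t IH] _; first by rewrite count_upto0; lra.
have le : (count_upto e' t <= count_upto e t)%N.
  by apply: leq_count_upto => s _ /andP[].
rewrite count_uptoS /e'; case: (boolP (_ && _)) => [/andP[_ /=]|_]; last first.
  by rewrite addn0 IH.
move=> h; rewrite natrD lerD2r; apply: le_trans h.
by rewrite ler_nat.
Qed.

(** At the rounds where e holds, its counter takes the values 1, 2, ... once each, so a condition on
    the counter can be counted over its values. This converts failures indexed by s(t) into failures
    indexed by k. *)
Lemma count_upto_comp_counter (e h : nat -> bool) t :
  count_upto (fun s => e s && h (count_upto e s)) t =
  count_upto h (count_upto e t).
Proof.
elim: t => [|t IH]; first by rewrite !count_upto0.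
rewrite !count_uptoS IH; case: (e t.+1) => /=; last by rewrite !addn0.
by rewrite addn1 count_uptoS.
Qed.

End Counting.

(** * Suboptimal rounds of the policy on confidence events *)

Section Trajectory.
Variables (R : realType) (d K M : nat) (A : 'I_M -> 'I_K -> 'cV[R]_d).
Variables (ctx : nat -> 'I_M) (arm : nat -> 'I_K) (rew : nat -> R).
Variables (theta : 'cV[R]_d) (xstar : 'I_M -> 'I_K).
Variables (n : nat) (c : R) (T : 'M[R]_(M, K) -> 'I_M -> 'I_K -> \bar R).
Variables (eps : nat -> R).
Let f := f_conf c d n (1 / n%:R).
Variables (g0 Lam : R).
Local Notation action := (action A ctx arm).
Local Notation design := (design A ctx arm).
Local Notation pulls := (pulls A ctx arm).
Local Notation theta_hat := (theta_hat A ctx arm rew).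
Local Notation gaps_hat := (gaps_hat A ctx arm rew).
Local Notation gap_hat_min := (gap_hat_min A ctx arm rew).
Local Notation exploits := (exploits A ctx arm rew f).
Local Notation explorations := (explorations A ctx arm rew f).
Local Notation demand := (demand A ctx arm rew f T).
Local Notation pull_ratio := (pull_ratio A ctx arm rew f T).

(** Pigeonhole: every such round adds a pull to an action with at most B earlier pulls, which can
    happen B + 1 times per action. Summing over pairs may count a vector shared by several contexts
    more than once, which only enlarges the bound. *)
Lemma count_small_pulls (P : nat -> bool) (B : R) t : 0 <= B ->
  (forall s, (1 <= s <= t)%N -> P s -> (pulls (action s) s.-1)%:R <= B) ->
  (count_upto P t)%:R <= (M * K)%:R * (B + 1).
Proof.
move=> B0 h.
pose e (u : 'I_M * 'I_K) s := action s == A u.1 u.2.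
pose e' u s := e u s && ((count_upto (e u) s.-1)%:R <= B).
apply: (@le_trans _ _ (\sum_u (count_upto (e' u) t)%:R)).
  rewrite -natr_sum ler_nat /count_upto exchange_big /=.
  rewrite big_nat_cond [X in (_ <= X)%N]big_nat_cond.
  apply: leq_sum => s; rewrite andbT ltnS => hs.
  case: (boolP (P s)) => // Ps; rewrite (bigD1 (ctx s, arm s))//=.
  rewrite /e' /e /= eqxx /=.
  by have := h s hs Ps; rewrite /Defs.pulls /count_upto => ->.
apply: (@le_trans _ _ (\sum_(u : 'I_M * 'I_K) (B + 1))).
  by apply: ler_sum => u _; exact: count_upto_small_counter.
by rewrite sumr_const card_prod !card_ord mulr_natl.
Qed.

Lemma explorationsE t : explorations t =
  count_upto (fun s => (d < s)%N && ~~ exploits s) t.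
Proof.
rewrite /Defs.explorations /count_upto.
have [dt|td] := leqP d t.
  rewrite (@big_cat_nat _ _ _ d.+1 1 t.+1)//= [X in (_ = X + _)%N]big_nat_cond.
  rewrite [X in (_ = X + _)%N]big1 => [|s /andP[/andP[_ sd] _]].
    rewrite add0n big_nat_cond [RHS]big_nat_cond.
    by apply: eq_bigr => s /andP[/andP[-> _] _].
  by rewrite ltnNge -ltnS sd.
rewrite big_geq ?ltnS ?(ltnW td)// big_nat_cond big1// => s.
rewrite andbT ltnS => /andP[_ st].
by rewrite ltnNge (ltnW (leq_ltn_trans st td)).
Qed.

(** F stands for [f_conf] at a level left open; the levels used are 1/n, 1/ln n and 1/k^2. *)
Definition conf_at (F : R) t := forall m i,
  `|dotp (A m i) (theta_hat t - theta)| <=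
  norm_inv (design t) (A m i) * Num.sqrt F.

Hypothesis hfol : follows_oam A ctx arm rew n c T eps.
Hypothesis f_gt0 : 0 < f.
Hypothesis dn : (d <= n)%N.
Hypothesis hT : forall D, nonneg_gaps D -> alloc_solution A f D (T D).
Hypothesis g0_gt0 : 0 < g0.
Hypothesis hgap : forall m i, i != xstar m -> g0 <= gaps A theta xstar m i.
Hypothesis Lam_gt0 : 0 < Lam.
(** One constant serves two spanning families: the arms of one context, relevant for (2b), where all
    arms of the current context have been pulled, and below the optimal arms, relevant for the end
    of exploration. *)
Hypothesis arm_coef : forall m m' i, exists2 k : 'I_K -> R,
  A m' i = \sum_j k j *: A m j & (\sum_j `|k j|) ^+ 2 <= Lam.
Hypothesis star_coef : forall m' i, exists2 k : 'I_M -> R,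
  A m' i = \sum_m k m *: A m (xstar m) & (\sum_m `|k m|) ^+ 2 <= Lam.
Hypothesis hspan : spans [seq A m (xstar m) | m <- enum 'I_M].

Let indep t : (1 <= t <= d)%N ->
  action t \notin span [seq action s | s <- iota 1 t.-1].
Proof.
move=> /andP[t1 td]; have := hfol (t := t).
by rewrite t1 (leq_trans td dn) td => /(_ isT).
Qed.

Lemma sqnorm_arm_le t m N m' i : (d <= t)%N -> 0 < N ->
  (forall j, N <= (pulls (A m j) t)%:R) ->
  sqnorm_inv (design t) (A m' i) <= Lam / N.
Proof.
move=> dt N0 h; have [k ek kL] := arm_coef m m' i.
apply: le_trans (sqnorm_design_le indep dt ek N0 h) _.
by rewrite ler_wpM2r// invr_ge0 ltW.
Qed.

Lemma sqnorm_star_le t N m' i : (d <= t)%N -> 0 < N ->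
  (forall m, N <= (pulls (A m (xstar m)) t)%:R) ->
  sqnorm_inv (design t) (A m' i) <= Lam / N.
Proof.
move=> dt N0 h; have [k ek kL] := star_coef m' i.
apply: le_trans (sqnorm_design_le indep dt ek N0 h) _.
by rewrite ler_wpM2r// invr_ge0 ltW.
Qed.

Lemma conf_at_le F t m i e : (d <= t)%N -> conf_at F t -> 0 <= e ->
  sqnorm_inv (design t) (A m i) * F <= e ^+ 2 ->
  `|dotp (A m i) (theta_hat t - theta)| <= e.
Proof.
move=> dt hc e0 h; apply: le_trans (hc m i) _.
rewrite /norm_inv -sqrtrM; last exact: sqnorm_design_ge0.
by rewrite -[leRHS]ger0_norm// -sqrtr_sqr ler_wsqrtr.
Qed.

(** After N pulls of x its squared norm is at most 1/N, so a confidence radius still at least [g0]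
    limits N. All counts of suboptimal pulls end here. *)
Lemma pulls_le x F t : (d <= t)%N -> 0 <= F ->
  g0 ^+ 2 <= sqnorm_inv (design t) x * F -> (pulls x t)%:R <= F / g0 ^+ 2.
Proof.
move=> dt F0 h; have [->|N0] := posnP (pulls x t).
  by rewrite divr_ge0// sqr_ge0.
have N0' : 0 < (pulls x t)%:R :> R by rewrite ltr0n.
rewrite ler_pdivlMr ?exprn_gt0//.
have := sqnorm_design_le1 indep dt N0' (lexx _).
rewrite -div1r ler_pdivlMr// => h1.
have := ler_wpM2r (ltW N0') h => /le_trans h2.
rewrite mulrC; apply: h2; rewrite mulrAC -[leRHS]mul1r.
by rewrite ler_wpM2r.
Qed.

Lemma gaps_hat_ge t m i j :
  dotp (A m j - A m i) (theta_hat t) <= gaps_hat t m i.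
Proof.
by rewrite mxE; apply: (@le_bigmax _ _ _ 0
  (fun j => dotp (A m j - A m i) (theta_hat t)) j).
Qed.

Lemma gaps_hat_le t m i b : 0 <= b ->
  (forall j, dotp (A m j - A m i) (theta_hat t) <= b) -> gaps_hat t m i <= b.
Proof. by move=> b0 h; rewrite mxE; apply: bigmax_le. Qed.

Lemma gaps_hat_ge0 t : nonneg_gaps (gaps_hat t).
Proof.
move=> m i; apply: le_trans (gaps_hat_ge t m i i).
by rewrite subrr dotp0l.
Qed.

Lemma gap_hat_min_le t m i : 0 < gaps_hat t m i ->
  (gap_hat_min t <= (gaps_hat t m i)%:E)%E.
Proof.
move=> h; rewrite /Defs.gap_hat_min.
exact: (@bigmin_le_cond _ _ _ +oo%E (m, i)
  (fun u : 'I_M * 'I_K => 0 < gaps_hat t u.1 u.2)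
  (fun u : 'I_M * 'I_K => (gaps_hat t u.1 u.2)%:E)).
Qed.

Lemma gap_hat_min_ge t a :
  (forall m i, 0 < gaps_hat t m i -> a <= gaps_hat t m i) ->
  (a%:E <= gap_hat_min t)%E.
Proof.
move=> h; rewrite /Defs.gap_hat_min; apply: le_bigmin; first exact: leey.
by move=> [m i] /= hi; rewrite lee_fin h.
Qed.

Lemma gap_hat_min_ge0 t : (0 <= gap_hat_min t)%E.
Proof. by apply: gap_hat_min_ge => m i /ltW. Qed.

(** A positive estimated gap dominates [gap_hat_min]; if it also dominates the gap of arm i, it
    replaces both terms of the maximum in the exploitation test. *)
Lemma exploits_norm_le t i m j : exploits t ->
  0 < gaps_hat t.-1 m j ->
  gaps_hat t.-1 (ctx t) i <= gaps_hat t.-1 m j ->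
  sqnorm_inv (design t.-1) (A (ctx t) i) * f <= gaps_hat t.-1 m j ^+ 2.
Proof.
move=> /forallP /(_ i) h D0 Di; rewrite -ler_pdivlMr// -lee_fin.
apply: le_trans h _; rewrite ge_max; apply/andP; split; last first.
  by rewrite lee_fin ler_wpM2r ?invr_ge0 ?(ltW f_gt0)// ler_sqr ?nnegrE ?gaps_hat_ge0.
rewrite EFinM lee_wpmul2r ?lee_fin ?invr_ge0 ?(ltW f_gt0)//.
by rewrite expr2 EFinM lee_pmul ?gap_hat_min_ge0// gap_hat_min_le.
Qed.

Lemma greedy_gaps_hat t m i : i != xstar m ->
  (forall j, dotp (A m j) (theta_hat t) <= dotp (A m i) (theta_hat t)) ->
  dotp (A m i - A m (xstar m)) (theta_hat t) != 0 ->
  [/\ gaps_hat t m i = 0,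
      gaps_hat t m (xstar m) = dotp (A m i - A m (xstar m)) (theta_hat t) &
      0 < gaps_hat t m (xstar m)].
Proof.
move=> ni gr nt.
have ge0 : 0 <= dotp (A m i - A m (xstar m)) (theta_hat t).
  by rewrite dotpBl subr_ge0.
have e : gaps_hat t m (xstar m) = dotp (A m i - A m (xstar m)) (theta_hat t).
  apply/eqP; rewrite eq_le gaps_hat_ge andbT; apply: gaps_hat_le => // j.
  by rewrite !dotpBl lerD2r.
split=> //; last by rewrite e lt_def nt.
apply/eqP; rewrite eq_le gaps_hat_ge0 andbT; apply: gaps_hat_le => // j.
by rewrite dotpBl subr_le0.
Qed.

Lemma gap_le_error t m i : i != xstar m ->
  g0 <= dotp (A m i - A m (xstar m)) (theta_hat t - theta)
        - dotp (A m i - A m (xstar m)) (theta_hat t).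
Proof.
move=> /hgap; rewrite mxE => h; apply: le_trans h _.
by rewrite dotpBr !dotpBl; lra.
Qed.

(** Let D > 0 be the estimated gap of the true optimal arm. The test bounds the error of that arm by
    D, and the true gap is at most both errors minus D. So the radius of the played arm alone is at
    least [g0], and this arm has been pulled rarely. *)
Lemma wrong_exploit_pulls t : (d <= t.-1)%N -> conf_at f t.-1 ->
  exploits t -> greedy A ctx arm rew t (arm t) -> arm t != xstar (ctx t) ->
  dotp (A (ctx t) (arm t) - A (ctx t) (xstar (ctx t))) (theta_hat t.-1) != 0 ->
  (pulls (action t) t.-1)%:R <= f / g0 ^+ 2.
Proof.
move=> dt hc ex gr ni nt; have [z e D0] := greedy_gaps_hat ni gr nt.
set D := gaps_hat _ _ _ in e D0.
have := gap_le_error t.-1 ni.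
rewrite -e dotpBl => h.
have hx : `|dotp (A (ctx t) (xstar (ctx t))) (theta_hat t.-1 - theta)| <= D.
  by apply: (conf_at_le dt hc (ltW D0)); exact: exploits_norm_le.
have hi := hc (ctx t) (arm t).
set b := norm_inv _ _ * _ in hi.
have gb : g0 <= b by move: hi hx; rewrite !ler_norml; lra.
apply: pulls_le => //; first exact: ltW.
have s0 := sqnorm_design_ge0 indep (A (ctx t) (arm t)) dt.
rewrite -(sqr_sqrtr s0) -[X in _ * X](sqr_sqrtr (ltW f_gt0)) -exprMn.
by rewrite ler_sqr ?nnegrE ?(ltW g0_gt0)// (le_trans _ gb)// ltW.
Qed.

(** With F <= f / 4 both errors are at most D / 2, so the true gap would be at most D / 2 + D / 2 -
    D = 0. Only a tie remains possible. *)
Lemma exploit_optimal F t : (d <= t.-1)%N -> conf_at F t.-1 -> 4 * F <= f ->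
  exploits t -> greedy A ctx arm rew t (arm t) -> arm t != xstar (ctx t) ->
  dotp (A (ctx t) (arm t) - A (ctx t) (xstar (ctx t))) (theta_hat t.-1) = 0.
Proof.
move=> dt hc Ff ex gr ni; apply/eqP/negPn/negP => nt.
have [z e D0] := greedy_gaps_hat ni gr nt.
set D := gaps_hat _ _ _ in e D0.
have := gap_le_error t.-1 ni.
rewrite -e dotpBl => h.
have bd i : gaps_hat t.-1 (ctx t) i <= D ->
    `|dotp (A (ctx t) i) (theta_hat t.-1 - theta)| <= D / 2.
  move=> iD; apply: (conf_at_le dt hc); first by rewrite divr_ge0// ltW.
  have := exploits_norm_le ex D0 iD.
  have := sqnorm_design_ge0 indep (A (ctx t) i) dt.
  set s := sqnorm_inv _ _ => s0 hs.
  have := ler_wpM2l s0 Ff; move: hs; rewrite -/D expr_div_n; lra.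
have h1 := bd (xstar (ctx t)) (lexx _).
have h2 : `|dotp (A (ctx t) (arm t)) (theta_hat t.-1 - theta)| <= D / 2.
  by apply: bd; rewrite z ltW.
by move: h1 h2 h g0_gt0; rewrite !ler_norml; lra.
Qed.

(** The usual optimism argument: the gap is at most twice the radius of the played arm. The bound g
    replaces F because F varies with s(t), while the final count needs a single threshold. *)
Lemma ucb_pulls F g t : (d <= t.-1)%N -> conf_at F t.-1 -> F <= g -> 0 <= g ->
  arm t != xstar (ctx t) ->
  (forall j, ucb_index A ctx arm rew F t j <=
             ucb_index A ctx arm rew F t (arm t)) ->
  (pulls (action t) t.-1)%:R <= 4 * g / g0 ^+ 2.
Proof.
move=> dt hc Fg gg ni /(_ (xstar (ctx t))); rewrite /ucb_index => h.
have h1 := hc (ctx t) (xstar (ctx t)); have h2 := hc (ctx t) (arm t).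
have := gap_le_error t.-1 ni; rewrite dotpBl => h3.
have h4 : g0 <= 2 * (norm_inv (design t.-1) (A (ctx t) (arm t)) * Num.sqrt g).
  have h5 : norm_inv (design t.-1) (A (ctx t) (arm t)) * Num.sqrt F <=
     norm_inv (design t.-1) (A (ctx t) (arm t)) * Num.sqrt g.
    by rewrite ler_wpM2l ?sqrtr_ge0// ler_wsqrtr.
  move: h h1 h2 h3 h5; rewrite !ler_norml dotpBl.
  rewrite -/action [Num.sqrt F * _]mulrC [X in _ + X <= _]mulrC.
  lra.
apply: pulls_le => //; first by rewrite mulr_ge0.
have s0 := sqnorm_design_ge0 indep (A (ctx t) (arm t)) dt.
rewrite -(sqr_sqrtr s0) mulrCA -[X in _ * (_ * X)](sqr_sqrtr gg) -exprMn.
have -> : 4 = 2 ^+ 2 :> R by rewrite expr2 -natrM.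
by rewrite -exprMn ler_sqr ?nnegrE ?(ltW g0_gt0)// (le_trans _ h4)// ltW.
Qed.

Lemma est_gap_ge F t b e m i : (d <= t)%N -> conf_at F t -> 0 <= e -> 0 <= F ->
  (forall m i, sqnorm_inv (design t) (A m i) <= b) -> b * F <= e ^+ 2 ->
  i != xstar m ->
  g0 - 2 * e <= dotp (A m (xstar m) - A m i) (theta_hat t).
Proof.
move=> dt hc e0 F0 hb hbe ni.
have hm j : `|dotp (A m j) (theta_hat t - theta)| <= e.
  apply: (conf_at_le dt hc e0); apply: le_trans hbe.
  by rewrite ler_wpM2r.
have h1 := hm i; have h2 := hm (xstar m).
have := gap_le_error t ni; move: h1 h2.
by rewrite !ler_norml [dotp (A m i - _) (_ - _)]dotpBl !(dotpBl _ _ (theta_hat t)); lra.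
Qed.

Lemma gaps_hat_ranked t :
  (forall m i, i != xstar m -> 0 < dotp (A m (xstar m) - A m i) (theta_hat t)) ->
  (forall m, gaps_hat t m (xstar m) = 0) /\
  (forall m i, i != xstar m -> 0 < gaps_hat t m i).
Proof.
move=> h; split=> [m|m i ni]; last first.
  by apply: lt_le_trans (gaps_hat_ge t m i (xstar m)); exact: h.
apply/eqP; rewrite eq_le gaps_hat_ge0 andbT; apply: gaps_hat_le => // j.
have [->|nj] := eqVneq j (xstar m); first by rewrite subrr dotp0l.
by have := h m j nj; rewrite !dotpBl; lra.
Qed.

(* When the estimated optimal arms are the true ones, weights +oo on them cost
   nothing, so that an optimal allocation vanishes on all other arms. *)
Lemma ranked_ratio_optimal t b1 :
  (forall m i, i != xstar m ->
     0 < dotp (A m (xstar m) - A m i) (theta_hat t.-1)) ->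
  ~~ [forall i, (demand t i <= (pulls (A (ctx t) i) t.-1)%:R%:E)%E] ->
  (forall j, (pull_ratio t b1 <= pull_ratio t j)%E) ->
  b1 = xstar (ctx t).
Proof.
move=> rk; have [D0 Dp] := gaps_hat_ranked rk.
have dem0 i : i != xstar (ctx t) -> demand t i = 0%E.
  move=> ni; rewrite /Defs.demand.
  rewrite (alloc_solution_eq0 hspan f_gt0 (@gaps_hat_ge0 _) D0
     (hT (@gaps_hat_ge0 _)) (Dp _ _ ni)).
  by rewrite min_l// lee_fin divr_ge0 ?sqr_ge0// ltW.
move=> /forallPn[i]; rewrite -ltNge => hi hb.
apply/eqP/negPn/negP => nb1.
have ei : i = xstar (ctx t).
  apply/eqP/negPn/negP => ni; move: hi; rewrite dem0// ltNge lee_fin.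
  by rewrite ler0n.
(* An arm of zero demand has ratio +oo, whereas the ratio of the optimal arm is finite, so such an
   arm cannot be the minimiser [b1]. *)
have := hb i; rewrite /Defs.pull_ratio dem0// eqxx.
case: eqP => [e0|_]; last by rewrite leNgt ltry.
by move: hi; rewrite e0 ltNge lee_fin ler0n.
Qed.

(** Contrapositive. With that many pulls of every optimal arm, squared norms are at most g0^2 / (16
    f), so errors are at most g0 / 4 and nonzero estimated gaps at least g0 / 2. The first term of
    the exploitation test is then at least g0^2 / (4 f), and the test succeeds for every arm. *)
Lemma explore_pulls t : (d <= t.-1)%N -> conf_at f t.-1 -> ~~ exploits t ->
  exists m, (pulls (A m (xstar m)) t.-1)%:R < 16 * Lam * f / g0 ^+ 2.
Proof.
move=> dt hc; apply: contraNP => /forallNP hN.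
have g2 : 0 < g0 ^+ 2 by rewrite exprn_gt0.
have N0 : 0 < 16 * Lam * f / g0 ^+ 2 by rewrite divr_gt0// !mulr_gt0.
have hsq m i : sqnorm_inv (design t.-1) (A m i) <= g0 ^+ 2 / (16 * f).
  have -> : g0 ^+ 2 / (16 * f) = Lam / (16 * Lam * f / g0 ^+ 2).
    by field; rewrite !gt_eqF.
  by apply: sqnorm_star_le => // k; rewrite leNgt; apply/negP/hN.
have eg m i : i != xstar m ->
    g0 / 2 <= dotp (A m (xstar m) - A m i) (theta_hat t.-1).
  move=> ni; apply: le_trans (est_gap_ge (e := g0 / 4) dt hc _ (ltW f_gt0) hsq _ ni).
  - by move: g0_gt0; lra.
  - by rewrite divr_ge0// ltW.
  - have -> : g0 ^+ 2 / (16 * f) * f = (g0 / 4) ^+ 2; last by [].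
    by field; rewrite gt_eqF.
have [D0 Dp] := @gaps_hat_ranked t.-1 (fun m i ni =>
  lt_le_trans (divr_gt0 g0_gt0 (ltr0Sn _ _)) (eg m i ni)).
have gm : ((g0 / 2)%:E <= gap_hat_min t.-1)%E.
  apply: gap_hat_min_ge => m i hi; apply: le_trans (gaps_hat_ge _ m i (xstar m)).
  by apply: eg; apply: contraTneq hi => ->; rewrite D0 ltxx.
have g20 : (0 <= (g0 / 2)%:E)%E by rewrite lee_fin divr_ge0// ltW.
apply/forallP => i; rewrite le_max; apply/orP; left.
apply: (@le_trans _ _ (((g0 / 2)%:E * (g0 / 2)%:E) * (f^-1)%:E)%E).
  rewrite -!EFinM lee_fin; apply: le_trans (hsq _ _) _.
  have -> : g0 / 2 * (g0 / 2) / f = 4 * (g0 ^+ 2 / (16 * f)).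
    by field; rewrite gt_eqF.
  have : 0 <= g0 ^+ 2 / (16 * f) by rewrite divr_ge0 ?mulr_ge0// ltW.
  lra.
by rewrite lee_wpmul2r ?lee_fin ?invr_ge0 ?(ltW f_gt0)// lee_pmul.
Qed.

Let subopt s := arm s != xstar (ctx s).

Lemma explorations_le t : (explorations t <= t)%N.
Proof. by rewrite explorationsE count_upto_le. Qed.

(** The value s(t) = 1 is set apart: its level 1/s^2 is 1, outside the range of the confidence
    guarantee. It accounts for the additional 1. *)
Lemma count_ucb_bad (bad : nat -> bool) t :
  (count_upto (fun s => ((d < s)%N && ~~ exploits s) &&
      (bad (explorations s) || (explorations s < 2)%N)) t <=
   1 + count_upto (fun k => (1 < k)%N && bad k) t)%N.
Proof.
set e := fun s => (d < s)%N && ~~ exploits s.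
pose h k := bad k || (k < 2)%N.
have -> : count_upto (fun s => e s &&
      (bad (explorations s) || (explorations s < 2)%N)) t =
    count_upto (fun s => e s && h (count_upto e s)) t.
  congr (count_upto _ t); apply/funext => s.
  by rewrite /h -explorationsE.
rewrite count_upto_comp_counter.
apply: (@leq_trans (count_upto h t)).
  by apply: count_upto_mono; exact: count_upto_le.
apply: (@leq_trans (count_upto (fun k => k <= 1)%N t +
  count_upto (fun k => (1 < k)%N && bad k) t)%N).
  apply: count_upto_or => k _; rewrite /h; case: (ltnP k 2) => hk.
    by rewrite -ltnS hk.
  by rewrite orbF => hb; rewrite hb orbT.
by apply: leq_add => //; apply: count_upto_le_bound.
Qed.

(** Stated with F, g, [Xb] and t free because it is used twice: up to a time of order ln n with the
    radius of level 1/ln n and no wrong exploitation, and up to any t <= n with the radius of level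
    1/n. *)
Lemma suboptimal_count_le F (bad : nat -> bool) g Xb ell E eta q t :
  (t <= n)%N ->
  0 <= F -> (forall u, (d <= u <= n)%N -> conf_at F u) ->
  (forall k u, (2 <= k <= t)%N -> ~~ bad k -> (d <= u <= n)%N ->
    conf_at (f_conf c d n (1 / k%:R ^+ 2)) u) ->
  0 <= g ->
  (forall k, (2 <= k <= t)%N -> f_conf c d n (1 / k%:R ^+ 2) <= g) ->
  (count_upto (fun s => [&& d < s, exploits s & subopt s]%N) t)%:R <= Xb ->
  0 <= ell ->
  (forall s, (3 <= s <= n)%N -> 0 < eps s /\ (eps s)^-1 <= ell) ->
  0 <= E -> 0 <= eta ->
  (forall s, (3 <= s <= n)%N -> eps s <= E) ->
  (forall s, (q < s <= n)%N -> eps s <= eta) ->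
  (count_upto subopt t)%:R <=
    d%:R + Xb + (M * K)%:R * (4 * g / g0 ^+ 2 + 1) +
    (1 + (count_upto (fun k => (1 < k)%N && bad k) t)%:R) +
    (M * K)%:R * (E * q%:R + eta * t%:R + 1) + 2 +
    (4 * F * Lam / g0 ^+ 2 * ell + 1).
Proof.
move=> tn F0 hF hbad gg0 hg hX ell0 heps E0 eta0 hE heta.
(* More than V pulls of every arm of one context make twice the error, at most 2 sqrt (Lam F / N),
   less than [g0], so that all rankings are right. *)
set V := 4 * F * Lam / g0 ^+ 2.
have V0 : 0 <= V.
  by rewrite divr_ge0 ?sqr_ge0// mulr_ge0 ?(ltW Lam_gt0)// mulr_ge0.
pose ex s := (d < s)%N && ~~ exploits s.
(* The classes are: initialisation, wrong exploitation, UCB at a level that holds, exploration at a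
   failing level or with s(t) < 2, forced exploration, the rounds 1 and 2 where nothing is known
   about eps, and (2b) with s(t-1) still small. *)
pose c1 s := (s <= d)%N.
pose c2 s := [&& d < s, exploits s & subopt s]%N.
pose c3 s := (ex s && subopt s) && [&& [forall i, (demand s i <=
   (pulls (A (ctx s) i) s.-1)%:R%:E)%E], ~~ bad (explorations s) &
   (2 <= explorations s)%N].
pose c4 s := ex s && (bad (explorations s) || (explorations s < 2)%N).
pose c5 s := [&& 3 <= s, ex s & subopt s]%N &&
  ((pulls (action s) s.-1)%:R <= eps s * (explorations s.-1)%:R).
pose c6 s := (s <= 2)%N.
pose c7 s := ex s && ((explorations s.-1)%:R <= V * ell).
have split s : (1 <= s <= t)%N -> subopt s ->
    c1 s || (c2 s || (c3 s || (c4 s || (c5 s || (c6 s || c7 s))))).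
  move=> /andP[s1 st] sub; have sn := leq_trans st tn.
  have := hfol (t := s); rewrite s1 sn => /(_ isT).
  rewrite /c1; case: (leqP s d) => //= ds.
  rewrite /c2 ds sub andbT /=; case: (boolP (exploits s)) => //= nex.
  rewrite /c4 /c3 /ex ds nex sub /= /oam_explore.
  case: (boolP [forall i, (demand s i <=
    (pulls (A (ctx s) i) s.-1)%:R%:E)%E]) => [uu _|nu].
    by case: (bad _); case: (ltnP (explorations s) 2); rewrite ?orbT.
  move=> [b1 [b2 [hb1 hb2 ea]]].
  apply/orP; right; apply/orP; right.
  rewrite /c5 /c6; case: (leqP s 2) => s3; first by rewrite orbT.
  rewrite /ex ds nex sub ?s3 /=.
  move: ea; case: ifPn => [h2 ea|].
    by move=> *; apply/orP; left; rewrite /Defs.action ea.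
  rewrite -ltNge => h2 ea.
  (* Here [b1] is played, so every arm of the context has more than eps_s s(s-1) pulls. If s(s-1) >
     V ell, this exceeds V since 1/eps <= ell; the ranking is then right and [b1] is optimal, a
     contradiction. *)
  apply/orP; right; rewrite /c7 /ex ds nex /= leNgt; apply/negP => hV.
  have {}e0 := (heps s (introT andP (conj s3 sn))).1.
  have {}el := (heps s (introT andP (conj s3 sn))).2.
  have ds' : (d <= s.-1)%N by rewrite -ltnS prednK.
  have hV2 : V < (pulls (A (ctx s) b2) s.-1)%:R.
    apply: le_lt_trans h2; rewrite mulrC -ler_pdivrMr//.
    by apply: le_trans (ltW hV); rewrite ler_wpM2l.
  have N0 := le_lt_trans V0 hV2.
  set N := (pulls (A (ctx s) b2) s.-1)%:R in hV2 N0.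
  have hsq m i : sqnorm_inv (design s.-1) (A m i) <= Lam / N.
    by apply: (sqnorm_arm_le (m := ctx s)) => // j; rewrite ler_nat.
  have LFN : 0 <= Lam / N * F.
    by rewrite mulr_ge0// divr_ge0// ltW.
  have rk m i : i != xstar m ->
      0 < dotp (A m (xstar m) - A m i) (theta_hat s.-1).
    move=> ni.
    have hcs : conf_at F s.-1 by apply: hF; rewrite ds' (leq_trans (leq_pred _)).
    apply: lt_le_trans (est_gap_ge ds' hcs (sqrtr_ge0 (Lam / N * F)) F0 hsq _ ni).
      rewrite subr_gt0; have [->|e0'] := eqVneq (Num.sqrt (Lam / N * F)) 0.
        by rewrite mulr0.
      rewrite -ltr_sqr ?nnegrE ?mulr_ge0 ?sqrtr_ge0 ?(ltW g0_gt0)//.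
      rewrite exprMn sqr_sqrtr//.
      move: hV2; rewrite /V ltr_pdivrMr ?exprn_gt0// => hV2.
      rewrite -(ltr_pM2l N0); apply: le_lt_trans hV2.
      rewrite le_eqVlt; apply/orP; left; apply/eqP.
      by field; rewrite gt_eqF.
    by rewrite sqr_sqrtr.
  by move: sub; rewrite /subopt ea (ranked_ratio_optimal rk nu hb1) eqxx.
have n1 : (count_upto c1 t)%:R <= d%:R :> R.
  by rewrite ler_nat; apply: count_upto_le_bound.
have n3 : (count_upto c3 t)%:R <= (M * K)%:R * (4 * g / g0 ^+ 2 + 1).
  apply: count_small_pulls; first by rewrite divr_ge0 ?sqr_ge0// mulr_ge0.
  move=> s /andP[s1 st] /andP[/andP[/andP[ds nex] sub] /and3P[u nb k2]].
  have sn := leq_trans st tn.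
  have ds' : (d <= s.-1)%N by rewrite -ltnS prednK.
  have := hfol (t := s); rewrite s1 sn => /(_ isT).
  rewrite leqNgt ds /= (negbTE nex) /oam_explore u => hu.
  have kt : (2 <= explorations s <= t)%N.
    by rewrite k2 (leq_trans (explorations_le s)).
  apply: (ucb_pulls ds' _ (hg _ kt)) => //.
  by apply: hbad => //; rewrite ds' (leq_trans (leq_pred _)).
have n4 : (count_upto c4 t)%:R <=
    1 + (count_upto (fun k => (1 < k)%N && bad k) t)%:R :> R.
  by apply: le_trans (_ : (1 + _)%N%:R <= _);
    [rewrite ler_nat; exact: (count_ucb_bad bad)|rewrite natrD].
(* Up to round q the threshold eps_s s(s-1) is at most E q, afterwards at most eta t. *)
have n5 : (count_upto c5 t)%:R <=
    (M * K)%:R * (E * q%:R + eta * t%:R + 1).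
  apply: count_small_pulls; first by rewrite addr_ge0// mulr_ge0.
  move=> s /andP[s1 st] /andP[/and3P[s3 _ _] h]; apply: le_trans h _.
  have sn := leq_trans st tn.
  have e1 := hE s; rewrite s3 sn in e1; have {}e1 := e1 isT.
  have xs : (explorations s.-1)%:R <= s%:R :> R.
    by rewrite ler_nat (leq_trans (explorations_le _))// leq_pred.
  have [sq|qs] := leqP s q.
    apply: (@le_trans _ _ (E * q%:R)).
      by rewrite ler_pM ?ler0n ?(ltW ((heps s _).1)) ?s3// (le_trans xs)// ler_nat.
    by rewrite lerDl mulr_ge0.
  have e2 := heta s; rewrite qs sn in e2; have {}e2 := e2 isT.
  apply: (@le_trans _ _ (eta * t%:R)).
    by rewrite ler_pM ?ler0n ?(ltW ((heps s _).1)) ?s3// (le_trans xs)// ler_nat.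
  by rewrite lerDr mulr_ge0.
have n6 : (count_upto c6 t)%:R <= 2 :> R.
  by rewrite ler_nat; apply: count_upto_le_bound.
have n7 : (count_upto c7 t)%:R <= V * ell + 1.
  have -> : c7 = fun s => ex s && ((count_upto ex s.-1)%:R <= V * ell).
    by apply/funext => s; rewrite /c7 explorationsE.
  by apply: count_upto_small_counter; rewrite mulr_ge0.
apply: (@le_trans _ _ ((count_upto c1 t)%:R + ((count_upto c2 t)%:R +
  ((count_upto c3 t)%:R + ((count_upto c4 t)%:R + ((count_upto c5 t)%:R +
  ((count_upto c6 t)%:R + (count_upto c7 t)%:R))))))).
  rewrite -!natrD ler_nat.
  apply: leq_trans (count_upto_or split) _; rewrite leq_add2l.
  apply: leq_trans (count_upto_or (fun s _ h => h)) _; rewrite leq_add2l.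
  apply: leq_trans (count_upto_or (fun s _ h => h)) _; rewrite leq_add2l.
  apply: leq_trans (count_upto_or (fun s _ h => h)) _; rewrite leq_add2l.
  apply: leq_trans (count_upto_or (fun s _ h => h)) _; rewrite leq_add2l.
  exact: count_upto_or (fun s _ h => h).
have n2 : (count_upto c2 t)%:R <= Xb by [].
lra.
Qed.

Lemma ctx_count_le m t : (count_upto (fun s => ctx s == m) t <=
  pulls (A m (xstar m)) t + count_upto subopt t)%N.
Proof.
apply: count_upto_or => s _ /eqP <-; rewrite /subopt /Defs.action.
by case: (eqVneq (arm s) (xstar (ctx s))) => [->|]; rewrite ?eqxx ?orbT.
Qed.

Local Notation Nstar := (16 * Lam * f / g0 ^+ 2).

(** The occurrences of a context that are not suboptimal rounds are pulls of its optimal arm, so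
    every optimal arm has reached the number of pulls that excludes exploration. *)
Lemma late_exploits t0 t : (forall u, (d <= u <= n)%N -> conf_at f u) ->
  (d <= t0)%N -> (t0 < t <= n)%N ->
  (forall m, Nstar + (count_upto subopt t0)%:R <=
     (count_upto (fun s => ctx s == m) t0)%:R) ->
  exploits t.
Proof.
move=> hc dt0 /andP[t0t tn] h; apply: contraT => nex.
have t0t' : (t0 <= t.-1)%N by rewrite -ltnS prednK// (leq_trans _ t0t).
have [|m] := explore_pulls (leq_trans dt0 t0t') _ nex.
  by apply: hc; rewrite (leq_trans dt0 t0t') (leq_trans (leq_pred _)).
rewrite ltNge => /negP[]; have := h m.
have : (count_upto (fun s => ctx s == m) t0)%:R <=
    (pulls (A m (xstar m)) t0)%:R + (count_upto subopt t0)%:R :> R.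
  by rewrite -natrD ler_nat ctx_count_le.
have : (pulls (A m (xstar m)) t0)%:R <= (pulls (A m (xstar m)) t.-1)%:R :> R.
  by rewrite ler_nat; exact: count_upto_mono.
lra.
Qed.

Lemma suboptimal_count_stops t0 :
  (forall u, (d <= u <= n)%N -> conf_at f u) ->
  (d <= t0 <= n)%N ->
  (forall m, Nstar + (count_upto subopt t0)%:R <=
     (count_upto (fun s => ctx s == m) t0)%:R) ->
  (forall s, (d < s <= n)%N -> exploits s -> ~~ subopt s) ->
  (count_upto subopt n <= count_upto subopt t0)%N.
Proof.
move=> hc /andP[dt0 t0n] h hex.
(* The induction runs over t <= n, while the horizon n of the hypotheses stays fixed. *)
have {t0n} : (n <= n)%N by [].
elim: {1 3}n => [|t IH] tn.
  by rewrite count_upto0.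
have [t0t|tt0] := ltnP t0 t.+1; last first.
  exact: count_upto_mono.
rewrite count_uptoS [X in (_ + X)%N](_ : _ = 0%N) ?addn0 ?IH// ?(ltnW tn)//.
rewrite (negbTE (hex t.+1 _ _))//; first by rewrite (leq_ltn_trans dt0).
by apply: late_exploits h; rewrite ?t0t.
Qed.

(** An exploration at s > t0 needs an optimal arm with fewer than [Nstar] pulls. Its context has
    occurred at least rho (s-1) times, of which at most a + (rho/2) (s-1) were suboptimal, so
    (rho/2) (s-1) <= a + Nstar. This bounds the last exploration round, hence their number. *)
Lemma explorations_bound t0 rho a eta :
  (forall u, (d <= u <= n)%N -> conf_at f u) ->
  (d <= t0)%N -> 0 < rho -> 0 <= a -> 2 * eta <= rho ->
  (forall t m, (t0 <= t <= n)%N ->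
     rho * t%:R <= (count_upto (fun s => ctx s == m) t)%:R) ->
  (forall t, (t0 <= t <= n)%N -> (count_upto subopt t)%:R <= a + eta * t%:R) ->
  (explorations n)%:R <= t0%:R + 1 + 2 * (a + Nstar) / rho.
Proof.
move=> hc dt0 rho0 a0 er hctx hsub; rewrite explorationsE.
have N0 : 0 <= Nstar by rewrite divr_ge0 ?sqr_ge0// !mulr_ge0// ltW.
have W0 : 0 <= 2 * (a + Nstar) / rho.
  by rewrite divr_ge0 ?(ltW rho0)// mulr_ge0// addr_ge0.
apply: count_upto_le_real_bound; first by rewrite !addr_ge0.
move=> s /andP[s1 sn] /andP[ds nex].
have [st0|t0s] := leqP s t0.
  have : s%:R <= t0%:R :> R by rewrite ler_nat.
  by move: W0; lra.
have t0s' : (t0 <= s.-1)%N by rewrite -ltnS prednK.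
have sn' : (s.-1 <= n)%N by rewrite (leq_trans (leq_pred _)).
have [|m hm] := explore_pulls (leq_trans dt0 t0s') _ nex.
  by apply: hc; rewrite (leq_trans dt0 t0s').
have h1 := hctx s.-1 m; rewrite t0s' sn' in h1; have {}h1 := h1 isT.
have h2 := hsub s.-1; rewrite t0s' sn' in h2; have {}h2 := h2 isT.
have h3 : (count_upto (fun s => ctx s == m) s.-1)%:R <=
    (pulls (A m (xstar m)) s.-1)%:R + (count_upto subopt s.-1)%:R :> R.
  by rewrite -natrD ler_nat ctx_count_le.
have es : s%:R = s.-1%:R + 1 :> R by rewrite natr1 prednK.
have h4 : 2 * eta * s.-1%:R <= rho * s.-1%:R by rewrite ler_wpM2r.
have h5 : s.-1%:R <= 2 * (a + Nstar) / rho.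
  by rewrite ler_pdivlMr//; move: h1 h2 h3 h4 hm; lra.
have : 0 <= t0%:R :> R by [].
by rewrite es; move: h5; lra.
Qed.

Lemma suboptimal_count_le_explorations (Xb : R) :
  (count_upto (fun s => [&& d < s, exploits s & subopt s]%N) n)%:R <= Xb ->
  (count_upto subopt n)%:R <= d%:R + (explorations n)%:R + Xb.
Proof.
move=> hX.
have : (count_upto subopt n <= count_upto (fun s => s <= d)%N n +
    (count_upto (fun s => (d < s)%N && ~~ exploits s) n +
    count_upto (fun s => [&& d < s, exploits s & subopt s]%N) n))%N.
  have h : forall s, (1 <= s <= n)%N -> subopt s -> (s <= d)%N ||
    (((d < s)%N && ~~ exploits s) || [&& d < s, exploits s & subopt s]%N).
    by move=> s _ ->; case: leqP => //= _; case: (exploits s).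
  apply: leq_trans (count_upto_or h) _; rewrite leq_add2l.
  exact: count_upto_or (fun s _ h => h).
rewrite -explorationsE -(ler_nat R) !natrD.
have : (count_upto (fun s => s <= d)%N n)%:R <= d%:R :> R.
  by rewrite ler_nat; apply: count_upto_le_bound.
lra.
Qed.

Lemma wrong_exploit_count t : (t <= n)%N ->
  (forall u, (d <= u <= n)%N -> conf_at f u) ->
  (forall u m i j, (d <= u <= n)%N -> i != j ->
     dotp (A m i - A m j) (theta_hat u) != 0) ->
  (count_upto (fun s => [&& d < s, exploits s & subopt s]%N) t)%:R <=
  (M * K)%:R * (f / g0 ^+ 2 + 1).
Proof.
move=> tn hc nt; apply: count_small_pulls.
  by rewrite divr_ge0 ?sqr_ge0// ltW.
move=> s /andP[s1 st] /and3P[ds ex sub].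
have sn := leq_trans st tn.
have ds' : (d <= s.-1)%N by rewrite -ltnS prednK.
have sn' : (s.-1 <= n)%N by rewrite (leq_trans (leq_pred _)).
have := hfol (t := s); rewrite s1 sn => /(_ isT).
rewrite leqNgt ds /= ex => gr.
apply: wrong_exploit_pulls => //; first by apply: hc; rewrite ds'.
by apply: nt => //; rewrite ds'.
Qed.

Lemma no_wrong_exploit F s :
  (forall u, (d <= u <= n)%N -> conf_at F u) -> 4 * F <= f ->
  (forall u m i j, (d <= u <= n)%N -> i != j ->
     dotp (A m i - A m j) (theta_hat u) != 0) ->
  (d < s <= n)%N -> exploits s -> ~~ subopt s.
Proof.
move=> hc Ff nt /andP[ds sn] ex; apply/negP => sub.
have ds' : (d <= s.-1)%N by rewrite -ltnS prednK// (leq_ltn_trans _ ds).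
have sn' : (s.-1 <= n)%N by rewrite (leq_trans (leq_pred _)).
have := hfol (t := s); rewrite (leq_ltn_trans _ ds)// sn => /(_ isT).
rewrite leqNgt ds /= ex => gr.
have hcs : conf_at F s.-1 by apply: hc; rewrite ds'.
have /eqP := exploit_optimal ds' hcs Ff ex gr sub.
by apply/negP; apply: nt => //; rewrite ds'.
Qed.

End Trajectory.

(** * The standard Gaussian distribution *)

Section Gauss.
Variable R : realType.
Local Notation mu := (@lebesgue_measure R).
Local Notation gamma := (@normal_prob R 0 1).

Lemma gauss_density_ae :
  ae_eq mu setT (Radon_Nikodym_SigmaFinite.f gamma mu)
    (fun x => (normal_pdf 0 1 x)%:E).
Proof.
have gm : gamma `<< mu by exact: normal_prob_dominates.
apply: integral_ae_eq => //.
- exact: Radon_Nikodym_SigmaFinite.f_integrable.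
- by apply/measurable_EFinP; exact: measurable_normal_pdf.
- by move=> E _ mE; rewrite -Radon_Nikodym_SigmaFinite.f_integral.
Qed.

Lemma ge0_integral_gauss (f : R -> \bar R) : (forall x, (0 <= f x)%E) ->
  measurable_fun setT f ->
  (\int[gamma]_x f x = \int[mu]_x (f x * (normal_pdf 0 1 x)%:E))%E.
Proof.
move=> f0 mf; have gm : gamma `<< mu by exact: normal_prob_dominates.
rewrite -(Radon_Nikodym_SigmaFinite.change_of_variables gm)//.
apply: ae_eq_integral => //.
- apply: emeasurable_funM => //.
  exact: measurable_int (Radon_Nikodym_SigmaFinite.f_integrable gm).
- apply: emeasurable_funM => //.
  by apply/measurable_EFinP; exact: measurable_normal_pdf.
- apply: ae_eqe_mul2l; exact: gauss_density_ae.
Qed.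

(** |x| times the density of variance 1 is dominated by a multiple of the density of standard
    deviation 2: the exponents differ by 3 x^2 / 8, and 2 exp (3 x^2 / 8) >= |x|. *)
Lemma gauss_integrable : gamma.-integrable setT (fun x => x%:E).
Proof.
apply/integrableP; split; first exact: EFin_measurable.
rewrite ge0_integral_gauss//; last exact: measurableT_comp.
pose k := 2 * normal_peak 1 / normal_peak 2 : R.
have p2 : 0 < normal_peak (2 : R) by rewrite normal_peak_gt0.
have p1 : 0 < normal_peak (1 : R) by rewrite normal_peak_gt0.
apply: (@le_lt_trans _ _ (\int[mu]_x (k%:E * (normal_pdf 0 2 x)%:E))%E).
  apply: ge0_le_integral => //.
  - by move=> x _; rewrite mule_ge0// lee_fin normal_pdf_ge0.
  - apply: emeasurable_funM; first exact: measurableT_comp.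
    by apply/measurable_EFinP; exact: measurable_normal_pdf.
  - apply: emeasurable_funM => //.
    by apply/measurable_EFinP; exact: measurable_normal_pdf.
  - move=> x _; rewrite !normal_pdfE// -EFinM lee_fin /k /normal_fun.
    set p := normal_peak 1; set q := normal_peak 2.
    have -> : 2 * p / q * (q * expR (- (x - 0) ^+ 2 / (2 ^+ 2 *+ 2))) =
        p * (2 * expR (- (x - 0) ^+ 2 / (2 ^+ 2 *+ 2))).
      by field; rewrite gt_eqF.
    rewrite mulrCA ler_wpM2l ?(ltW p1)//.
    have -> : - (x - 0) ^+ 2 / (2 ^+ 2 *+ 2) =
       3 / 8 * x ^+ 2 + (- (x - 0) ^+ 2 / (1 ^+ 2 *+ 2)) :> R.
      by rewrite subr0; field.
    rewrite expRD mulrA ler_wpM2r ?expR_ge0//.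
    have := expR_ge1Dx (3 / 8 * x ^+ 2).
    have : `|x| <= 2 * (1 + 3 / 8 * x ^+ 2).
      have := sqr_ge0 (x - 1); have := sqr_ge0 (x + 1).
      by have := sqr_ge0 x; rewrite !expr2 ler_norml => *; apply/andP; split; nra.
    by lra.
rewrite integralZl//; last exact: integrable_normal_pdf.
by rewrite integral_normal_pdf mule1 ltry.
Qed.

Lemma gauss_sym (B : set R) : measurable B -> gamma (-%R @^-1` B) = gamma B.
Proof.
move=> mB; rewrite /normal_prob.
transitivity (\int[pushforward mu (-%R : _ -> measurableTypeR R)]_(x in B)
   (normal_pdf 0 1 x)%:E)%E.
  rewrite ge0_integral_pushforward//=.
  - apply: eq_integral => x _; congr (_%:E).
    by rewrite !normal_pdfE// /normal_fun /= !subr0 sqrrN.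
  - by apply/measurable_EFinP; apply: measurable_funTS; exact: measurable_normal_pdf.
  - by move=> x _; rewrite lee_fin normal_pdf_ge0.
by apply: eq_measure_integral => C mC CB; exact: lebesgue_measureN.
Qed.

(** By symmetry the mean equals its opposite; integrability makes it finite, hence 0. *)
Lemma gauss_mean0 : (\int[gamma]_x x%:E = 0)%E.
Proof.
have h : (\int[gamma]_x x%:E = \int[gamma]_x (- x)%:E)%E.
  transitivity (\int[pushforward gamma (-%R : _ -> measurableTypeR R)]_x x%:E)%E.
    by apply: eq_measure_integral => C mC CB; rewrite /= -gauss_sym.
  rewrite integral_pushforward//=.
  rewrite preimage_setT.
  by have := integrableN gauss_integrable.
have e : (\int[gamma]_x (- x)%:E = (-1)%:E * \int[gamma]_x x%:E)%E.
  rewrite -(integralZl measurableT gauss_integrable).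
  by apply: eq_integral => x _; rewrite -EFinM mulN1r.
move: h; rewrite e.
have := integrable_fin_num measurableT gauss_integrable.
case: (integral _ _ _) => //= x _ []; rewrite mulN1r => h.
by congr (_%:E); lra.
Qed.

Lemma gauss_le_lebesgue (B : set R) : measurable B ->
  (gamma B <= (normal_peak 1)%:E * mu B)%E.
Proof.
move=> mB; rewrite /normal_prob -integral_cst//; apply: ge0_le_integral => //.
- by move=> x _; rewrite lee_fin normal_pdf_ge0.
- by apply/measurable_EFinP; apply: measurable_funTS; exact: measurable_normal_pdf.
- by move=> x _; rewrite lee_fin normal_pdf_ub.
Qed.

End Gauss.

(** * Measurability of the confidence events *)

Section FiniteFibers.
Context dT (T : measurableType dT) (I : finType) (H : T -> I).
Hypothesis mH : forall i, measurable (H @^-1` [set i]).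

Lemma measurable_dep_finite (S : I -> set T) : (forall i, measurable (S i)) ->
  measurable [set w | S (H w) w].
Proof.
move=> mS.
have -> : [set w | S (H w) w] = \bigcup_(i in setT) (H @^-1` [set i] `&` S i).
  apply/seteqP; split => [w /= h|w [i _ [/= <-]]//]; by exists (H w).
apply: fin_bigcup_measurable => [|i _]; first exact: finite_finset.
exact: measurableI.
Qed.

Lemma measurable_fun_dep_finite d' (U : measurableType d') (g : I -> T -> U) :
  (forall i, measurable_fun setT (g i)) ->
  measurable_fun setT (fun w => g (H w) w).
Proof.
move=> mg _ B mB; rewrite setTI.
apply: (@measurable_dep_finite (fun i => g i @^-1` B)) => i.
by rewrite -[X in measurable X]setTI; exact: mg.
Qed.

End FiniteFibers.

Section TrajectoryExt.
Variables (R : realType) (d K M : nat) (A : 'I_M -> 'I_K -> 'cV[R]_d).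
Variables (ctx ctx' : nat -> 'I_M) (arm arm' : nat -> 'I_K) (rew : nat -> R).

Lemma dotp_theta_hat v t : dotp v (theta_hat A ctx arm rew t) =
  \sum_(1 <= s < t.+1)
    dotp v (invmx (design A ctx arm t) *m action A ctx arm s) * rew s.
Proof.
rewrite /theta_hat mulmx_sumr dotpC dotp_suml; apply: eq_bigr => s _.
by rewrite -scalemxAr dotpZl mulrC dotpC.
Qed.

Variable n : nat.
Hypothesis ec : forall s, (1 <= s <= n)%N -> ctx s = ctx' s.
Hypothesis ea : forall s, (1 <= s <= n)%N -> arm s = arm' s.

Lemma action_ext s : (1 <= s <= n)%N ->
  action A ctx arm s = action A ctx' arm' s.
Proof. by move=> sn; rewrite /action ec// ea. Qed.

Lemma design_ext t : (t <= n)%N -> design A ctx arm t = design A ctx' arm' t.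
Proof.
move=> tn; apply: eq_big_nat => s /andP[s1 st].
by rewrite action_ext// s1 -ltnS (leq_trans st).
Qed.

Lemma theta_hat_ext t : (t <= n)%N ->
  theta_hat A ctx arm rew t = theta_hat A ctx' arm' rew t.
Proof.
move=> tn; rewrite /theta_hat design_ext//; congr (_ *m _).
apply: eq_big_nat => s /andP[s1 st].
by rewrite action_ext// s1 -ltnS (leq_trans st).
Qed.

End TrajectoryExt.

Section Run.
Variables (R : realType) (d K M : nat) (A : 'I_M -> 'I_K -> 'cV[R]_d).
Variables (theta : 'cV[R]_d) (p : 'I_M -> R) (n : nat).
Variable r : bandit_run A theta p n.
Local Notation P := (run_prob r).

Lemma ctx_arm_measurable t (u : 'I_M * 'I_K) :
  measurable ((fun w => (run_ctx r t w, run_arm r t w)) @^-1` [set u]).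
Proof.
rewrite (_ : _ @^-1` _ =
    run_ctx r t @^-1` [set u.1] `&` run_arm r t @^-1` [set u.2]); last first.
  by apply/seteqP; split=> w /=; [move=> <-|case: u => /= u1 u2 [-> ->]].
by apply: measurableI; [exact: ctx_measurable|exact: arm_measurable].
Qed.

Lemma rew_measurable t : measurable_fun setT (run_rew r t).
Proof.
apply: (@measurable_fun_dep_finite _ _ _
  (fun w => (run_ctx r t w, run_arm r t w)) (ctx_arm_measurable t) _ _
  (fun u w => dotp (A u.1 u.2) theta + run_noise r t w)).
by move=> u; apply: measurable_funD.
Qed.

(** The discrete part of the run takes finitely many values. On each fibre the design matrices are
    constant and the estimates are linear in the rewards with constant coefficients. *)
Definition run_history (w : run_space r) : {ffun 'I_n.+1 -> 'I_M * 'I_K} :=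
  [ffun s : 'I_n.+1 => (run_ctx r s w, run_arm r s w)].

Lemma run_history_measurable h : measurable (run_history @^-1` [set h]).
Proof.
rewrite (_ : _ @^-1` _ = \bigcap_(s in [set: 'I_n.+1])
    (fun w => (run_ctx r s w, run_arm r s w)) @^-1` [set h s]); last first.
  apply/seteqP; split=> w /=; first by move=> <- s _; rewrite ffunE.
  by move=> hw; apply/ffunP => s; rewrite ffunE; exact: hw.
apply: fin_bigcap_measurable => [|s _]; first exact: finite_finset.
exact: ctx_arm_measurable.
Qed.

Implicit Types h : {ffun 'I_n.+1 -> 'I_M * 'I_K}.
Definition hist_ctx h s := (h (inord s)).1.
Definition hist_arm h s := (h (inord s)).2.

Lemma hist_ctxE w s : (1 <= s <= n)%N ->
  run_ctx r s w = hist_ctx (run_history w) s.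
Proof. by move=> /andP[_ sn]; rewrite /hist_ctx ffunE /= inordK. Qed.

Lemma hist_armE w s : (1 <= s <= n)%N ->
  run_arm r s w = hist_arm (run_history w) s.
Proof. by move=> /andP[_ sn]; rewrite /hist_arm ffunE /= inordK. Qed.

Definition hist_coef h v t s : R :=
  dotp v (invmx (design A (hist_ctx h) (hist_arm h) t) *m
          action A (hist_ctx h) (hist_arm h) s).

Lemma run_theta_hat v t w : (t <= n)%N ->
  dotp v (theta_hat A (run_ctx r ^~ w) (run_arm r ^~ w) (run_rew r ^~ w) t) =
  \sum_(1 <= s < t.+1) hist_coef (run_history w) v t s * run_rew r s w.
Proof.
move=> tn; rewrite (theta_hat_ext A _ (@hist_ctxE w) (@hist_armE w) tn).
by rewrite dotp_theta_hat.
Qed.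

Lemma measurable_lin_rew (a : nat -> R) t :
  measurable_fun setT (fun w => \sum_(1 <= s < t) a s * run_rew r s w).
Proof.
apply: measurable_sum => s; apply: measurable_funM => //.
exact: rew_measurable.
Qed.

Lemma confidence_failure_measurable c delta :
  measurable (@confidence_failure _ _ _ _ A theta p n r c delta).
Proof.
pose S h := \bigcup_(x in [set x : 'I_n.+1 * ('I_M * 'I_K) |
    (d <= x.1)%N /\ A x.2.1 x.2.2 != 0])
  [set w | norm_inv (design A (hist_ctx h) (hist_arm h) x.1) (A x.2.1 x.2.2) *
    Num.sqrt (f_conf c d n delta) <=
   `|\sum_(1 <= s < x.1.+1) hist_coef h (A x.2.1 x.2.2) x.1 s * run_rew r s w -
     dotp (A x.2.1 x.2.2) theta| ].
rewrite (_ : confidence_failure c delta = [set w | S (run_history w) w]).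
  apply: measurable_dep_finite; first exact: run_history_measurable.
  move=> h; apply: fin_bigcup_measurable => [|x _]; first exact: finite_finset.
  rewrite -[X in measurable X]setTI; apply: measurable_fun_le => //.
  apply: measurableT_comp; first exact: normr_measurable.
  by apply: measurable_funB => //; exact: measurable_lin_rew.
have eD w t : (t <= n)%N -> design A (run_ctx r ^~ w) (run_arm r ^~ w) t =
    design A (hist_ctx (run_history w)) (hist_arm (run_history w)) t.
  move=> tn; apply: (@design_ext _ _ _ _ _ _ _ _ _ n) => // s.
    exact: hist_ctxE.
  exact: hist_armE.
apply/seteqP; split=> w /=.
  move=> [t [m [i [/andP[dt tn] A0 hle]]]].
  exists (inord t, (m, i)) => /=; rewrite inordK ?ltnS//.
  by move: hle; rewrite eD// dotpBr run_theta_hat.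
move=> [[t [m i]] /= [dt A0] hle]; exists t, m, i.
have tn : (t <= n)%N by rewrite -ltnS.
by rewrite dt tn; split=> //; rewrite eD// dotpBr run_theta_hat.
Qed.

End Run.

(** * Absence of ties *)

Section Cells.
Variable R : realType.
Implicit Types (e x : R).

(** These sets partition the line into pairs of opposite intervals of length e. Using |x| keeps the
    index a natural number, at the price of a factor 2 in the measure. *)
Definition cell e (k : nat) : set R := [set x | k%:R * e <= `|x| < k.+1%:R * e].

Lemma measurable_cell e k : measurable (cell e k).
Proof.
rewrite (_ : cell e k = Num.norm @^-1` `[k%:R * e, k.+1%:R * e[); last first.
  by apply/seteqP; split=> x; rewrite /= in_itv.
by rewrite -[X in measurable X]setTI; exact: normr_measurable.
Qed.

Lemma cell_cover e x : 0 < e -> exists k, cell e k x.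
Proof.
move=> e0; exists (Num.truncn (`|x| / e)); rewrite /cell /=.
rewrite -ler_pdivlMr// -ltr_pdivrMr//; apply: truncn_itv.
by rewrite divr_ge0// ltW.
Qed.

Lemma cell_inj e x j k : 0 < e -> cell e j x -> cell e k x -> j = k.
Proof.
move=> e0 /andP[j1 j2] /andP[k1 k2].
have jk : (j <= k)%N.
  by rewrite -ltnS -(ltr_nat R) -(ltr_pM2r e0); exact: le_lt_trans k2.
have kj : (k <= j)%N.
  by rewrite -ltnS -(ltr_nat R) -(ltr_pM2r e0); exact: le_lt_trans j2.
by apply/eqP; rewrite eqn_leq jk kj.
Qed.

Lemma gauss_cell_le e k : 0 < e ->
  (normal_prob 0 1 (cell e k) <= (normal_peak 1 * (2 * e))%:E)%E.
Proof.
move=> e0; apply: le_trans (gauss_le_lebesgue (measurable_cell e k)) _.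
rewrite EFinM lee_wpmul2l ?lee_fin ?normal_peak_ge0//.
pose I1 : set R := `[k%:R * e, k.+1%:R * e]%classic.
pose I2 : set R := `[- (k.+1%:R * e), - (k%:R * e)]%classic.
have ke : k%:R * e <= k.+1%:R * e by rewrite ler_pM2r// ler_nat.
apply: (@le_trans _ _ (lebesgue_measure (I1 `|` I2))).
  apply: le_measure; rewrite ?inE; [exact: measurable_cell| |].
    by apply: measurableU; exact: measurable_itv.
  move=> x /= /andP[h1 h2]; have [x0|x0] := leP 0 x.
    by left; rewrite /I1 /= in_itv /=; move: h1 h2; rewrite ger0_norm// => -> /ltW ->.
  right; rewrite /I2 /= in_itv /=; move: h1 h2; rewrite ltr0_norm//.
  by rewrite lerNr => ->; rewrite ltrNl => /ltW ->.
have ee : k.+1%:R * e - k%:R * e = e by rewrite -natr1; lra.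
have klt : k%:R * e < k.+1%:R * e by rewrite ltr_pM2r// ltr_nat.
have l1 : (lebesgue_measure I1 <= e%:E)%E.
  by rewrite /I1 lebesgue_measure_itv /= lte_fin klt -EFinB ee.
have l2 : (lebesgue_measure I2 <= e%:E)%E.
  by rewrite /I2 lebesgue_measure_itv /= lte_fin ltrN2 klt -EFinB opprK addrC ee.
have mI1 : measurable I1 by exact: measurable_itv.
have mI2 : measurable I2 by exact: measurable_itv.
apply: (le_trans (measureU2 lebesgue_measure mI1 mI2)).
have -> : (2 * e)%:E = (e%:E + e%:E)%E by rewrite -EFinD; congr (_%:E); lra.
by apply: leeD; [exact: l1|exact: l2].
Qed.

End Cells.

Section NoiseNull.
Variables (R : realType) (d K M : nat) (A : 'I_M -> 'I_K -> 'cV[R]_d).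
Variables (theta : 'cV[R]_d) (p : 'I_M -> R) (n : nat).
Variable r : bandit_run A theta p n.
Local Notation P := (run_prob r).
Local Notation past_choice := (past_and_choice (run_ctx r) (run_arm r) (run_rew r)).

(** Independence is given for events, so W is discretised: equality puts noise and W in the same
    cell, and P (W in cell) P (noise in cell) sums to at most 2 e times the peak of the density, for
    every e > 0. *)
Lemma noise_null t (W : run_space r -> R) : (1 <= t <= n)%N ->
  measurable_fun setT W ->
  (forall B, measurable B -> past_choice t (W @^-1` B)) ->
  P [set w | run_noise r t w = W w] = 0%E.
Proof.
move=> tn mW pW; set S := [set w | _].
have mS : measurable S.
  have m0 : measurable_fun setT (fun w => run_noise r t w - W w).
    exact: measurable_funB.
  rewrite (_ : S = (fun w => run_noise r t w - W w) @^-1` [set 0]).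
    by rewrite -[X in measurable X]setTI; exact: m0.
  apply/seteqP; split=> w /= => [->|]; first by rewrite subrr.
  by move=> /eqP; rewrite subr_eq0 => /eqP.
have pk := normal_peak_gt0 (oner_neq0 R).
suff bd (e : R) : 0 < e -> (P S <= (normal_peak 1 * (2 * e))%:E)%E.
  apply/eqP; rewrite eq_le measure_ge0 andbT; apply/lee_addgt0Pr => e e0.
  rewrite add0e; have := bd (e / (2 * normal_peak 1)) (divr_gt0 e0 (mulr_gt0 (ltr0Sn _ _) pk)).
  by rewrite (_ : normal_peak 1 * _ = e)//; field; rewrite gt_eqF.
move=> e0.
pose F k := W @^-1` cell e k `&` run_noise r t @^-1` cell e k.
have mWc k : measurable (W @^-1` cell e k).
  by rewrite -[X in measurable X]setTI; apply: mW => //; exact: measurable_cell.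
have mF k : measurable (F k).
  apply: measurableI => //.
  by rewrite -[X in measurable X]setTI; apply: measurable_funPT => //; exact: measurable_cell.
have SF : S `<=` \bigcup_k F k.
  move=> w /= Sw; have [k hk] := cell_cover (W w) e0.
  by exists k => //; split => //=; rewrite Sw.
apply: (le_trans (measure_sigma_subadditive P mF mS SF)).
have FE k : (P (F k) <= (normal_peak 1 * (2 * e))%:E * P (W @^-1` cell e k))%E.
  rewrite /F (noise_law tn)//; last exact: measurable_cell.
    by rewrite muleC lee_wpmul2r// gauss_cell_le.
  exact: pW (measurable_cell e k).
apply: (@le_trans _ _ (\sum_(0 <= k <oo)
    ((normal_peak 1 * (2 * e))%:E * P (W @^-1` cell e k)))%E).
  by apply: lee_nneseries => [k _ _|k _]; [exact: measure_ge0|exact: FE].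
rewrite nneseriesZl//.
rewrite -[leRHS]mule1 lee_wpmul2l ?lee_fin ?mulr_ge0 ?(ltW pk) ?(ltW e0)//.
rewrite (@eq_eseriesl _ _ (fun x => x \in [set: nat])); last first.
  by move=> x; rewrite in_setT.
rewrite -measure_bigcup//; first exact/probability_le1/bigcupT_measurable.
apply/trivIsetP => i j _ _ ij; apply/seteqP; split=> // w /= [h1 h2].
by move: ij; rewrite (cell_inj e0 h1 h2) eqxx.
Qed.

End NoiseNull.

Lemma negligible_finite_cover dT (T : ringOfSetsType dT) (R : realFieldType)
    (mu : {content set T -> \bar R}) (I : finType) (F : I -> set T) (S : set T) :
  (forall w, S w -> exists i, F i w) -> (forall i, mu.-negligible (F i)) ->
  mu.-negligible S.
Proof.
move=> SF nF; apply: (@negligibleS _ _ _ _ (\big[setU/set0]_(i : I) F i)).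
  move=> w /SF[i Fi]; rewrite -bigcup_seq; exists i => //=.
  by rewrite mem_index_enum.
by elim/big_ind: _ => //; [exact: negligible_set0|exact: negligibleU].
Qed.

Section DesignCoef.
Variables (R : realType) (d K M : nat) (A : 'I_M -> 'I_K -> 'cV[R]_d).
Variables (ctx : nat -> 'I_M) (arm : nat -> 'I_K).

Lemma design_trmx t : (design A ctx arm t)^T = design A ctx arm t.
Proof.
rewrite /design raddf_sum; apply: eq_bigr => s _.
by rewrite /= trmx_mul trmxK.
Qed.

(** If all these numbers vanished, y = (D^-1)^T v would be orthogonal to every action, so D y = 0;
    but D is symmetric, so D y = v. *)
Lemma design_coef_neq0 v t : design A ctx arm t \in unitmx -> v != 0 ->
  exists2 s, (1 <= s <= t)%N &
    dotp v (invmx (design A ctx arm t) *m action A ctx arm s) != 0.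
Proof.
set D := design A ctx arm t => uD v0; apply: contrapT => nex.
pose y := (invmx D)^T *m v.
have yX s : (1 <= s <= t)%N -> (action A ctx arm s)^T *m y = 0.
  move=> st; apply/matrixP => i j; rewrite !ord1 [RHS]mxE.
  apply/eqP/negPn/negP => h; apply: nex; exists s => //.
  apply: contra h => /eqP h; apply/eqP; rewrite -[RHS]h -/(dotp _ _) dotpC.
  by rewrite /dotp /y trmx_mul trmxK mulmxA.
move: v0 => /eqP; apply.
have -> : v = D *m y.
  rewrite -[X in X *m _](design_trmx t : D^T = D) /y mulmxA -trmx_mul.
  by rewrite mulVmx// trmx1 mul1mx.
rewrite /D /design mulmx_suml big_nat big1// => s st.
by rewrite -mulmxA yX ?mulmx0.
Qed.

End DesignCoef.

Section Ties.
Variables (R : realType) (d K M : nat) (A : 'I_M -> 'I_K -> 'cV[R]_d).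
Variables (theta : 'cV[R]_d) (p : 'I_M -> R) (n : nat).
Variable r : bandit_run A theta p n.
Local Notation P := (run_prob r).
Local Notation past_choice := (past_and_choice (run_ctx r) (run_arm r) (run_rew r)).

Lemma past_lin_rew (a : nat -> R) (b c : R) t B : measurable B ->
  past_choice t
    ((fun w => b * (\sum_(1 <= s < t) a s * run_rew r s w) + c) @^-1` B).
Proof.
move=> mB; rewrite /past_and_choice.
set G := (X in <<s X >>).
have mr s : (1 <= s < t)%N ->
    measurable_fun (setT : set (g_sigma_algebraType G))
      (run_rew r s : g_sigma_algebraType G -> R).
  move=> st _ C mC; rewrite setTI; apply: sub_sigma_algebra.
  by left; exists s => //=; right; exists C.
(* Measurability of a sum asks for every index, but only the rewards before t belong to the past;
   the others are cut to 0. *)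
pose rw s w := if (1 <= s < t)%N then run_rew r s w else 0.
have mrw s : measurable_fun (setT : set (g_sigma_algebraType G))
      (rw s : g_sigma_algebraType G -> R).
  rewrite /rw; case: (boolP (1 <= s < t)%N) => st; first exact: mr.
  exact: measurable_cst.
have : measurable_fun (setT : set (g_sigma_algebraType G))
   ((fun w => b * (\sum_(1 <= s < t) a s * rw s w) + c)
     : g_sigma_algebraType G -> R).
  apply: measurable_funD => //; apply: measurable_funM => //.
  by apply: measurable_sum => s; apply: measurable_funM.
move=> /(_ measurableT _ mB); rewrite setTI.
rewrite (_ : (fun w => _ + c) = (fun w => b * (\sum_(1 <= s < t) a s * run_rew r s w) + c))//.
apply/funext => w; congr (_ * _ + _); apply: eq_big_nat => s st.
by rewrite /rw st.
Qed.

Hypothesis hindep : forall w t, (1 <= t <= d)%N ->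
  action A (run_ctx r ^~ w) (run_arm r ^~ w) t \notin
  span [seq action A (run_ctx r ^~ w) (run_arm r ^~ w) s | s <- iota 1 t.-1].

(* Conditionally on the contexts and arms, the estimate is a nonconstant affine
   function of the last noise on which it depends. *)
Lemma tie_negligible v u : v != 0 -> (d <= u <= n)%N ->
  P.-negligible [set w | dotp v (theta_hat A (run_ctx r ^~ w) (run_arm r ^~ w)
    (run_rew r ^~ w) u) = 0].
Proof.
move=> v0 /andP[du un].
(* The arms after a round depend on its noise, hence so do the coefficients of the estimate. Fixing
   the whole history h makes them constants, and the event is enlarged to one relation between
   noises. *)
pose F h := [set w | run_history w = h /\
  design A (hist_ctx h) (hist_arm h) u \in unitmx /\
  \sum_(1 <= s < u.+1) hist_coef A h v u s * run_rew r s w = 0].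
apply: (negligible_finite_cover (F := F)) => [w /= h0|h].
  exists (run_history w); split=> //; split; last by rewrite -run_theta_hat.
  rewrite -(@design_ext _ _ _ _ A _ _ _ _ n (@hist_ctxE _ _ _ _ _ _ _ _ _ w)
     (@hist_armE _ _ _ _ _ _ _ _ _ w) _ un).
  by have := design_unitmx (hindep w) du.
have [uD|nD] := boolP (design A (hist_ctx h) (hist_arm h) u \in unitmx); last first.
  by apply: negligibleS (negligible_set0 P) => w [_ []]; rewrite (negbTE nD).
have [s1 s1u s1c] := design_coef_neq0 uD v0.
pose Q s := (1 <= s <= u)%N && (hist_coef A h v u s != 0).
have exQ : exists s, Q s by exists s1; rewrite /Q s1u.
have ubQ s : Q s -> (s <= u)%N by move=> /andP[/andP[]].
have [s0 /andP[/andP[s01 s0u] c0] s0max] := ex_maxnP exQ ubQ.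
set a := hist_coef A h v u s0 in c0.
(* W solves the tie equation for the noise of [s0], the last round with a nonzero coefficient; only
   earlier rewards occur in it. *)
pose W w := - a^-1 * (\sum_(1 <= s < s0) hist_coef A h v u s * run_rew r s w) +
  - dotp (A (hist_ctx h s0) (hist_arm h s0)) theta.
have mW : measurable_fun setT W.
  apply: measurable_funD => //; apply: measurable_funM => //.
  exact: measurable_lin_rew.
have s0n : (1 <= s0 <= n)%N by rewrite s01 (leq_trans s0u).
exists [set w | run_noise r s0 w = W w]; split.
- have m0 : measurable_fun setT (fun w => run_noise r s0 w - W w).
    exact: measurable_funB.
  rewrite (_ : [set w | _] = (fun w => run_noise r s0 w - W w) @^-1` [set 0]).
    by rewrite -[X in measurable X]setTI; exact: m0.
  apply/seteqP; split=> w /= => [->|]; first by rewrite subrr.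
  by move=> /eqP; rewrite subr_eq0 => /eqP.
- apply: noise_null => // B mB; exact: past_lin_rew.
- move=> w /= [hw [_]].
  rewrite (@big_cat_nat _ _ _ s0.+1)//= [X in _ + X]big_nat_cond.
  rewrite [X in _ + X]big1 => [|s /andP[/andP[s0s su] _]]; last first.
    apply/eqP; rewrite mulf_eq0; apply/orP; left.
    apply/negPn/negP => cs; have := s0max s; rewrite /Q cs andbT.
    by rewrite (leq_trans _ s0s)// -ltnS su leqNgt s0s => /(_ isT).
  rewrite addr0 big_nat_recr//= -/a.
  have -> : run_rew r s0 w =
      dotp (A (hist_ctx h s0) (hist_arm h s0)) theta + run_noise r s0 w.
    by rewrite /run_rew /= (hist_ctxE w s0n) (hist_armE w s0n) hw.
  rewrite /W; set Z := \sum_(1 <= s < s0) _ => h0.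
  have -> : Z = - (a * (dotp (A (hist_ctx h s0) (hist_arm h s0)) theta +
       run_noise r s0 w)) by lra.
  by field.
Qed.

End Ties.

(** * Occurrences of the contexts *)

Section Contexts.
Variables (R : realType) (d K M : nat) (A : 'I_M -> 'I_K -> 'cV[R]_d).
Variables (theta : 'cV[R]_d) (p : 'I_M -> R) (n : nat).
Variable r : bandit_run A theta p n.
Local Notation P := (run_prob r).
Local Notation past := (past (run_ctx r) (run_arm r) (run_rew r)).
Variable m : 'I_M.

Definition ctx_count (t : nat) (w : run_space r) : nat :=
  count_upto (fun s => run_ctx r s w == m) t.

Definition ctx_count_is (t k : nat) : set (run_space r) :=
  [set w | ctx_count t w = k].

Lemma ctx_count_isS0 t : ctx_count_is t.+1 0 =
  ctx_count_is t 0 `\` run_ctx r t.+1 @^-1` [set m].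
Proof.
apply/seteqP; split=> w; rewrite /ctx_count_is /ctx_count /= count_uptoS.
  by case: eqP => [_|ne]; rewrite ?addn1// addn0; split.
by move=> [-> /eqP/negbTE ->].
Qed.

Lemma ctx_count_isSS t k : ctx_count_is t.+1 k.+1 =
  (ctx_count_is t k.+1 `\` run_ctx r t.+1 @^-1` [set m]) `|`
  (ctx_count_is t k `&` run_ctx r t.+1 @^-1` [set m]).
Proof.
apply/seteqP; split=> w; rewrite /ctx_count_is /ctx_count /= count_uptoS.
  case: eqP => [e|ne]; rewrite ?addn1 ?addn0; first by move=> [<-]; right.
  by move=> ->; left.
move=> [[-> /eqP/negbTE ->]|[-> ->]]; first by rewrite addn0.
by rewrite eqxx addn1.
Qed.

Lemma ctx_count_is0 k : ctx_count_is 0 k = if k is 0 then setT else set0.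
Proof.
apply/seteqP; split=> w; rewrite /ctx_count_is /ctx_count /= count_upto0.
  by move=> <-.
by case: k.
Qed.

Lemma ctx_count_past t s k : (t < s)%N -> past s (ctx_count_is t k).
Proof.
move=> ts; rewrite /Defs.past; set G := past_events _ _ _ _.
suff : measurable (ctx_count_is t k : set (g_sigma_algebraType G)) by [].
have mC u : (1 <= u < s)%N -> measurable
    (run_ctx r u @^-1` [set m] : set (g_sigma_algebraType G)).
  by move=> us; apply: sub_sigma_algebra; exists u => //; left; left; exists [set m].
elim: t k ts => [|t IH] k ts.
  by rewrite ctx_count_is0; case: k.
have ts' := ltnW ts; case: k => [|k].
  by rewrite ctx_count_isS0; apply: measurableD; [exact: IH|exact: mC].
rewrite ctx_count_isSS; apply: measurableU.
  by apply: measurableD; [exact: IH|exact: mC].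
by apply: measurableI; [exact: IH|exact: mC].
Qed.

Lemma ctx_count_measurable t k : measurable (ctx_count_is t k).
Proof.
elim: t k => [|t IH] k; first by rewrite ctx_count_is0; case: k.
have mC : measurable (run_ctx r t.+1 @^-1` [set m]) by exact: ctx_measurable.
case: k => [|k]; first by rewrite ctx_count_isS0; exact: measurableD.
by rewrite ctx_count_isSS; apply: measurableU; [exact: measurableD|exact: measurableI].
Qed.

Local Notation prob t k := (fine (P (ctx_count_is t k))).

Lemma probE t k : P (ctx_count_is t k) = (prob t k)%:E.
Proof. by rewrite fineK// fin_num_measure//; exact: ctx_count_measurable. Qed.

Lemma prob_ge0 t k : 0 <= prob t k.
Proof. by rewrite fine_ge0. Qed.

Lemma prob_ctx t k : (t < n)%N ->
  P (ctx_count_is t k `&` run_ctx r t.+1 @^-1` [set m]) =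
  (prob t k * p m)%:E.
Proof.
move=> tn; rewrite (ctx_law (b := r))//; last exact: ctx_count_past.
by rewrite EFinM -probE.
Qed.

Lemma prob_not_ctx t k : (t < n)%N ->
  P (ctx_count_is t k `\` run_ctx r t.+1 @^-1` [set m]) =
  (prob t k * (1 - p m))%:E.
Proof.
move=> tn; rewrite measureD//.
- rewrite [X in (_ - X)%E](prob_ctx k tn) [X in (X - _)%E]probE -EFinB.
  by congr (_%:E); ring.
- exact: ctx_count_measurable.
- exact: ctx_measurable.
- by rewrite ltey_eq fin_num_measure//; exact: ctx_count_measurable.
Qed.

Lemma probS0 t : (t < n)%N -> prob t.+1 0 = prob t 0 * (1 - p m).
Proof. by move=> tn; rewrite ctx_count_isS0 prob_not_ctx. Qed.

Lemma probSS t k : (t < n)%N ->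
  prob t.+1 k.+1 = prob t k.+1 * (1 - p m) + prob t k * p m.
Proof.
move=> tn; rewrite ctx_count_isSS measureU.
- by rewrite [X in (_ + X)%E](prob_ctx k tn) [X in (X + _)%E](prob_not_ctx _ tn).
- by apply: measurableD; [exact: ctx_count_measurable|exact: ctx_measurable].
- by apply: measurableI; [exact: ctx_count_measurable|exact: ctx_measurable].
- by apply/seteqP; split=> // w /= [[_ h] []].
Qed.

Hypothesis p01 : 0 <= p m <= 1.

(** The left side is a truncation of the expectation of 2^-count. One round multiplies the full sum
    by (1 - p) + p / 2; the cut at N keeps the sums finite and turns equality into inequality. *)
Lemma ctx_generating_le t N : (t <= n)%N ->
  \sum_(0 <= k < N.+1) prob t k * 2^-1 ^+ k <= (1 - p m / 2) ^+ t.
Proof.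
have /andP[p0 p1] := p01.
elim: t => [|t IH] tn.
  rewrite big_nat_recl// ctx_count_is0 probability_setT /= big1 => [|k _].
    by rewrite addr0 mul1r !expr0.
  by rewrite ctx_count_is0 measure0 /= mul0r.
rewrite big_nat_recl// probS0//.
under eq_bigr do rewrite probSS//.
have {}IH := IH (ltnW tn).
rewrite exprS.
apply: (@le_trans _ _ ((1 - p m / 2) *
   \sum_(0 <= k < N.+1) prob t k * 2^-1 ^+ k)); last first.
  by rewrite ler_wpM2l//; lra.
have -> : \sum_(0 <= k < N)
    (prob t k.+1 * (1 - p m) + prob t k * p m) * 2^-1 ^+ k.+1 =
  (1 - p m) * (\sum_(0 <= k < N) prob t k.+1 * 2^-1 ^+ k.+1) +
  p m / 2 * (\sum_(0 <= k < N) prob t k * 2^-1 ^+ k).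
  rewrite !mulr_sumr -big_split /=; apply: eq_bigr => k _.
  by rewrite !exprS; field.
have h1 : \sum_(0 <= k < N.+1) prob t k * 2^-1 ^+ k =
   prob t 0 * 2^-1 ^+ 0 + \sum_(0 <= k < N) prob t k.+1 * 2^-1 ^+ k.+1.
  by rewrite big_nat_recl.
have h2 : \sum_(0 <= k < N) prob t k * 2^-1 ^+ k <=
   \sum_(0 <= k < N.+1) prob t k * 2^-1 ^+ k.
  by rewrite [leRHS]big_nat_recr//= lerDl mulr_ge0 ?prob_ge0// exprn_ge0.
have := ler_wpM2l (divr_ge0 p0 (ler0n _ 2)) h2.
rewrite h1 expr0; lra.
Qed.

(* Chernoff bound with the generating function at 1/2: (1 - p/2)^t is at most
   exp (- p t / 2), and 2^k <= e^k. *)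
Lemma ctx_count_small_prob t : (t <= n)%N ->
  measurable [set w | (ctx_count t w)%:R < p m / 4 * t%:R] /\
  (P [set w | ((ctx_count t w)%:R < p m / 4 * t%:R)%R] <=
    (expR (- (p m / 4 * t%:R)))%:E)%E.
Proof.
move=> tn; have /andP[p0 p1] := p01; set S := [set w | _].
pose Q (k : 'I_t.+1) := (k : nat)%:R < p m / 4 * t%:R.
have -> : S = \big[setU/set0]_(k < t.+1 | Q k) ctx_count_is t k.
  rewrite -bigcup_seq_cond; apply/seteqP; split=> w /=.
    move=> Sw; have ct : (ctx_count t w < t.+1)%N by rewrite ltnS count_upto_le.
    by exists (Ordinal ct) => //=; rewrite mem_index_enum.
  by move=> [k /= /andP[_ Qk] e]; rewrite /S /= e.
split; first by apply: bigsetU_measurable => k _; exact: ctx_count_measurable.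
rewrite measure_bigsetU_ord_cond; last 2 first.
- by move=> k _; exact: ctx_count_measurable.
- apply/trivIsetP => i j _ _ ij; apply/seteqP; split=> // w [/= h1 h2].
  by move: ij; rewrite -val_eqE /= -h1 -h2 eqxx.
rewrite (eq_bigr (fun k : 'I_t.+1 => (prob t k)%:E)) => [|k _]; last exact: probE.
rewrite sumEFin lee_fin.
pose E := expR (p m / 4 * t%:R).
apply: (@le_trans _ _ (E * \sum_(0 <= k < t.+1) prob t k * 2^-1 ^+ k)).
  rewrite big_mkord mulr_sumr big_mkcond /=; apply: ler_sum => k _.
  have ge0 : 0 <= E * (prob t k * 2^-1 ^+ k).
    by rewrite mulr_ge0 ?expR_ge0// mulr_ge0 ?prob_ge0// exprn_ge0.
  case: ifP => // Qk; rewrite mulrCA -[leLHS]mulr1 ler_wpM2l ?prob_ge0//.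
  apply: (@le_trans _ _ (expR k%:R * 2^-1 ^+ k)); last first.
    by rewrite ler_wpM2r ?exprn_ge0// ler_expR ltW.
  rewrite -[k%:R]mulr1 expRM_natl -exprMn.
  apply: exprn_ege1; have := expR_ge1Dx (1 : R); lra.
apply: (@le_trans _ _ (E * expR (- (p m / 2)) ^+ t)).
  rewrite ler_wpM2l ?expR_ge0//; apply: le_trans (ctx_generating_le _ tn) _.
  rewrite lerXn2r ?nnegrE ?expR_ge0//; first lra.
  by have := expR_ge1Dx (- (p m / 2)).
rewrite -expRM_natl -expRD ler_expR -mulr_natl; lra.
Qed.

End Contexts.

(** * Regret as an expectation of gaps *)

Section Regret.
Variables (R : realType) (d K M : nat) (A : 'I_M -> 'I_K -> 'cV[R]_d).
Variables (theta : 'cV[R]_d) (p : 'I_M -> R) (n : nat).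
Variable r : bandit_run A theta p n.
Local Notation P := (run_prob r).
Variable xstar : 'I_M -> 'I_K.
Hypothesis hopt : optimal_arms A theta xstar.

Lemma noise_distribution t (B : set R) : (1 <= t <= n)%N -> measurable B ->
  P (run_noise r t @^-1` B) = normal_prob 0 1 B.
Proof.
move=> tn mB; have := noise_law (b := r) tn (E := setT) _ mB.
rewrite setTI probability_setT mul1e; apply.
exact: (@measurableT _ (g_sigma_algebraType _)).
Qed.

(** The noise with values in [measurableTypeR R], so that its pushforward is a measure on that
    type. *)
Let noise_phi t : run_space r -> measurableTypeR R := run_noise r t.

Let noise_phi_measurable t : measurable_fun setT (noise_phi t).
Proof. by move=> _ B mB; apply: (measurable_funPT (run_noise r t)). Qed.

Lemma noise_integrable t : (1 <= t <= n)%N ->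
  P.-integrable setT (EFin \o run_noise r t).
Proof.
move=> tn; apply/integrableP; split; first exact/measurable_EFinP.
have /integrableP[_ h] := gauss_integrable R.
have := @ge0_integral_pushforward _ _ _ _ _ (noise_phi t)
  (noise_phi_measurable t) P setT (fun x => `|x%:E|%E) measurableT.
rewrite preimage_setT => <-//=; last exact: measurableT_comp.
apply: le_lt_trans h; rewrite le_eqVlt; apply/orP; left; apply/eqP.
by apply: eq_measure_integral => B mB _; rewrite /= -(noise_distribution tn).
Qed.

Lemma noise_mean0 t : (1 <= t <= n)%N -> (\int[P]_w (run_noise r t w)%:E = 0)%E.
Proof.
move=> tn; rewrite -(gauss_mean0 R).
transitivity (\int[pushforward P (noise_phi t)]_x x%:E)%E.
  rewrite (integral_pushforward (noise_phi_measurable t))//=.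
  by rewrite preimage_setT; exact: noise_integrable.
by apply: eq_measure_integral => B mB _; rewrite /= -(noise_distribution tn).
Qed.

Definition run_gap (w : run_space r) (t : nat) : R :=
  gaps A theta xstar (run_ctx r t w) (run_arm r t w).

Definition gap_sum (w : run_space r) : R := \sum_(1 <= t < n.+1) run_gap w t.

Lemma gaps_ge0 m i : 0 <= gaps A theta xstar m i.
Proof. by rewrite mxE dotpBl subr_ge0. Qed.

Lemma gap_sum_ge0 w : 0 <= gap_sum w.
Proof. by apply: sumr_ge0 => t _; exact: gaps_ge0. Qed.

Definition gap_total : R := \sum_m \sum_i gaps A theta xstar m i.

Lemma gap_le_total m i : gaps A theta xstar m i <= gap_total.
Proof.
rewrite /gap_total (bigD1 m)//= (bigD1 i)//= -addrA lerDl addr_ge0//.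
  by apply: sumr_ge0 => j _; exact: gaps_ge0.
by apply: sumr_ge0 => k _; apply: sumr_ge0 => j _; exact: gaps_ge0.
Qed.

Lemma gap_total_ge0 : 0 <= gap_total.
Proof. by apply: sumr_ge0 => k _; apply: sumr_ge0 => j _; exact: gaps_ge0. Qed.

Lemma gap_sum_measurable : measurable_fun setT gap_sum.
Proof.
apply: measurable_sum => t.
exact: (@measurable_fun_dep_finite _ _ _
  (fun w => (run_ctx r t w, run_arm r t w)) (ctx_arm_measurable r t) _ _
  (fun u w => gaps A theta xstar u.1 u.2)).
Qed.

Lemma gap_sum_le w : gap_sum w <=
  gap_total * (count_upto (fun t =>
    run_arm r t w != xstar (run_ctx r t w)) n)%:R.
Proof.
rewrite /gap_sum /count_upto natr_sum mulr_sumr; apply: ler_sum => t _.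
rewrite /run_gap; case: eqP => [->|_] /=.
  by rewrite mxE dotpBl subrr mulr0.
by rewrite mulr1 gap_le_total.
Qed.

Lemma gap_sum_integrable : P.-integrable setT (EFin \o gap_sum).
Proof.
apply: measurable_bounded_integrable => //.
- by rewrite ltey_eq fin_num_measure.
- exact: gap_sum_measurable.
- exists (gap_total * n%:R); split; first exact: num_real.
  move=> x hx w _ /=; apply: le_trans (ltW hx).
  rewrite ger0_norm ?gap_sum_ge0//; apply: le_trans (gap_sum_le w) _.
  by rewrite ler_wpM2l ?gap_total_ge0// ler_nat count_upto_le.
Qed.

Lemma regretE : regret r xstar = (\int[P]_w (gap_sum w)%:E)%E.
Proof.
(* The Gaussian law is known for the rounds 1 to n only; cutting the noise elsewhere makes it
   integrable with mean 0 at every index. *)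
pose noise t := if (1 <= t <= n)%N then (run_noise r t : run_space r -> R) else cst 0.
have iN t : P.-integrable setT (EFin \o noise t).
  rewrite /noise; case: (boolP (1 <= t <= n)%N) => tn; first exact: noise_integrable.
  exact: finite_measure_integrable_cst.
have mN t : (\int[P]_w (noise t w)%:E = 0)%E.
  rewrite /noise; case: (boolP (1 <= t <= n)%N) => tn; first exact: noise_mean0.
  by rewrite integral0.
rewrite /regret unlock.
transitivity (\int[P]_w ((gap_sum w)%:E -
    \sum_(1 <= t < n.+1) (noise t w)%:E))%E.
  apply: eq_integral => w _; rewrite sumEFin -EFinB; congr (_%:E).
  rewrite /gap_sum -!sumrB; apply: eq_big_nat => t; rewrite ltnS => tn.
  by rewrite /noise tn /run_gap mxE dotpBl /run_rew; ring.
rewrite integralB//; last 2 first.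
- exact: gap_sum_integrable.
- by apply: integrable_sum => // t _; exact: iN.
by rewrite integral_sum// big1 ?sube0.
Qed.

Lemma regret_ge0 : (0 <= regret r xstar)%E.
Proof.
by rewrite regretE; apply: integral_ge0 => w _; rewrite lee_fin gap_sum_ge0.
Qed.

(** The single passage from trajectories to expectations: a bound by a constant plus weighted
    indicators, off a negligible set, is integrated term by term. *)
Lemma regret_le (I : finType) (S : I -> set (run_space r)) (b q : I -> R)
    (a : R) (N : set (run_space r)) :
  0 <= a -> (forall i, 0 <= b i) -> (forall i, measurable (S i)) ->
  (forall i, (P (S i) <= (q i)%:E)%E) -> P.-negligible N ->
  (forall w, ~ N w -> gap_sum w <= a + \sum_i b i * \1_(S i) w) ->
  (regret r xstar <= (a + \sum_i b i * q i)%:E)%E.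
Proof.
move=> a0 b0 mS qS [N' [mN' N'0 NN']] h; rewrite regretE.
have mY : measurable_fun setT (fun w => a + \sum_i b i * \1_(S i) w).
  apply: measurable_funD => //; apply: measurable_sum => i.
  by apply: measurable_funM.
have Y0 w : 0 <= a + \sum_i b i * \1_(S i) w.
  by rewrite addr_ge0// sumr_ge0// => i _; rewrite mulr_ge0.
apply: (@le_trans _ _ (\int[P]_w (a + \sum_i b i * \1_(S i) w)%:E)%E).
  apply: ae_ge0_le_integral => //.
  - by move=> w _; rewrite lee_fin gap_sum_ge0.
  - by apply/measurable_EFinP; exact: gap_sum_measurable.
  - by move=> w _; rewrite lee_fin.
  - exact/measurable_EFinP.
  - exists N'; split => // w /= nh; apply: NN'; apply: contrapT => nN.
    by apply: nh => _; rewrite lee_fin; exact: h.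
under eq_integral do rewrite EFinD -sumEFin.
rewrite ge0_integralD//; last 2 first.
- by move=> w _; rewrite sume_ge0// => i _; rewrite lee_fin mulr_ge0.
- apply: emeasurable_sum => i; apply/measurable_EFinP.
  by apply: measurable_funM.
rewrite integral_cst// [X in (_ * X + _)%E](probability_setT P) mule1 EFinD leeD//.
rewrite ge0_integral_sum//; last 2 first.
- by move=> i; apply/measurable_EFinP; apply: measurable_funM.
- by move=> i w _; rewrite lee_fin mulr_ge0.
rewrite -sumEFin; apply: lee_sum => i _.
under eq_integral do rewrite EFinM.
rewrite ge0_integralZl_EFin//; last exact/measurable_EFinP.
rewrite integral_indic// setIT EFinM. apply: lee_wpmul2l; [by rewrite lee_fin|exact: qS].
Qed.

End Regret.

(** * A regret bound at a fixed horizon *)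

(** Telescoping with 1/(x+1)^2 <= 1/x - 1/(x+1). The expected number of failing levels is therefore
    at most 1. *)
Lemma sum_inv_sqr_le1 (R : realFieldType) n :
  \sum_(0 <= k < n.+1) (if (1 < k)%N then 1 / k%:R ^+ 2 else 0 : R) <= 1.
Proof.
case: n => [|n]; first by rewrite big_nat1.
suff : \sum_(0 <= k < n.+2) (if (1 < k)%N then 1 / k%:R ^+ 2 else 0 : R) <=
    1 - 1 / n.+1%:R.
  by move/le_trans; apply; rewrite gerBl divr_ge0.
elim: n => [|n IH]; first by rewrite big_nat_recr//= big_nat1 /= divr1 addr0 subrr.
rewrite big_nat_recr//=; set s := \sum_(0 <= k < _) _ in IH *.
have x0 : 0 < n.+1%:R :> R by [].
rewrite -[n.+2%:R]natr1; set x : R := n.+1%:R in IH x0 *.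
have y0 : 0 < x + 1 by lra.
have : 1 / (x + 1) ^+ 2 <= 1 / x - 1 / (x + 1).
  have -> : 1 / x - 1 / (x + 1) = 1 / (x * (x + 1)).
    by field; rewrite !gt_eqF.
  rewrite !div1r lef_pV2 ?posrE ?exprn_gt0 ?mulr_gt0// expr2.
  by rewrite ler_pM2r//; lra.
by move=> h; apply: le_trans (lerD IH h) _; rewrite addrA subrK.
Qed.

Lemma inv_sqr_itv (R : realFieldType) (k : nat) : (1 < k)%N ->
  0 < (1 : R) / k%:R ^+ 2 < 1.
Proof.
move=> k1; have k2 : 1 < k%:R ^+ 2 :> R by rewrite exprn_egt1// ltr1n.
have k2' := lt_trans ltr01 k2.
by rewrite divr_gt0//= ltr_pdivrMr// mul1r.
Qed.

Section FixedHorizon.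
Variables (R : realType) (d K M : nat) (A : 'I_M -> 'I_K -> 'cV[R]_d).
Variables (theta : 'cV[R]_d) (xstar : 'I_M -> 'I_K) (p : 'I_M -> R).
Variables (n : nat) (c : R) (T : 'M[R]_(M, K) -> 'I_M -> 'I_K -> \bar R).
Variable eps : nat -> R.
Variable r : bandit_run A theta p n.
Local Notation P := (run_prob r).
Local Notation f := (f_conf c d n (1 / n%:R)).
Local Notation failure := (@confidence_failure _ _ _ _ A theta p n r c).
Variables (g0 Lam rho : R).
Hypothesis hinj : forall m, injective (A m).
Hypothesis hopt : optimal_arms A theta xstar.
Hypothesis hspan : spans [seq A m (xstar m) | m <- enum 'I_M].
Hypothesis f_gt0 : 0 < f.
Hypothesis dn : (d <= n)%N.
Hypothesis hT : forall D, nonneg_gaps D -> alloc_solution A f D (T D).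
Hypothesis g0_gt0 : 0 < g0.
Hypothesis hgap : forall m i, i != xstar m -> g0 <= gaps A theta xstar m i.
Hypothesis Lam_gt0 : 0 < Lam.
Hypothesis arm_coef : forall m m' i, exists2 k : 'I_K -> R,
  A m' i = \sum_j k j *: A m j & (\sum_j `|k j|) ^+ 2 <= Lam.
Hypothesis star_coef : forall m' i, exists2 k : 'I_M -> R,
  A m' i = \sum_m k m *: A m (xstar m) & (\sum_m `|k m|) ^+ 2 <= Lam.
Hypothesis hoam : run_follows_oam r c T eps.
Hypothesis hconf : confidence r c.

Lemma conf_at_of_success delta w : ~ failure delta w ->
  forall u, (d <= u <= n)%N -> conf_at A (run_ctx r ^~ w) (run_arm r ^~ w)
    (run_rew r ^~ w) theta (f_conf c d n delta) u.
Proof.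
move=> nf u du m i; have [->|A0] := eqVneq (A m i) 0.
  by rewrite dotp0l normr0 mulr_ge0// sqrtr_ge0.
rewrite leNgt; apply/negP => h; apply: nf; exists u, m, i.
by split=> //; exact: ltW.
Qed.

(** Levels start at k = 2, since confidence is assumed for levels below 1. *)
Definition failures (t : nat) (w : run_space r) : nat :=
  count_upto (fun k => (1 < k)%N && `[< failure (1 / k%:R ^+ 2) w >]) t.

Lemma failures_mono w t : (t <= n)%N -> (failures t w <= failures n w)%N.
Proof. exact: count_upto_mono. Qed.

Definition tied : set (run_space r) :=
  [set w | exists (u : nat) m i j, [/\ (d <= u <= n)%N, i != j &
    dotp (A m i - A m j) (theta_hat A (run_ctx r ^~ w) (run_arm r ^~ w)
      (run_rew r ^~ w) u) = 0]].

Lemma tied_negligible : P.-negligible tied.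
Proof.
pose F (x : 'I_n.+1 * ('I_M * ('I_K * 'I_K))) : set (run_space r) :=
  [set w | [/\ (d <= x.1)%N, x.2.2.1 != x.2.2.2 &
   dotp (A x.2.1 x.2.2.1 - A x.2.1 x.2.2.2)
     (theta_hat A (run_ctx r ^~ w) (run_arm r ^~ w) (run_rew r ^~ w) x.1) = 0]].
apply: (negligible_finite_cover (F := F)).
  move=> w [u [m [i [j [/andP[du un] ij h]]]]].
  by exists (inord u, (m, (i, j))); split=> //=; rewrite inordK ?ltnS.
move=> [u [m [i j]]].
have [ij|ij] := eqVneq i j.
  by apply: negligibleS (negligible_set0 P) => w [/=]; rewrite ij eqxx.
have [du|ud] := leqP d u; last first.
  by apply: negligibleS (negligible_set0 P) => w [/=]; rewrite leqNgt ud.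
apply: (@negligibleS _ _ _ _ [set w | dotp (A m i - A m j) (theta_hat A
  (run_ctx r ^~ w) (run_arm r ^~ w) (run_rew r ^~ w) u) = 0]).
  by move=> w [].
apply: tie_negligible.
- move=> w t /andP[t1 td]; have := hoam w (t := t).
  by rewrite t1 (leq_trans td dn) td => /(_ isT).
- rewrite subr_eq0; apply: contra ij => /eqP e; apply/eqP; exact: (hinj e).
- by rewrite du /= -ltnS ltn_ord.
Qed.

(** F is the radius parameter at the intermediate level [delta]; [g1] and [g2] bound the UCB
    parameters up to [t0] and up to n; E bounds eps from round 3 on, [eta] after round q; U and W
    bound the suboptimal rounds in the favourable and unfavourable cases. *)
Variables (t0 q : nat) (delta F g1 g2 ell E eta U W : R).
Hypothesis t0n : (d <= t0 <= n)%N.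
Hypothesis FE : F = f_conf c d n delta.
Hypothesis F_ge0 : 0 <= F.
Hypothesis Ff : 4 * F <= f.
Hypothesis g1_ge0 : 0 <= g1.
Hypothesis hg1 : forall k, (2 <= k <= t0)%N -> f_conf c d n (1 / k%:R ^+ 2) <= g1.
Hypothesis g2_ge0 : 0 <= g2.
Hypothesis hg2 : forall k, (2 <= k <= n)%N -> f_conf c d n (1 / k%:R ^+ 2) <= g2.
Hypothesis ell_ge0 : 0 <= ell.
Hypothesis heps : forall s, (3 <= s <= n)%N -> 0 < eps s /\ (eps s)^-1 <= ell.
Hypothesis E_ge0 : 0 <= E.
Hypothesis hE : forall s, (3 <= s <= n)%N -> eps s <= E.
Hypothesis eta_gt0 : 0 < eta.
Hypothesis heta : forall s, (q < s <= n)%N -> eps s <= eta.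
Hypothesis rho_gt0 : 0 < rho.
Hypothesis eta_rho : 2 * ((M * K)%:R * eta) <= rho.
Local Notation Nstar := (16 * Lam * f / g0 ^+ 2).
Hypothesis hU : d%:R + (M * K)%:R * (4 * g1 / g0 ^+ 2 + 1) + (1 + eta * t0%:R) +
  (M * K)%:R * (E * q%:R + eta * t0%:R + 1) + 2 +
  (4 * F * Lam / g0 ^+ 2 * ell + 1) <= U.
Hypothesis hNU : Nstar + U <= rho * t0%:R.
Let Xb := (M * K)%:R * (f / g0 ^+ 2 + 1).
Let a := d%:R + Xb + (M * K)%:R * (4 * g2 / g0 ^+ 2 + 1) + 1 +
  (M * K)%:R * (E * q%:R + 1) + 2 + (4 * f * Lam / g0 ^+ 2 * ell + 1).
Hypothesis hW : d%:R + (t0%:R + 1 + 2 * (a + Nstar) / rho) + Xb <= W.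

Let subopt w t := run_arm r t w != xstar (run_ctx r t w).

Let nt w : ~ tied w -> forall u m i j, (d <= u <= n)%N -> i != j ->
  dotp (A m i - A m j) (theta_hat A (run_ctx r ^~ w) (run_arm r ^~ w)
      (run_rew r ^~ w) u) != 0.
Proof.
by move=> ntw u m i j du ij; apply/eqP => h; apply: ntw; exists u, m, i, j.
Qed.

Let conf_bad w t k u : (2 <= k <= t)%N ->
  ~~ `[< failure (1 / k%:R ^+ 2) w >] -> (d <= u <= n)%N ->
  conf_at A (run_ctx r ^~ w) (run_arm r ^~ w) (run_rew r ^~ w) theta
    (f_conf c d n (1 / k%:R ^+ 2)) u.
Proof. by move=> _ /asboolP nf; exact: (conf_at_of_success nf). Qed.

(** Level [delta] removes wrong exploitations, so U bounds the first [t0] rounds. Then [hNU] leaves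
    enough pulls of every optimal arm for exploration to stop, and the count no longer grows. *)
Lemma good_suboptimal_count w : ~ tied w -> ~ failure (1 / n%:R) w ->
  ~ failure delta w -> (failures t0 w)%:R <= eta * t0%:R ->
  (forall m, rho * t0%:R <= (ctx_count m t0 w)%:R) ->
  (count_upto (subopt w) n)%:R <= U.
Proof.
move=> ntw nf1 nf2 hfail hctx; have /andP[dt0 t0n'] := t0n.
have hc1 := conf_at_of_success nf1.
have hc2 : forall u, (d <= u <= n)%N -> conf_at A (run_ctx r ^~ w)
    (run_arm r ^~ w) (run_rew r ^~ w) theta F u.
  by rewrite FE; exact: (conf_at_of_success nf2).
have nwe s := @no_wrong_exploit R d K M A _ _ _ theta xstar n c T eps g0
  (hoam w) f_gt0 dn g0_gt0 hgap F s hc2 Ff (nt ntw).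
have hX : (count_upto (fun s => [&& d < s, exploits A (run_ctx r ^~ w)
    (run_arm r ^~ w) (run_rew r ^~ w) f s & subopt w s]%N) t0)%:R <= 0 :> R.
  rewrite -[0](mulr0n 1) ler_nat; apply: count_upto_le_bound => s /andP[_ st] /and3P[ds ex].
  by rewrite /subopt (negbTE (nwe s _ ex))// ds (leq_trans st).
have h1 : (count_upto (subopt w) t0)%:R <= U.
  apply: le_trans hU.
  apply: (le_trans (suboptimal_count_le (hoam w) f_gt0 dn hT g0_gt0 hgap
    Lam_gt0 arm_coef hspan t0n' F_ge0 hc2 (@conf_bad w t0) g1_ge0 hg1 hX
    ell_ge0 heps E_ge0 (ltW eta_gt0) hE heta)).
  by move: hfail; rewrite /failures; lra.
apply: (le_trans _ h1); rewrite ler_nat.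
apply: (suboptimal_count_stops (hoam w) f_gt0 dn g0_gt0 hgap Lam_gt0 star_coef
  hc1 t0n _ nwe) => m.
apply: le_trans (hctx m); apply: le_trans hNU.
rewrite lerD2l; exact: h1.
Qed.

(** Forced exploration contributes a term linear in t, absorbed by half the rate at which contexts
    occur; what remains bounds the last exploration, and wrong exploitations add [Xb]. *)
Lemma bad_suboptimal_count w : ~ tied w -> ~ failure (1 / n%:R) w ->
  (forall t m, (t0 <= t <= n)%N -> rho * t%:R <= (ctx_count m t w)%:R) ->
  (count_upto (subopt w) n)%:R <= W + 2 / rho * (failures n w)%:R.
Proof.
move=> ntw nf1 hctx; have /andP[dt0 t0n'] := t0n.
have hc1 := conf_at_of_success nf1.
have hX t : (t <= n)%N -> (count_upto (fun s => [&& d < s,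
    exploits A (run_ctx r ^~ w) (run_arm r ^~ w) (run_rew r ^~ w) f s &
    subopt w s]%N) t)%:R <= Xb.
  move=> tn; exact: (wrong_exploit_count (hoam w) f_gt0 dn g0_gt0 hgap tn hc1
    (nt ntw)).
have h1 t : (t <= n)%N -> (count_upto (subopt w) t)%:R <=
    a + (failures n w)%:R + (M * K)%:R * eta * t%:R.
  move=> tn.
  have hg2t k : (2 <= k <= t)%N -> f_conf c d n (1 / k%:R ^+ 2) <= g2.
    by move=> /andP[k2 kt]; apply: hg2; rewrite k2 (leq_trans kt).
  apply: (le_trans (suboptimal_count_le (hoam w) f_gt0 dn hT g0_gt0 hgap
    Lam_gt0 arm_coef hspan tn (ltW f_gt0) hc1 (@conf_bad w t) g2_ge0 hg2t
    (hX t tn) ell_ge0 heps E_ge0 (ltW eta_gt0) hE heta)).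
  have : (failures t w)%:R <= (failures n w)%:R :> R.
    by rewrite ler_nat failures_mono.
  by rewrite /a /failures; lra.
have pos0 x : 0 <= x -> 0 <= x / g0 ^+ 2.
  by move=> x0; rewrite divr_ge0// sqr_ge0.
have a_ge0 : 0 <= a.
  have x1 : 0 <= Xb by rewrite /Xb mulr_ge0// addr_ge0// pos0// ltW.
  have x2 : 0 <= (M * K)%:R * (4 * g2 / g0 ^+ 2 + 1).
    by rewrite mulr_ge0// addr_ge0// pos0// mulr_ge0.
  have x3 : 0 <= (M * K)%:R * (E * q%:R + 1).
    by rewrite mulr_ge0// addr_ge0// mulr_ge0.
  have x4 : 0 <= 4 * f * Lam / g0 ^+ 2 * ell.
    by rewrite mulr_ge0// pos0// !mulr_ge0// ltW.
  by rewrite /a; have := ler0n R d; lra.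
have h2 := explorations_bound (hoam w) f_gt0 dn g0_gt0 hgap Lam_gt0 star_coef
  hc1 dt0 rho_gt0 (addr_ge0 a_ge0 (ler0n R (failures n w))) eta_rho hctx
  (fun t ht => h1 t (proj2 (andP ht))).
apply: (le_trans (suboptimal_count_le_explorations (hX n (leqnn n)))).
apply: (@le_trans _ _ (d%:R + (t0%:R + 1 + 2 * (a + Nstar) / rho) + Xb +
   2 / rho * (failures n w)%:R)); last by rewrite lerD2r.
have e : 2 * (a + (failures n w)%:R + Nstar) / rho =
   2 * (a + Nstar) / rho + 2 / rho * (failures n w)%:R.
  by field; rewrite !gt_eqF.
by move: h2; rewrite e; lra.
Qed.

Local Notation Dt := (gap_total A theta xstar).
Variable qc : R.
Hypothesis n_gt1 : (1 < n)%N.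
Hypothesis delta01 : 0 < delta < 1.
Hypothesis p01 : forall m, 0 <= p m <= 1.
Hypothesis rho_p : forall m, rho <= p m / 4.
Hypothesis hqc : expR (- (rho * t0%:R)) <= qc.
Hypothesis t0_gt0 : (0 < t0)%N.
Hypothesis U_ge0 : 0 <= U.
Hypothesis W_ge0 : 0 <= W.

(** Each exceptional event is charged a weight: n for a failure at level 1/n or a rare context, W
    for a failure at level [delta], and W / (eta t0) + 2 / rho for each failing level 1/k^2, up to
    the factor [Dt]. *)
Lemma regret_fixed_horizon : (regret r xstar <=
  (Dt * (U + 1 + W * delta + n%:R * (n.+1%:R * M%:R * qc) +
     (W / (eta * t0%:R) + 2 / rho)))%:E)%E.
Proof.
pose I := ((bool + 'I_n.+1 * 'I_M) + 'I_n.+1)%type.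
pose S (i : I) : set (run_space r) := match i with
  | inl (inl true) => failure (1 / n%:R)
  | inl (inl false) => failure delta
  | inl (inr (t, m)) => if (t0 <= t)%N then
      [set w | (ctx_count m t w)%:R < p m / 4 * t%:R] else set0
  | inr k => if (1 < k)%N then failure (1 / k%:R ^+ 2) else set0 end.
pose bk := Dt * (W / (eta * t0%:R) + 2 / rho).
pose b (i : I) : R := match i with
  | inl (inl true) => Dt * n%:R
  | inl (inl false) => Dt * W
  | inl (inr _) => Dt * n%:R
  | inr k => bk end.
pose qq (i : I) : R := match i with
  | inl (inl true) => 1 / n%:R
  | inl (inl false) => delta
  | inl (inr _) => qc
  | inr k => if (1 < k)%N then 1 / k%:R ^+ 2 else 0 end.
have Dt0 : 0 <= Dt by exact: gap_total_ge0.
have n0 : 0 < n%:R :> R by rewrite ltr0n (ltn_trans _ n_gt1).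
have et0 : 0 < eta * t0%:R by rewrite mulr_gt0// ltr0n.
have qc0 : 0 <= qc by apply: le_trans hqc; exact: expR_ge0.
have bk0 : 0 <= bk.
  by rewrite /bk mulr_ge0// addr_ge0// divr_ge0// ltW.
have b0 i : 0 <= b i.
  by case: i => [[[]|?]|?] //=; rewrite mulr_ge0// ltW.
have n01 : 0 < (1 : R) / n%:R < 1.
  by rewrite divr_gt0//= ltr_pdivrMr// mul1r ltr1n.
have mS i : measurable (S i).
  case: i => [[[]|[t m]]|k] /=; try exact: confidence_failure_measurable.
    case: ifP => // _; have tn : (t <= n)%N by rewrite -ltnS.
    exact: (ctx_count_small_prob r (p01 m) tn).1.
  by case: ifP => // _; exact: confidence_failure_measurable.
have qS i : (P (S i) <= (qq i)%:E)%E.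
  case: i => [[[]|[t m]]|k] /=.
  - exact: hconf.
  - exact: hconf.
  - case: ifP => [t0t|_]; last by rewrite measure0 lee_fin.
    have tn : (t <= n)%N by rewrite -ltnS.
    apply: (le_trans (ctx_count_small_prob r (p01 m) tn).2).
    rewrite lee_fin; apply: le_trans hqc; rewrite ler_expR lerN2.
    by rewrite ler_pM ?ler_nat// ltW.
  - case: ifP => [k1|_]; last by rewrite measure0.
    exact/hconf/inv_sqr_itv.
have hpt w : ~ tied w -> gap_sum xstar w <= Dt * U + \sum_i b i * \1_(S i) w.
  move=> ntw.
  have bS0 i : 0 <= b i * \1_(S i) w by rewrite mulr_ge0.
  have one i B : S i w -> B <= b i ->
      B <= Dt * U + \sum_i b i * \1_(S i) w.
    move=> Siw Bb; rewrite (bigD1 i)//= indicE mem_set//= mulr1.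
    have : 0 <= Dt * U by rewrite mulr_ge0.
    have : 0 <= \sum_(j | j != i) b j * \1_(S j) w by rewrite sumr_ge0.
    lra.
  have gn : gap_sum xstar w <= Dt * n%:R.
    apply: le_trans (gap_sum_le hopt w) _.
    by rewrite ler_wpM2l// ler_nat count_upto_le.
  have [f1|nf1] := pselect (failure (1 / n%:R) w).
    exact: (one (inl (inl true))).
  have [[t [m [t0t lt]]]|nctx] := pselect (exists (t : 'I_n.+1) m,
      (t0 <= t)%N /\ (ctx_count m t w)%:R < p m / 4 * t%:R).
    by apply: (one (inl (inr (t, m)))) => //=; rewrite t0t.
  have hctx t m : (t0 <= t <= n)%N -> rho * t%:R <= (ctx_count m t w)%:R.
    move=> /andP[t0t tn]; apply: (@le_trans _ _ (p m / 4 * t%:R)).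
      by rewrite ler_wpM2r.
    rewrite leNgt; apply/negP => h; apply: nctx.
    by exists (inord t), m; rewrite inordK.
  have [[nf2 hfail]|nbad] := pselect (~ failure delta w /\
      (failures t0 w)%:R <= eta * t0%:R).
    apply: le_trans (gap_sum_le hopt w) _.
    apply: (@le_trans _ _ (Dt * U)); last by rewrite lerDl sumr_ge0.
    rewrite ler_wpM2l//; apply: good_suboptimal_count => // m.
    by apply: hctx; rewrite leqnn; case/andP: t0n.
  have hb := bad_suboptimal_count ntw nf1 hctx.
  apply: le_trans (gap_sum_le hopt w) _.
  apply: (@le_trans _ _ (Dt * (W + 2 / rho * (failures n w)%:R))).
    by rewrite ler_wpM2l.
  have fE : \sum_(k < n.+1) b (inr k) * \1_(S (inr k)) w =
      bk * (failures n w)%:R.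
    rewrite -mulr_sumr; congr (_ * _).
    rewrite /failures /count_upto natr_sum.
    rewrite -(big_mkord xpredT (fun k => \1_(if (1 < k)%N then
      failure (1 / k%:R ^+ 2) else set0) w)).
    rewrite big_ltn//= indicE in_set0 add0r.
    apply: eq_bigr => k _; rewrite indicE; case: ifP => k1 /=.
      by congr (_%:R); congr nat_of_bool; apply/idP/idP => [/set_mem/asboolP|/asboolP/mem_set].
    by rewrite in_set0.
  rewrite big_sumType /= fE.
  have s1 : 0 <= \sum_(i : bool + 'I_n.+1 * 'I_M) b (inl i) * \1_(S (inl i)) w.
    by rewrite sumr_ge0.
  have DU : 0 <= Dt * U by rewrite mulr_ge0.
  have fl : 0 <= (failures n w)%:R :> R by [].
  have bkE : bk * (failures n w)%:R = Dt * W * ((failures n w)%:R / (eta * t0%:R))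
     + Dt * (2 / rho * (failures n w)%:R).
    by rewrite /bk; field; rewrite !gt_eqF// ltr0n.
  rewrite bkE.
  have DW : 0 <= Dt * W by rewrite mulr_ge0.
  have [f2|nf2] := pselect (failure delta w).
    have : Dt * W <= \sum_(i : bool + 'I_n.+1 * 'I_M) b (inl i) * \1_(S (inl i)) w.
      rewrite (bigD1 (inl false))//= [X in Dt * W * X](_ : _ = 1).
        rewrite mulr1 lerDl; apply: sumr_ge0 => i _; exact: (bS0 (inl i)).
      by rewrite indicE mem_set.
    have : 0 <= Dt * W * ((failures n w)%:R / (eta * t0%:R)).
      by rewrite mulr_ge0// divr_ge0// ltW.
    by lra.
  (* The Markov step: with more than eta t0 failing levels, W is at most W / (eta t0) times their
     number. *)
  have hf : eta * t0%:R < (failures n w)%:R.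
    apply: (@lt_le_trans _ _ (failures t0 w)%:R).
      by rewrite ltNge; apply/negP => h; apply: nbad.
    by rewrite ler_nat; apply: failures_mono; case/andP: t0n.
  have : Dt * W * 1 <= Dt * W * ((failures n w)%:R / (eta * t0%:R)).
    by rewrite ler_wpM2l// ler_pdivlMr// mul1r ltW.
  by lra.
apply: (le_trans (regret_le hopt (mulr_ge0 Dt0 U_ge0) b0 mS qS tied_negligible hpt)).
rewrite lee_fin big_sumType /= big_sumType /= big_bool /=.
have -> : \sum_(i : 'I_n.+1 * 'I_M) Dt * n%:R * qc =
    Dt * (n%:R * (n.+1%:R * M%:R * qc)).
  rewrite sumr_const card_prod !card_ord -[LHS]mulr_natl natrM; ring.
have -> : \sum_(k < n.+1) bk * (if (1 < k)%N then 1 / k%:R ^+ 2 else 0) =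
    bk * \sum_(0 <= k < n.+1) (if (1 < k)%N then 1 / k%:R ^+ 2 else 0).
  by rewrite -mulr_sumr big_mkord.
have h1 : Dt * n%:R * (1 / n%:R) = Dt by field; rewrite gt_eqF.
have h2 : bk * \sum_(0 <= k < n.+1) (if (1 < k)%N then 1 / k%:R ^+ 2 else 0) <= bk.
  by rewrite -[leRHS]mulr1 ler_wpM2l// sum_inv_sqr_le1.
rewrite h1; move: h2; rewrite /bk; lra.
Qed.

End FixedHorizon.

(** * Asymptotics *)

Section Asymptotics.
Variable R : realType.

(** From exp y >= (y/4)^4 it suffices that e y^2 >= 4^4 a, which holds once y >= 1 and e y >= 4^4
    a. *)
Lemma sqr_le_expR (a e : R) : 0 <= a -> 0 < e ->
  exists2 y0, 1 <= y0 & forall y, y0 <= y -> a * y ^+ 2 <= e * expR y.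
Proof.
move=> a0 e0; have [k0] : exists2 k, 0 < k & k = 4 ^+ 4 :> R.
  by exists (4 ^+ 4) => //; rewrite exprn_gt0.
move=> kp kE; have b0 : 0 <= k0 * a / e by rewrite divr_ge0 ?mulr_ge0// ltW.
exists (1 + k0 * a / e); first by rewrite lerDl.
move=> y hy; have y1 : 1 <= y by apply: le_trans hy; rewrite lerDl.
have ey : (y / 4) ^+ 4 <= expR y.
  have -> : y = 4%:R * (y / 4) by field.
  rewrite expRM_natl mulrAC divff// mul1r lerXn2r ?nnegrE ?expR_ge0//.
    by rewrite divr_ge0//; lra.
  by have := expR_ge1Dx (y / 4); lra.
apply: le_trans (ler_wpM2l (ltW e0) ey).
have ha : k0 * a <= e * y.
  have : k0 * a / e <= y by apply: le_trans hy; rewrite lerDr.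
  by rewrite ler_pdivrMr// [y * e]mulrC.
have -> : e * (y / 4) ^+ 4 = (e * y * y) / k0 * y ^+ 2.
  by rewrite kE; field.
rewrite ler_wpM2r ?sqr_ge0// ler_pdivlMr// mulrC; apply: le_trans ha _.
rewrite -[leLHS]mulr1 ler_wpM2l// mulr_ge0 ?(ltW e0)//; lra.
Qed.

Lemma lnln_near (y : R) : \forall n \near \oo, y <= ln (ln n%:R).
Proof.
exists (Num.truncn (expR (expR y))).+1 => // n /= hn.
have h : expR (expR y) <= n%:R.
  rewrite -[leLHS]ger0_norm ?expR_ge0//.
  by apply/ltW; rewrite ger0_norm ?expR_ge0// -truncn_lt_nat ?expR_ge0.
have n0 : 0 < n%:R :> R by apply: lt_le_trans h; exact: expR_gt0.
have h1 : expR y <= ln n%:R.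
  by rewrite -[leLHS]expRK ler_ln ?posrE ?expR_gt0.
have l0 : 0 < ln n%:R :> R by apply: lt_le_trans h1; exact: expR_gt0.
by rewrite -[leLHS]expRK ler_ln ?posrE ?expR_gt0.
Qed.

Lemma ln_le_mono (x y : R) : 0 < x -> x <= y -> ln x <= ln y.
Proof. by move=> x0 xy; rewrite ler_ln ?posrE// (lt_le_trans x0). Qed.

Lemma lnln_gt0E (x : R) : 0 < ln x -> 0 < x.
Proof. by move=> h; rewrite ltNge; apply/negP => /ln0 e; move: h; rewrite e ltxx. Qed.

(** exp (-1) >= (1 - 1/6)^6 > 1/3. Hence ln ln t > 0 from t = 3 on, which is why bounds on eps start
    there. *)
Lemma ln3_gt1 : 1 < ln (3 : R).
Proof.
rewrite -[ltLHS]expRK ltr_ln ?posrE ?expR_gt0//.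
have e0 := expR_gt0 (1 : R).
have h : (5 / 6) ^+ 6 <= expR (- 1 : R).
  have -> : - 1 = 6%:R * (- (1 / 6)) :> R by field.
  rewrite expRM_natl lerXn2r ?nnegrE ?expR_ge0//.
  by have := expR_ge1Dx (- (1 / 6) : R); lra.
rewrite expRN in h.
have := ler_wpM2r (ltW e0) h; rewrite mulVf ?gt_eqF//.
set e := expR 1 in e0 *; set x : R := 5 / 6.
have -> : x ^+ 6 = x * x * (x * x) * (x * x) by ring.
have -> : x * x = 25 / 36 by rewrite /x; lra.
have h1 : 27 / 56 <= 25 / 36 * (25 / 36) :> R by lra.
have h2 : 1 / 3 < 25 / 36 * (25 / 36) * (25 / 36) :> R by move: h1; lra.
by have := ltr_pM2r e0 (1 / 3) (25 / 36 * (25 / 36) * (25 / 36)); rewrite h2; lra.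
Qed.

Lemma lnln_pos s : (3 <= s)%N -> 0 < ln (ln (s%:R : R)).
Proof.
move=> s3; apply: ln_gt0; apply: lt_le_trans ln3_gt1 _.
by rewrite ler_ln ?posrE ?ler_nat// ltr0n (leq_trans _ s3).
Qed.

Lemma lnln_mono s t : (3 <= s <= t)%N -> ln (ln (s%:R : R)) <= ln (ln t%:R).
Proof.
move=> /andP[s3 st]; have s0 : (0 < s)%N by rewrite (leq_trans _ s3).
have h : ln (s%:R : R) <= ln t%:R by apply: ln_le_mono; rewrite ?ltr0n ?ler_nat.
apply: ln_le_mono => //; exact: lnln_gt0E (lnln_pos s3).
Qed.

Section Conf.
Variables (c : R) (d n : nat).
Hypothesis c0 : 0 <= c.
Local Notation L := (ln (n%:R : R)).
Local Notation ell := (ln L).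
Hypothesis ell1 : 1 <= ell.

(** Once ln ln n >= 1, the term c d log (d log n) is at most [kappa] ln ln n. *)
Definition kappa : R := c * d%:R * (1 + ln d%:R).

Lemma kappa_ge0 : 0 <= kappa.
Proof.
rewrite /kappa; case: d => [|k]; first by rewrite mulr0 mul0r.
by rewrite !mulr_ge0// addr_ge0// ln_ge0// ler1n.
Qed.

Lemma lnn_gt0 : 0 < L.
Proof. by apply: lnln_gt0E; exact: lt_le_trans ltr01 ell1. Qed.

Lemma lnnE : L = expR ell.
Proof. by rewrite lnK// posrE lnn_gt0. Qed.

Lemma ell_le_lnn : ell <= L.
Proof. by apply/ltW/ln_sublinear; exact: lnn_gt0. Qed.

Lemma nE : n%:R = expR L.
Proof. by rewrite lnK// posrE; exact: lnln_gt0E lnn_gt0. Qed.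

Lemma loglog_term_itv : 0 <= c * d%:R * ln (d%:R * L) <= kappa * ell.
Proof.
have l0 := lnn_gt0; rewrite /kappa; case: d => [|k].
  by rewrite mulr0 !mul0r lexx.
rewrite lnM ?posrE ?ltr0n//.
have d0 : 0 <= ln (k.+1%:R : R) by rewrite ln_ge0// ler1n.
apply/andP; split; first by rewrite !mulr_ge0// addr_ge0// (le_trans ler01).
rewrite -[leRHS]mulrA; apply: ler_wpM2l; first by rewrite mulr_ge0.
rewrite mulrDl mul1r addrC lerD2l -[leLHS]mulr1.
by rewrite ler_wpM2l.
Qed.

Lemma f_conf_bounds (x : R) : 1 <= x ->
  2 * ln x <= f_conf c d n (1 / x) <= 2 * (1 + 1 / L) * ln x + kappa * ell.
Proof.
move=> x1; have e : 1 / (1 / x) = x by rewrite !div1r invrK.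
rewrite /f_conf e.
have /andP[h1 h2] := loglog_term_itv.
rewrite lerD2l h2 andbT.
have lx := ln_ge0 x1; have l0 := lnn_gt0.
have : 0 <= 1 / L * ln x by rewrite mulr_ge0// divr_ge0// ltW.
lra.
Qed.

Lemma f_conf_le (x : R) : 1 <= x -> f_conf c d n (1 / x) <= 4 * ln x + kappa * ell.
Proof.
move=> x1; have /andP[_ h] := f_conf_bounds x1.
apply: le_trans h _; rewrite lerD2r ler_wpM2r ?ln_ge0//.
have : 1 / L <= 1.
  by rewrite ler_pdivrMr ?lnn_gt0// mul1r (le_trans ell1)// ell_le_lnn.
lra.
Qed.

Lemma n_ge1 : 1 <= (n%:R : R).
Proof.
by rewrite nE; apply: le_trans (expR_ge1Dx _); have := lnn_gt0; lra.
Qed.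

Lemma f_conf_n : 2 * L <= f_conf c d n (1 / n%:R) <= 2 * L + 2 + kappa * ell.
Proof.
have /andP[-> h /=] := f_conf_bounds n_ge1; apply: le_trans h _.
rewrite lerD2r; have l0 := lnn_gt0.
have -> : 2 * (1 + 1 / L) * L = 2 * L + 2 by field; rewrite gt_eqF.
by [].
Qed.

Lemma f_conf_lnn : 0 <= f_conf c d n (1 / L) <= (4 + kappa) * ell.
Proof.
have L1 : 1 <= L by rewrite (le_trans ell1)// ell_le_lnn.
have /andP[h _] := f_conf_bounds L1; have h2 := f_conf_le L1.
apply/andP; split; first by apply: le_trans h; rewrite mulr_ge0// (le_trans ler01).
by apply: (le_trans h2); rewrite [leRHS]mulrDl.
Qed.

Lemma f_conf_sqr k : (1 <= k)%N ->
  f_conf c d n (1 / k%:R ^+ 2) <= 8 * ln k%:R + kappa * ell.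
Proof.
move=> k1; have k0 : 0 < k%:R :> R by rewrite ltr0n.
have k1' : 1 <= k%:R ^+ 2 :> R by rewrite exprn_ege1// ler1n.
apply: le_trans (f_conf_le k1') _; rewrite lerD2r lnXn// mulr2n; lra.
Qed.

End Conf.
End Asymptotics.

(** * Uniform bounds and explicit constants *)

Section Constants.
Variable R : realType.

Lemma finite_pos_lower_bound (I : finType) (Q : pred I) (F : I -> R) :
  (forall i, Q i -> 0 < F i) ->
  exists2 g, 0 < g & forall i, Q i -> g <= F i.
Proof.
move=> h; exists (\big[Num.min/1]_(i | Q i) F i).
  by apply: lt_bigmin.
by move=> i Qi; exact: bigmin_le_cond.
Qed.

Lemma finite_coef_bound (I J : finType) (Q : I -> (J -> R) -> Prop) :
  (forall i, exists k, Q i k) ->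
  exists2 C, 0 < C & forall i, exists2 k, Q i k & (\sum_j `|k j|) ^+ 2 <= C.
Proof.
move=> /choice[k hk]; exists (1 + \sum_i (\sum_j `|k i j|) ^+ 2).
  by rewrite ltr_pwDl// sumr_ge0// => i _; rewrite sqr_ge0.
move=> i; exists (k i) => //.
rewrite (bigD1 i)//= addrCA lerDl addr_ge0// sumr_ge0// => j _.
exact: sqr_ge0.
Qed.

Lemma le_add_scaled (x1 x2 y1 y2 z : R) :
  x1 <= y1 * z -> x2 <= y2 * z -> x1 + x2 <= (y1 + y2) * z.
Proof. by move=> h1 h2; rewrite mulrDl lerD. Qed.

Lemma le_mul_scaled (k x y z : R) : 0 <= k -> x <= y * z -> k * x <= k * y * z.
Proof. by move=> k0 h; rewrite -mulrA ler_wpM2l. Qed.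

Lemma le_cst_scaled (x z : R) : 0 <= x -> 1 <= z -> x <= x * z.
Proof. by move=> x0 z1; rewrite -[leLHS]mulr1 ler_wpM2l. Qed.

(** Coefficient obtained by bounding every term of the favourable case by a multiple of ell^2. The
    arguments stand for d, M K, 1/g0^2, ln (2 C0), [kappa], E q and [Lam]. *)
Definition good_cst (dd mk iG lC ka Eq Lam : R) : R :=
  dd + mk * (iG * (4 * (8 * lC + 8 + ka)) + 1) + 1 + mk * (Eq + 1) + 2 +
  (4 * Lam * iG * (4 + ka) + 1).

Lemma good_cst_le dd mk iG lC ka Eq Lam F ell :
  0 <= dd -> 0 <= mk -> 0 <= iG -> 0 <= lC -> 0 <= ka -> 0 <= Eq ->
  0 <= Lam -> 1 <= ell -> F <= (4 + ka) * ell ->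
  dd + mk * (iG * (4 * (8 * lC + 8 * ell + ka * ell)) + 1) + 1 +
    mk * (Eq + 1) + 2 + (4 * Lam * iG * (F * ell) + 1) <=
  good_cst dd mk iG lC ka Eq Lam * ell ^+ 2.
Proof.
move=> dd0 mk0 iG0 lC0 ka0 Eq0 L0 e1 hF.
have e0 : 0 <= ell by apply: le_trans e1.
have z1 : 1 <= ell ^+ 2 by rewrite exprn_ege1.
have ez : ell <= ell ^+ 2 by rewrite expr2 -[leLHS]mulr1 ler_wpM2l.
rewrite /good_cst; do ?apply: le_add_scaled; try by apply: le_cst_scaled.
- apply: le_mul_scaled => //; apply: le_add_scaled; last exact: le_cst_scaled.
  do 2 apply: le_mul_scaled => //.
  do ?apply: le_add_scaled; try by rewrite ler_wpM2l.
  by apply: le_cst_scaled => //; rewrite mulr_ge0.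
- by apply: le_cst_scaled => //; rewrite mulr_ge0// addr_ge0.
- apply: le_mul_scaled; first by rewrite !mulr_ge0.
  by rewrite expr2 mulrA ler_wpM2r.
Qed.

Definition bad_cst0 (dd mk iG ka Eq Lam : R) : R :=
  dd + mk * (iG * 3 + 1) + mk * (iG * (4 * (8 + ka)) + 1) + 1 + mk * (Eq + 1) +
  2 + (4 * Lam * iG * 3 + 1).

(** The analogue for the unfavourable case on the scale L ell, with [irho] for 1/rho; each 3 comes
    from f <= 3 L. *)
Definition bad_cst (dd mk iG ka Eq Lam C0 irho : R) : R :=
  dd + (2 * C0 + 1 + 2 * irho * (bad_cst0 dd mk iG ka Eq Lam + 16 * Lam * iG * 3))
  + mk * (iG * 3 + 1).

Lemma bad_cst_le dd mk iG ka Eq Lam C0 irho L ell f t0 :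
  0 <= dd -> 0 <= mk -> 0 <= iG -> 0 <= ka -> 0 <= Eq -> 0 <= Lam ->
  0 <= C0 -> 0 <= irho -> 1 <= ell -> ell <= L -> f <= 3 * L -> t0 <= 2 * C0 * L ->
  dd + (t0 + 1 + 2 * irho * (dd + mk * (iG * f + 1) +
      mk * (iG * (4 * (8 * L + ka * ell)) + 1) + 1 + mk * (Eq + 1) + 2 +
      (4 * Lam * iG * (f * ell) + 1) + 16 * Lam * iG * f)) +
      mk * (iG * f + 1) <=
  bad_cst dd mk iG ka Eq Lam C0 irho * (L * ell).
Proof.
move=> dd0 mk0 iG0 ka0 Eq0 La0 C00 ir0 e1 eL hf ht.
have e0 : 0 <= ell by apply: le_trans e1.
have L1 : 1 <= L by apply: le_trans eL.
have L0 : 0 <= L by apply: le_trans e0 eL.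
have Lz : L <= L * ell by rewrite -[leLHS]mulr1 ler_wpM2l.
have ez : ell <= L * ell by rewrite -[leLHS]mul1r ler_wpM2r.
have z1 : 1 <= L * ell by apply: le_trans Lz.
have fz : f <= 3 * (L * ell) by apply: le_trans hf _; rewrite ler_wpM2l.
have hX : mk * (iG * f + 1) <= mk * (iG * 3 + 1) * (L * ell).
  apply: le_mul_scaled => //; apply: le_add_scaled; last exact: le_cst_scaled.
  exact: le_mul_scaled.
rewrite /bad_cst; apply: le_add_scaled => //.
apply: le_add_scaled; first exact: le_cst_scaled.
apply: le_add_scaled.
  apply: le_add_scaled; last exact: le_cst_scaled.
  by apply: le_trans ht _; rewrite ler_wpM2l// mulr_ge0.
apply: le_mul_scaled; first by rewrite mulr_ge0.
apply: le_add_scaled; last first.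
  by apply: le_mul_scaled => //; rewrite !mulr_ge0.
rewrite /bad_cst0; do ?apply: le_add_scaled => //; try by apply: le_cst_scaled.
- apply: le_mul_scaled => //; apply: le_add_scaled; last exact: le_cst_scaled.
  do 2 apply: le_mul_scaled => //.
  by apply: le_add_scaled; rewrite ler_wpM2l.
- by apply: le_cst_scaled => //; rewrite mulr_ge0// addr_ge0.
- apply: le_mul_scaled; first by rewrite !mulr_ge0.
  by rewrite mulrA ler_wpM2r.
Qed.

End Constants.

(** All constants are fixed before n, and largeness of n is expressed through y = ln ln n, so that
    the scales are y, y^2, L = e^y and n = e^L. *)
Lemma regret_eventually_le (R : realType) (d K M : nat)
    (A : 'I_M -> 'I_K -> 'cV[R]_d) (theta : 'cV[R]_d) (xstar : 'I_M -> 'I_K)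
    (hA : action_sets A) (hopt : optimal_arms A theta xstar)
    (hspan : spans [seq A m (xstar m) | m <- enum 'I_M])
    (p : 'I_M -> R) (c : R) (hp : forall m, 0 < p m) (hp1 : \sum_m p m = 1)
    (hc : 0 < c) (T : nat -> 'M[R]_(M, K) -> 'I_M -> 'I_K -> \bar R)
    (r : forall n, bandit_run A theta p n)
    (hoam : forall n,
       run_follows_oam (r n) c (T n) (fun t => 1 / ln (ln t%:R)))
    (g0 : R) (g0_gt0 : 0 < g0)
    (hgap : forall m i, i != xstar m -> g0 <= gaps A theta xstar m i) (h : R) :
  0 < h -> exists y0, forall n, y0 <= ln (ln (n%:R : R)) ->
  (forall D, nonneg_gaps D ->
     alloc_solution A (f_conf c d n (1 / n%:R)) D (T n D)) ->
  confidence (r n) c ->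
  (regret (r n) xstar <= (h * ln n%:R)%:E)%E.
Proof.
pose eps t : R := 1 / ln (ln t%:R).
pose f n := f_conf c d n (1 / n%:R).
move=> h0.
have [La1 La1_gt0 arm1] : exists2 C, 0 < C & forall x : 'I_M * ('I_M * 'I_K),
    exists2 k : 'I_K -> R, A x.2.1 x.2.2 = \sum_j k j *: A x.1 j &
    (\sum_j `|k j|) ^+ 2 <= C.
  apply: finite_coef_bound => x.
  exact: (spans_coef (action_spans hA x.1)).
have [La2 La2_gt0 star1] : exists2 C, 0 < C & forall x : 'I_M * 'I_K,
    exists2 k : 'I_M -> R, A x.1 x.2 = \sum_m k m *: A m (xstar m) &
    (\sum_m `|k m|) ^+ 2 <= C.
  apply: finite_coef_bound => x; exact: (spans_coef hspan).
pose Lam := La1 + La2.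
have Lam_gt0 : 0 < Lam by rewrite addr_gt0.
have arm_coef m m' i : exists2 k : 'I_K -> R,
    A m' i = \sum_j k j *: A m j & (\sum_j `|k j|) ^+ 2 <= Lam.
  have [k e kl] := arm1 (m, (m', i)); exists k => //.
  by apply: le_trans kl _; rewrite lerDl ltW.
have star_coef m' i : exists2 k : 'I_M -> R,
    A m' i = \sum_m k m *: A m (xstar m) & (\sum_m `|k m|) ^+ 2 <= Lam.
  have [k e kl] := star1 (m', i); exists k => //.
  by apply: le_trans kl _; rewrite lerDr ltW.
have [p0 p0_gt0 hp0] := finite_pos_lower_bound (Q := predT) (fun m _ => hp m).
have p01 m : 0 <= p m <= 1.
  rewrite ltW//= -hp1 (bigD1 m)//= lerDl sumr_ge0// => k _; exact: ltW.
pose rho := p0 / 4.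
have rho_gt0 : 0 < rho by rewrite divr_gt0.
have rho_p m : rho <= p m / 4 by rewrite ler_wpM2r// hp0.
pose Dt := gap_total A theta xstar.
have Dt0 : 0 <= Dt by exact: gap_total_ge0.
pose mk : R := (M * K)%:R.
have mk0 : 0 <= mk by [].
pose mk1 := mk + 1.
have mk1_gt0 : 0 < mk1 by move: mk0; rewrite /mk1; clear; lra.
pose iG := (g0 ^+ 2)^-1.
have iG0 : 0 < iG by rewrite invr_gt0 exprn_gt0.
(* With t0 about C0 L: the first summand gives exp (- rho t0) <= n^-2, the second makes [Nstar], at
   most 48 Lam iG L, no more than rho t0 / 2, and the third ensures C0 >= 1. *)
pose C0 := 2 / rho + 96 * Lam * iG / rho + 1.
have C01 : 1 <= C0.
  by rewrite /C0 lerDr addr_ge0// divr_ge0 ?(ltW rho_gt0)// !mulr_ge0// ltW.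
have C0_gt0 : 0 < C0 by apply: lt_le_trans C01.
have C0_rho : 2 <= rho * C0.
  have -> : rho * C0 = 2 + 96 * Lam * iG + rho.
    by rewrite /C0; field; rewrite gt_eqF.
  rewrite -addrA lerDl addr_ge0 ?(ltW rho_gt0)// !mulr_ge0// ltW//.
have C0_N : 96 * Lam * iG <= rho * C0.
  have -> : rho * C0 = 2 + 96 * Lam * iG + rho.
    by rewrite /C0; field; rewrite gt_eqF.
  by rewrite addrAC lerDr addr_ge0// ltW.
(* The first bound gives U <= rho t0 / 4, the second Dt U <= h L / 4, for the U chosen below. *)
pose eta := Num.min (rho / (8 * mk1)) (h / (16 * (Dt + 1) * C0 * mk1)).
have Dt1_gt0 : 0 < Dt + 1 by move: Dt0; clear; lra.
have eta_gt0 : 0 < eta.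
  by rewrite /eta lt_min !divr_gt0// !mulr_gt0.
have eta_rho : 8 * mk1 * eta <= rho.
  by rewrite mulrC -ler_pdivlMr ?mulr_gt0// /eta ge_min lexx.
have eta_h : 16 * (Dt + 1) * C0 * mk1 * eta <= h.
  by rewrite mulrC -ler_pdivlMr ?mulr_gt0// /eta ge_min lexx orbT.
pose E : R := 1 / ln (ln 3%:R).
have E0 : 0 <= E by rewrite divr_ge0// ltW// lnln_pos.
(* Beyond q one has ln ln s >= 1/eta; the maximum with 2 ensures s >= 3, where ln ln s > 0. *)
pose q := maxn (Num.truncn (expR (expR (1 / eta)))) 2.
have heta s : (q < s)%N -> eps s <= eta.
  rewrite gtn_max => /andP[qs s3]; rewrite /eps div1r -[leRHS]invrK lef_pV2 ?posrE ?invr_gt0 ?lnln_pos//.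
  have es : expR (expR (1 / eta)) <= s%:R.
    by apply: ltW; rewrite -truncn_lt_nat// expR_ge0.
  have h1 : expR (1 / eta) <= ln s%:R.
    rewrite -[leLHS]expRK; apply: ln_le_mono es; exact: expR_gt0.
  rewrite -div1r -[leLHS]expRK; apply: ln_le_mono h1; exact: expR_gt0.
pose ka := kappa c d.
have ka0 : 0 <= ka by apply: kappa_ge0; exact: ltW.
pose lC := ln (2 * C0).
have lC0 : 0 <= lC by apply: ln_ge0; move: C01; clear; lra.
pose Eq := E * q%:R.
have Eq0 : 0 <= Eq by rewrite mulr_ge0.
pose cA := good_cst d%:R mk iG lC ka Eq Lam.
pose cW := bad_cst d%:R mk iG ka Eq Lam C0 rho^-1.
have bc0_ge0 : 0 <= bad_cst0 d%:R mk iG ka Eq Lam.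
  rewrite /bad_cst0 !addr_ge0// !mulr_ge0//; try exact: ltW.
  - by rewrite addr_ge0// mulr_ge0// ltW.
  - by rewrite addr_ge0// !mulr_ge0// ?addr_ge0// ltW.
  - by rewrite addr_ge0.
have cW0 : 0 <= cW.
  have b1 : 0 <= iG * 3 by apply: mulr_ge0 => //; exact: ltW.
  have b2 : 0 <= mk * (iG * 3 + 1) by apply: mulr_ge0 => //; exact: addr_ge0.
  have b3 : 0 <= 16 * Lam * iG * 3 by rewrite !mulr_ge0// ltW.
  have b4 : 0 <= 2 * rho^-1 by rewrite mulr_ge0// invr_ge0 ltW.
  have b5 : 0 <= 2 * C0 by rewrite mulr_ge0// ltW.
  have b6 := mulr_ge0 b4 (addr_ge0 bc0_ge0 b3).
  by rewrite /cW /bad_cst; apply: addr_ge0 => //; rewrite !addr_ge0.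
have cA0 : 0 <= cA.
  rewrite /cA /good_cst !addr_ge0// !mulr_ge0//; try exact: ltW.
  - by rewrite addr_ge0// !mulr_ge0// ?addr_ge0// ?mulr_ge0// ltW.
  - by rewrite addr_ge0.
  - by rewrite addr_ge0.
pose cR := Dt * (1 + cW + 2 * M%:R + cW / (eta * C0) + 2 / rho).
have cR0 : 0 <= cR.
  have a1 : 0 <= cW / (eta * C0).
    by apply: divr_ge0 => //; apply: mulr_ge0; exact: ltW.
  have a2 : 0 <= 2 / rho by apply: divr_ge0 => //; apply: ltW.
  have a3 : 0 <= 2 * M%:R :> R by apply: mulr_ge0.
  by rewrite /cR; apply: mulr_ge0 => //; do 4 (apply: addr_ge0 => //).
(* The three parts ensure f <= 3 L, 4 F <= f and d <= L. *)
pose cB := 2 + ka + 2 * (4 + ka) + d%:R.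
have cB0 : 0 <= cB by rewrite /cB !addr_ge0// mulr_ge0// addr_ge0.
have eC0 : 0 < mk1 * eta * C0 by rewrite !mulr_gt0.
have [y1 y11 hy1] := sqr_le_expR cA0 eC0.
have [y2 y21 hy2] := sqr_le_expR cB0 (@ltr01 R).
have h20 : 0 < h / 2 by rewrite divr_gt0.
have [y3 y31 hy3] := sqr_le_expR cR0 h20.
(* This one is applied to L instead of ln L, to obtain t0 <= n. *)
have [y4 y41 hy4] := sqr_le_expR (mulr_ge0 (ler0n R 2) (ltW C0_gt0)) (@ltr01 R).
exists (y1 + y2 + y3 + y4) => n hn hTn hconfn.
set L := ln (n%:R : R) in hn *; set ell := ln L in hn *.
have e1 : 1 <= ell by move: hn y11 y21 y31 y41; clear; lra.
have e0 : 0 < ell by apply: lt_le_trans e1.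
have L0 : 0 < L := lnn_gt0 e1.
have eL : ell <= L := ell_le_lnn e1.
have L1 : 1 <= L by apply: le_trans eL.
have LE : L = expR ell := lnnE e1.
have nEL : n%:R = expR L := nE e1.
have k1 : cA * ell ^+ 2 <= mk1 * eta * C0 * L.
  by rewrite LE; apply: hy1; move: hn y21 y31 y41; clear; lra.
have k2 : cB * ell ^+ 2 <= L.
  by rewrite LE -[leRHS]mul1r; apply: hy2; move: hn y11 y31 y41; clear; lra.
have k3 : cR * ell ^+ 2 <= h / 2 * L.
  by rewrite LE; apply: hy3; move: hn y11 y21 y41; clear; lra.
have k4 : 2 * C0 * L ^+ 2 <= n%:R.
  by rewrite nEL -[leRHS]mul1r; apply: hy4; move: hn eL y11 y21 y31; clear; lra.
have ez : ell <= ell ^+ 2 by rewrite expr2 -[leLHS]mulr1 ler_wpM2l// ltW.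
have z1 : 1 <= ell ^+ 2 by apply: le_trans ez.
have kae : ka * ell <= ka * ell ^+ 2 by rewrite ler_wpM2l.
have [fL1 fL2] : 2 * L <= f n /\ f n <= 3 * L.
  have /andP[-> h2] := f_conf_n d (ltW hc) e1; split=> //.
  apply: le_trans h2 _; rewrite -/L -/ell -/ka.
  have : (2 + ka) * ell ^+ 2 <= cB * ell ^+ 2.
    rewrite ler_wpM2r ?sqr_ge0// /cB -[leRHS]addrA lerDl addr_ge0//.
    by rewrite mulr_ge0// addr_ge0.
  by move: k2 kae z1; clear; lra.
have dL : d%:R <= L.
  apply: le_trans k2; apply: (@le_trans _ _ (d%:R * ell ^+ 2)).
    exact: le_cst_scaled.
  by rewrite ler_wpM2r ?sqr_ge0// /cB lerDr !addr_ge0// mulr_ge0// addr_ge0.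
have f_gt0 : 0 < f n by apply: lt_le_trans fL1; rewrite mulr_gt0.
pose t0 := (Num.truncn (C0 * L)).+1.
have C0L : 1 <= C0 * L by rewrite -[leLHS]mul1r ler_pM.
have C0L0 : 0 <= C0 * L by apply: le_trans C0L.
have t01 : C0 * L <= t0%:R by apply: ltW; rewrite /t0 -truncn_lt_nat.
have t02 : t0%:R <= 2 * C0 * L.
  rewrite /t0 -natr1; have : (Num.truncn (C0 * L))%:R <= C0 * L by rewrite truncn_le.
  by move: C0L; clear; lra.
have t0_gt0 : 0 < t0%:R :> R by rewrite ltr0n.
have dt0 : (d <= t0)%N.
  rewrite -(ler_nat R) (le_trans dL)// (le_trans _ t01)// -[leLHS]mul1r.
  by rewrite ler_wpM2r// ltW.
have t0n : (t0 <= n)%N.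
  rewrite -(ler_nat R) (le_trans t02)// (le_trans _ k4)// expr2 mulrA.
  by rewrite -[leLHS]mulr1 ler_wpM2l// mulr_ge0 ?(ltW L0)// mulr_ge0// ltW.
have dn : (d <= n)%N by rewrite (leq_trans dt0).
have n_gt1 : (1 < n)%N.
  rewrite ltnNge; apply/negP => n1.
  have : L <= 0 by apply: ln_le0; rewrite -[leRHS]/(1%:R) ler_nat.
  by move: L0; clear; lra.
pose F := f_conf c d n (1 / L).
have /andP[F0 F1] : 0 <= F <= (4 + ka) * ell := f_conf_lnn d (ltW hc) e1.
have Ff : 4 * F <= f n.
  apply: le_trans fL1.
  have h1 : (4 + ka) * ell <= (4 + ka) * ell ^+ 2 by rewrite ler_wpM2l// addr_ge0.
  have h2 : 2 * (4 + ka) * ell ^+ 2 <= cB * ell ^+ 2.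
    rewrite ler_wpM2r ?sqr_ge0// /cB.
    by move: ka0 (ler0n R d); clear; lra.
  by move: F1 h1 h2 k2; clear; lra.
pose g1 := 8 * lC + 8 * ell + ka * ell.
have kae0 : 0 <= ka * ell by rewrite mulr_ge0// ltW.
have g1_ge0 : 0 <= g1.
  by move: lC0 e0 kae0; rewrite /g1; clear; lra.
have hg1 k : (2 <= k <= t0)%N -> f_conf c d n (1 / k%:R ^+ 2) <= g1.
  move=> /andP[k2' kt]; have k1' := ltnW k2'.
  apply: le_trans (f_conf_sqr d (ltW hc) e1 k1') _; rewrite -/ka -/L -/ell /g1 lerD2r.
  have : ln (k%:R : R) <= lC + ell.
    rewrite /lC /ell -lnM ?posrE ?mulr_gt0//.
    apply: ln_le_mono; first by rewrite ltr0n.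
    by apply: le_trans t02; rewrite ler_nat.
  by clear; lra.
pose g2 := 8 * L + ka * ell.
have g2_ge0 : 0 <= g2 by rewrite /g2 addr_ge0// mulr_ge0// ltW.
have hg2 k : (2 <= k <= n)%N -> f_conf c d n (1 / k%:R ^+ 2) <= g2.
  move=> /andP[k2' kt]; have k1' := ltnW k2'.
  apply: le_trans (f_conf_sqr d (ltW hc) e1 k1') _; rewrite -/ka -/L -/ell /g2 lerD2r.
  have : ln (k%:R : R) <= L.
    by apply: ln_le_mono; rewrite ?ltr0n// ler_nat.
  by clear; lra.
have heps s : (3 <= s <= n)%N -> 0 < eps s /\ (eps s)^-1 <= ell.
  move=> /andP[s3 sn]; rewrite /eps div1r invr_gt0 invrK lnln_pos//; split=> //.
  by apply: lnln_mono; rewrite s3.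
have hE s : (3 <= s <= n)%N -> eps s <= E.
  move=> /andP[s3 sn]; rewrite /eps /E !div1r lef_pV2 ?posrE ?lnln_pos//.
  exact: lnln_mono.
have heta' s : (q < s <= n)%N -> eps s <= eta by move=> /andP[/heta].
(* One half absorbs the eta t0 terms of UCB failures and forced exploration, the other the terms of
   order ell^2. *)
pose U := 2 * mk1 * eta * t0%:R.
have et0 : 0 < eta * t0%:R by rewrite mulr_gt0.
have U0 : 0 <= U by rewrite /U !mulr_ge0// ltW.
have hU : d%:R + (M * K)%:R * (4 * g1 / g0 ^+ 2 + 1) + (1 + eta * t0%:R) +
    (M * K)%:R * (E * q%:R + eta * t0%:R + 1) + 2 +
    (4 * F * Lam / g0 ^+ 2 * ell + 1) <= U.
  have h1 := good_cst_le (ler0n R d) mk0 (ltW iG0) lC0 ka0 Eq0 (ltW Lam_gt0) e1 F1.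
  have h2 : mk1 * eta * C0 * L <= mk1 * eta * t0%:R.
    by rewrite -[leLHS]mulrA ler_wpM2l// mulr_ge0// ltW.
  have h3 := le_trans h1 (le_trans k1 h2).
  rewrite -/mk -/iG -/Eq [leRHS](_ : U = mk1 * eta * t0%:R + mk1 * eta * t0%:R).
    apply: le_trans (lerD h3 (lexx _)); rewrite le_eqVlt; apply/orP; left.
    by apply/eqP; rewrite /g1 /mk1; ring.
  by rewrite /U; ring.
have hNU : 16 * Lam * f n / g0 ^+ 2 + U <= rho * t0%:R.
  rewrite -/iG.
  have h1 : 16 * Lam * iG * f n <= 16 * Lam * iG * (3 * L).
    by rewrite ler_wpM2l// !mulr_ge0// ltW.
  have h2 : 96 * Lam * iG * L <= rho * C0 * L by rewrite ler_wpM2r// ltW.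
  have h3 : rho * C0 * L <= rho * t0%:R.
    by rewrite -[leLHS]mulrA ler_wpM2l// ltW.
  have h4 : 8 * mk1 * eta * t0%:R <= rho * t0%:R by rewrite ler_wpM2r// ltW.
  rewrite (_ : 16 * Lam * f n * iG = 16 * Lam * iG * f n); last by ring.
  have h5 : 0 <= rho * t0%:R by rewrite mulr_ge0// ltW.
  by rewrite /U; move: h1 h2 h3 h4 h5; clear; lra.
pose W := cW * (L * ell).
have W0 : 0 <= W by rewrite /W !mulr_ge0// ltW.
have hW : d%:R + (t0%:R + 1 + 2 * (d%:R + (M * K)%:R * (f n / g0 ^+ 2 + 1) +
    (M * K)%:R * (4 * g2 / g0 ^+ 2 + 1) + 1 + (M * K)%:R * (E * q%:R + 1) + 2 +
    (4 * f n * Lam / g0 ^+ 2 * ell + 1) + 16 * Lam * f n / g0 ^+ 2) / rho) +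
    (M * K)%:R * (f n / g0 ^+ 2 + 1) <= W.
  have ir0 : 0 <= rho^-1 by rewrite invr_ge0 ltW.
  have := bad_cst_le (ler0n R d) mk0 (ltW iG0) ka0 Eq0 (ltW Lam_gt0) (ltW C0_gt0)
    ir0 e1 eL fL2 t02.
  apply: le_trans; rewrite -/mk -/iG -/Eq le_eqVlt; apply/orP; left; apply/eqP.
  by rewrite /g2; ring.
have eLs : ell < L by exact: ln_sublinear.
have L1s : 1 < L by apply: le_lt_trans eLs.
have delta01 : 0 < (1 : R) / L < 1.
  by rewrite divr_gt0//= ltr_pdivrMr// mul1r.
pose qc := expR (- (2 * L)).
have hqc : expR (- (rho * t0%:R)) <= qc.
  rewrite /qc ler_expR lerN2; apply: (@le_trans _ _ (rho * C0 * L)).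
    by rewrite ler_wpM2r// ltW.
  by rewrite -[leLHS]mulrA ler_wpM2l// ltW.
have eta_rho' : 2 * ((M * K)%:R * eta) <= rho.
  rewrite -/mk; apply: le_trans eta_rho; rewrite /mk1.
  have : 0 <= mk * eta by rewrite mulr_ge0// ltW.
  by move: eta_gt0; clear; lra.
have t0d : (d <= t0 <= n)%N by rewrite dt0.
apply: (le_trans (regret_fixed_horizon (action_inj hA) hopt hspan f_gt0 dn hTn
  g0_gt0 hgap Lam_gt0 arm_coef star_coef (hoam n) hconfn t0d (erefl F) F0 Ff
  g1_ge0 hg1 g2_ge0 hg2 (ltW e0) heps E0 hE eta_gt0 heta' rho_gt0 eta_rho'
  hU hNU hW n_gt1 delta01 p01 rho_p hqc (ltn0Sn _) U0 W0)).
rewrite lee_fin -/Dt.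
have n0 : 0 <= n%:R :> R by [].
have s1 : n%:R * (n.+1%:R * M%:R * qc) <= 2 * M%:R.
  have q1 : n%:R * n%:R * qc = 1.
    by rewrite nEL /qc -!expRD -[RHS]expR0; congr expR; clear; lra.
  have n2 : n.+1%:R <= 2 * n%:R :> R.
    rewrite -natr1; have : 1 <= n%:R :> R by rewrite ler1n ltnW.
    by clear; lra.
  have : n.+1%:R * (n%:R * M%:R * qc) <= 2 * n%:R * (n%:R * M%:R * qc).
    by rewrite ler_wpM2r// !mulr_ge0// expR_ge0.
  rewrite (_ : 2 * n%:R * (n%:R * M%:R * qc) = 2 * M%:R * (n%:R * n%:R * qc)).
    rewrite q1 mulr1; apply: le_trans; rewrite le_eqVlt; apply/orP; left.
    by apply/eqP; ring.
  by ring.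
have s2 : W * (1 / L) = cW * ell by rewrite /W; field; rewrite gt_eqF.
have s3 : W / (eta * t0%:R) <= cW / (eta * C0) * ell.
  rewrite ler_pdivrMr//.
  have -> : cW / (eta * C0) * ell * (eta * t0%:R) = cW * ell / C0 * t0%:R.
    by field; rewrite !gt_eqF.
  have -> : W = cW * ell / C0 * (C0 * L) by rewrite /W; field; rewrite gt_eqF.
  by rewrite ler_wpM2l// divr_ge0 ?(ltW C0_gt0)// mulr_ge0// ltW.
have s4 : 4 * (Dt * U) <= h * L.
  have x0 : 0 <= C0 * mk1 * eta by rewrite !mulr_ge0// ltW.
  have h1 : 16 * Dt * C0 * mk1 * eta <= h by move: eta_h x0; clear; lra.
  have h2 : 16 * Dt * C0 * mk1 * eta * L <= h * L by rewrite ler_wpM2r// ltW.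
  apply: le_trans h2.
  have h3 : 8 * Dt * mk1 * eta * t0%:R <= 8 * Dt * mk1 * eta * (2 * C0 * L).
    by rewrite ler_wpM2l// !mulr_ge0// ltW.
  by rewrite /U; move: h3; clear; lra.
have s5 : Dt * (1 + cW * ell + 2 * M%:R + cW / (eta * C0) * ell + 2 / rho) <=
    cR * ell ^+ 2.
  rewrite /cR; apply: le_mul_scaled => //; do ?apply: le_add_scaled.
  - exact: le_cst_scaled.
  - by rewrite ler_wpM2l.
  - by apply: le_cst_scaled => //; rewrite mulr_ge0.
  - by rewrite ler_wpM2l// divr_ge0// mulr_ge0// ltW.
  - by apply: le_cst_scaled => //; rewrite divr_ge0// ltW.
have s6 : Dt * (1 + W * (1 / L) + n%:R * (n.+1%:R * M%:R * qc) +
    (W / (eta * t0%:R) + 2 / rho)) <= 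
    Dt * (1 + cW * ell + 2 * M%:R + cW / (eta * C0) * ell + 2 / rho).
  by rewrite ler_wpM2l//; move: s1 s3; rewrite s2; clear; lra.
have h5 := le_trans s6 (le_trans s5 k3).
have hL0 : 0 <= h * L by rewrite mulr_ge0// ltW.
rewrite (_ : Dt * _ = Dt * U + Dt * (1 + W * (1 / L) +
   n%:R * (n.+1%:R * M%:R * qc) + (W / (eta * t0%:R) + 2 / rho))); last by ring.
by move: s4 h5 hL0; clear; lra.
Qed.

(** * Vanishing of the constant and of the normalised regret *)

Theorem mainTheorem4 (R : realType) (d K M : nat)
    (A : 'I_M -> 'I_K -> 'cV[R]_d) (theta : 'cV[R]_d) (xstar : 'I_M -> 'I_K)
    (hA : action_sets A)
    (hopt : optimal_arms A theta xstar)
    (hspan : spans [seq A m (xstar m) | m <- enum 'I_M]) :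
  C_const A theta xstar = 0%E /\
  forall (p : 'I_M -> R) (hp : forall m, 0 < p m) (hp1 : \sum_m p m = 1)
    (c : R) (hc : 0 < c)
    (T : nat -> 'M[R]_(M, K) -> 'I_M -> 'I_K -> \bar R)
    (hT : \forall n \near \oo, forall D, nonneg_gaps D ->
       alloc_solution A (f_conf c d n (1 / n%:R)) D (T n D))
    (hTuniq : \forall n \near \oo, forall alpha,
       alloc_solution A (f_conf c d n (1 / n%:R)) (gaps A theta xstar) alpha ->
       alpha = T n (gaps A theta xstar))
    (hTcont : \forall n \near \oo, forall m i,
       T n D m i @[D --> within (@nonneg_gaps R K M)
                                (nbhs (gaps A theta xstar))]
       --> T n (gaps A theta xstar) m i)
    (r : forall n, bandit_run A theta p n)
    (hconf : \forall n \near \oo, confidence (r n) c)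
    (hoam : forall n,
       run_follows_oam (r n) c (T n) (fun t => 1 / ln (ln t%:R))),
  limn_einf (fun n => (regret (r n) xstar * (1 / ln n%:R)%:E)%E) = 0%E.
Proof.
split; first exact: C_const_eq0.
move=> p hp hp1 c hc T hT hTuniq _ r hconf hoam.
have fpos : \forall n \near \oo, 0 < f_conf c d n (1 / n%:R).
  apply: filterS (lnln_near (1 : R)) => n h1.
  have /andP[h2 _] := f_conf_n d (ltW hc) h1.
  by apply: lt_le_trans h2; rewrite mulr_gt0// lnn_gt0.
(* Uniqueness at a single horizon is enough to separate the gaps from 0, since the gaps do not
   depend on n. *)
have [n1 [f1 u1]] := filter_ex (filterI fpos hTuniq).
have [g0 g0_gt0 hg0] := finite_pos_lower_bound
  (Q := fun u : 'I_M * 'I_K => u.2 != xstar u.1)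
  (F := fun u => gaps A theta xstar u.1 u.2)
  (fun u nu => unique_optimal_arm hspan f1 hopt u1 nu).
have hgap m i : i != xstar m -> g0 <= gaps A theta xstar m i.
  exact: hg0 (m, i).
pose u n := (regret (r n) xstar * (1 / ln (n%:R : R))%:E)%E.
have key (h : R) : 0 < h -> \forall n \near \oo, (0 <= u n)%E /\ (u n <= h%:E)%E.
  move=> h0; have [y0 hy0] :=
    regret_eventually_le hA hopt hspan hp hp1 hc hoam g0_gt0 hgap h0.
  near=> n; have L0 : 0 < ln (n%:R : R).
    by apply: lnn_gt0; near: n; exact: lnln_near.
  have iL0 : (0 <= (1 / ln (n%:R : R))%:E)%E by rewrite lee_fin divr_ge0// ltW.
  split; first by rewrite mule_ge0// regret_ge0.
  have -> : h%:E = ((h * ln n%:R)%:E * (1 / ln n%:R)%:E)%E.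
    by rewrite -EFinM; congr (_%:E); field; rewrite gt_eqF.
  apply: lee_wpmul2r => //; apply: hy0; last 2 first.
  - by near: n.
  - by near: n.
  - by near: n; exact: lnln_near.
(* The normalised regret is eventually between 0 and any h > 0, so it converges and its lower limit
   is its limit. *)
suff /cvg_limn_einf_sup[-> _] : u @ \oo --> 0%E by [].
apply/fine_cvgP; split.
  near=> n; have [h1 h2] : (0 <= u n)%E /\ (u n <= (1 : R)%:E)%E.
    by near: n; exact: key.
  by rewrite ge0_fin_numE//; apply: le_lt_trans h2 _; rewrite ltry.
apply/cvgrPdist_le => e e0; near=> n.
have [h1 h2] : (0 <= u n)%E /\ (u n <= e%:E)%E by near: n; exact: key.
rewrite sub0r normrN /=; case: (u n) h1 h2 => //= x; rewrite !lee_fin => x0 xe.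
by rewrite ger0_norm.
Unshelve. all: by end_near. Qed.
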